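(* Assume (H1), and fix $u_i\in\mathcal U$ and $\bar u\in C([0,T];\mathbb R^{n_1})$. Then: (i) $f\mapsto\bar J_i(u_i,f)$ has a unique maximizer $\hat f$ over $L^2(0,T;\mathbb R^n)$; (ii) the system $dx_i=(Ax_i+Bu_i+Gm_i+\gamma p_i)dt+DdW_i$, $\dot m_i=(A+G)m_i+B\bar u+\gamma p_i$, $\dot p_i=-(A+G)^Tp_i-(I-\Gamma)^TQ[\mathbb Ex_i-(\Gamma m_i+\eta)]$, with $x_i(0)$ given, $m_i(0)=m_0$, $p_i(T)=H\,\mathbb Ex_i(T)$, has a unique solution $(x_i,m_i,p_i)\in L^2_{\mathcal F}(0,T;\mathbb R^n)\times L^2(0,T;\mathbb R^{2n})$ (with $m_i,p_i$ deterministic), and $\hat f=\gamma p_i$.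
   Context: Fix integers $n,n_1,n_2\ge1$, $T>0$, constant matrices $A,G,\Gamma\in\mathbb R^{n\times n}$, $B\in\mathbb R^{n\times n_1}$, $D\in\mathbb R^{n\times n_2}$, $\eta,m_0\in\mathbb R^n$, $\gamma>0$, symmetric $Q\ge0$, $H\ge0$ ($n\times n$), $R>0$ ($n_1\times n_1$). Write $|z|_M^2=z^TMz$, $\widehat Q=(I-\Gamma)^TQ(I-\Gamma)$, $\|h\|_{L^2}=(\int_0^T|h|^2dt)^{1/2}$. $W_i$ is an $n_2$-dimensional standard Brownian motion with natural filtration $\{\mathcal F_t\}$, $\mathcal U=L^2_{\mathcal F}(0,T;\mathbb R^{n_1})$. Fix deterministic $x_i(0)\in\mathbb R^n$. For $u_i\in\mathcal U$, $f\in L^2(0,T;\mathbb R^n)$ let $dx_i=(Ax_i+Bu_i+Gm_i+f)dt+DdW_i$, $\dot m_i=(A+G)m_i+B\bar u+f$, $m_i(0)=m_0$, and $\bar J_i(u_i,f)=\mathbb E\int_0^T\{|x_i-(\Gamma m_i+\eta)|_Q^2+u_i^TRu_i-\frac1\gamma|f|^2\}dt+\mathbb E\,x_i(T)^THx_i(T)$. For $g\in L^2(0,T;\mathbb R^n)$ let $\dot z=(A+G)z+g$, $z(0)=0$, $\bar J''(g)=\int_0^T\{-z^T\widehat Qz+\frac1\gamma|g|^2\}dt-z(T)^THz(T)$. (H1): there exists $\epsilon_0>0$ with $\bar J''(g)\ge\epsilon_0\|g\|_{L^2}^2$ for all $g$. *)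

(* Defs.v *)
From HB Require Import structures.
From mathcomp Require Import all_boot all_order all_algebra.
From mathcomp Require Import all_classical all_reals all_analysis.
From Stdlib Require Import ClassicalEpsilon.

Set Implicit Arguments.
Unset Strict Implicit.
Unset Printing Implicit Defensive.

Import Order.TTheory GRing.Theory Num.Theory.
Import numFieldNormedType.Exports.

Local Open Scope classical_set_scope.
Local Open Scope ring_scope.

Section LQDefs.
Context {R : realType}.
Notation leb := (@lebesgue_measure R).

Definition Icc (a b : R) : set R := `[a, b]%classic.

Definition sqn {k} (v : 'cV[R]_k) : R := (v^T *m v) 0 0.
Definition qf {k} (M : 'M[R]_k) (v : 'cV[R]_k) : R := (v^T *m M *m v) 0 0.

Definition symmetric_mx {k} (M : 'M[R]_k) : Prop := M^T = M.
Definition psd {k} (M : 'M[R]_k) : Prop := symmetric_mx M /\ forall v, 0 <= qf M v.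
Definition pd {k} (M : 'M[R]_k) : Prop :=
  symmetric_mx M /\ forall v : 'cV[R]_k, v != 0 -> 0 < qf M v.

Definition intv {k} (a b : R) (f : R -> 'cV[R]_k) : 'cV[R]_k :=
  \col_j (\int[leb]_(s in Icc a b) f s j 0).

Definition L2det {k} (T : R) (f : R -> 'cV[R]_k) : Prop :=
  (forall j, measurable_fun (Icc 0 T) (fun t => f t j 0)) /\
  (\int[leb]_(t in Icc 0 T) (sqn (f t))%:E < +oo)%E.

Definition L2sq {k} (T : R) (f : R -> 'cV[R]_k) : R :=
  fine (\int[leb]_(t in Icc 0 T) (sqn (f t))%:E)%E.

Definition ae_eq_on {k} (T : R) (f g : R -> 'cV[R]_k) : Prop :=
  {ae leb, forall t, Icc 0 T t -> f t = g t}.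

Definition cont_on {k} (T : R) (f : R -> 'cV[R]_k) : Prop :=
  forall j, {within `[0, T], continuous (fun t => f t j 0)}.

Section Stoch.
Context {d : measure_display} {Om : measurableType d} (P : probability Om R).

Definition natF {k} (W : R -> Om -> 'cV[R]_k) (t : R) : set (set Om) :=
  <<s [set A | exists (r : R) (j : 'I_k) (B : set R),
        [/\ 0 <= r <= t, measurable B & A = [set w | B (W r w j 0)]]] >>.

(* W is a k-dimensional standard Brownian motion (time t >= 0):
   W_0 = 0, continuous paths, and for 0 <= s < t the increment W_t - W_s
   is independent of F_s with law N(0,(t-s) I_k) (independent N(0,t-s)
   components).  The last clause expresses exactly this:
   P(A /\ {W_t - W_s in B_1 x ... x B_k}) = P(A) * prod_j N(0,t-s)(B_j). *)
Definition std_BM {k} (W : R -> Om -> 'cV[R]_k) : Prop :=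
  [/\ (forall t (j : 'I_k), measurable_fun setT (fun w => W t w j 0)),
      (forall w, W 0 w = 0),
      (forall w (j : 'I_k), {within `[0, +oo[, continuous (fun t => W t w j 0)}) &
      (forall s t, 0 <= s -> s < t -> forall A, natF W s A ->
        forall B : 'I_k -> set R, (forall j, measurable (B j)) ->
        P (A `&` [set w | forall j, B j (W t w j 0 - W s w j 0)])
        = (fine (P A) * \prod_(j < k) fine (normal_prob 0 (Num.sqrt (t - s)) (B j)))%:E)].

Definition L2F {k l} (W : R -> Om -> 'cV[R]_k) (T : R) (x : R -> Om -> 'cV[R]_l) : Prop :=
  [/\ (forall j, measurable_fun (Icc 0 T `*` setT)
                   (fun z : R * Om => x z.1 z.2 j 0)),
      (forall t, 0 <= t <= T -> forall j (B : set R), measurable B ->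
          natF W t [set w | B (x t w j 0)]) &
      (\int[P]_w (\int[leb]_(t in Icc 0 T) (sqn (x t w))%:E) < +oo)%E].

Definition L2F_eq {l} (T : R) (x y : R -> Om -> 'cV[R]_l) : Prop :=
  (\int[P]_w (\int[leb]_(t in Icc 0 T) (sqn (x t w - y t w))%:E) = 0)%E.

Definition Ev {l} (X : Om -> 'cV[R]_l) : 'cV[R]_l :=
  \col_j fine ('E_P[fun w => X w j 0]).

Variables (n n1 n2 : nat) (T : R) (A G Gam Q H : 'M[R]_n) (B : 'M[R]_(n, n1))
  (D : 'M[R]_(n, n2)) (Rw : 'M[R]_n1) (eta m0 x0 : 'cV[R]_n) (gam : R)
  (W : R -> Om -> 'cV[R]_n2).

(* state equations, for given u, ubar, f:
   dx = (A x + B u + G m + f) dt + D dW, x(0) = x0  (additive noise, so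
   in integral form the stochastic integral is D (W_t - W_0) = D W_t);
   m' = (A+G) m + B ubar + f, m(0) = m0. *)
Definition state_sol (u : R -> Om -> 'cV[R]_n1) (ubar : R -> 'cV[R]_n1)
  (f : R -> 'cV[R]_n) (x : R -> Om -> 'cV[R]_n) (m : R -> 'cV[R]_n) : Prop :=
  [/\ L2det T m,
      (forall t, 0 <= t <= T ->
         m t = m0 + intv 0 t (fun s => (A + G) *m m s + B *m ubar s + f s)),
      L2F W T x &
      {ae P, forall w, forall t, 0 <= t <= T ->
         x t w = x0 + intv 0 t (fun s => A *m x s w + B *m u s w + G *m m s + f s)
                 + D *m W t w}].

Definition cost (u : R -> Om -> 'cV[R]_n1) (f : R -> 'cV[R]_n)
  (x : R -> Om -> 'cV[R]_n) (m : R -> 'cV[R]_n) : R :=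
  fine (\int[P]_w (\int[leb]_(t in Icc 0 T) (qf Q (x t w - (Gam *m m t + eta)))%:E))%E
  + fine (\int[P]_w (\int[leb]_(t in Icc 0 T) (qf Rw (u t w))%:E))%E
  - gam^-1 * L2sq T f
  + fine ('E_P[fun w => qf H (x T w)])%E.

(* bar J_i(u_i, f), evaluated along the (a.s. unique) solution of the
   state equations *)
Definition Jbar (u : R -> Om -> 'cV[R]_n1) (ubar : R -> 'cV[R]_n1)
  (f : R -> 'cV[R]_n) : R :=
  let xm := epsilon (inhabits ((fun _ _ => 0), (fun _ => 0)))
              (fun xm : (R -> Om -> 'cV[R]_n) * (R -> 'cV[R]_n) =>
                 state_sol u ubar f xm.1 xm.2) in
  cost u f xm.1 xm.2.

Definition fb_sol (u : R -> Om -> 'cV[R]_n1) (ubar : R -> 'cV[R]_n1)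
  (x : R -> Om -> 'cV[R]_n) (m p : R -> 'cV[R]_n) : Prop :=
  [/\ [/\ L2F W T x, L2det T m & L2det T p],
      {ae P, forall w, forall t, 0 <= t <= T ->
         x t w = x0 + intv 0 t (fun s => A *m x s w + B *m u s w + G *m m s + gam *: p s)
                 + D *m W t w},
      (forall t, 0 <= t <= T ->
         m t = m0 + intv 0 t (fun s => (A + G) *m m s + B *m ubar s + gam *: p s)) &
      (forall t, 0 <= t <= T ->
         p t = H *m Ev (x T) + intv t T (fun s => (A + G)^T *m p s
                 + (1 - Gam)^T *m Q *m (Ev (x s) - (Gam *m m s + eta))))].

End Stoch.

Definition z_sol {n} (T : R) (A G : 'M[R]_n) (g z : R -> 'cV[R]_n) : Prop :=
  L2det T z /\ forall t, 0 <= t <= T -> z t = intv 0 t (fun s => (A + G) *m z s + g s).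

Definition Jpp {n} (T : R) (Gam Q H : 'M[R]_n) (gam : R) (g z : R -> 'cV[R]_n) : R :=
  - fine (\int[leb]_(t in Icc 0 T) (qf ((1 - Gam)^T *m Q *m (1 - Gam)) (z t))%:E)%E
  + gam^-1 * L2sq T g - qf H (z T).

Definition H1 {n} (T : R) (A G Gam Q H : 'M[R]_n) (gam : R) : Prop :=
  exists eps0 : R, 0 < eps0 /\
    forall g z, L2det T g -> z_sol T A G g z -> eps0 * L2sq T g <= Jpp T Gam Q H gam g z.

End LQDefs.

(* Main.v *)
Require Import Defs.
From HB Require Import structures.
From mathcomp Require Import all_boot all_order all_algebra.
From mathcomp Require Import all_classical all_reals all_analysis.
From mathcomp Require Import measurable_realfun ring lra.

(** For an L^2 control g, adding g to f shifts x and m by the same deterministic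
z, the solution of z' = (A + G) z + g with z(0) = 0.  If (x, m, p) solves the
forward-backward system, the part of J(gamma p + g) - J(gamma p) which is linear
in g vanishes by the duality between the equations of p and z, so
J(gamma p + g) = J(gamma p) - J''(g).  By (H1) this makes gamma p the unique
maximizer, and it forces two solutions of the system to have the same p, hence
the same m and x.

For existence, start from the state (x, m) with f = 0 and look for the solution
in the form (x + z, m + z, p): this leaves a linear two-point boundary value
problem for (z, p), solved by shooting on p(0).  The shooting map is a square
matrix whose kernel consists of the homogeneous solutions; for these J'' vanishes
at g = gamma p, so (H1) kills them.

The filtration is not completed, so solving the state equation requires an
exactly adapted version of the integral over [0, t] of an adapted square-integrable
process.  It is obtained as an upper limit of Riemann sums with greedily chosen
nodes. *)

Import Order.TTheory GRing.Theory Num.Theory.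
Import numFieldNormedType.Exports.
Local Open Scope classical_set_scope.
Local Open Scope ring_scope.

Set Implicit Arguments.
Unset Strict Implicit.
Unset Printing Implicit Defensive.

#[local] Hint Extern 0 (_.-measurable (Icc _ _)) => exact: measurable_itv : core.

(** * Absolutely continuous functions on [0, T] *)

Section AbsolutelyContinuous.
Context {R : realType}.
Notation leb := (@lebesgue_measure R).
Implicit Types (T t : R) (f g a b : R -> R).

(** Controls are merely square integrable, so no equation holds in the classical sense. An equation
    is therefore handled as a function paired with an integrable density ([abscont]), and the
    calculus rests on the product rule for such pairs. With the matrix exponential it gives
    variation of constants, uniqueness ([mexp (- M) t *m v t] is conserved) and the duality between
    [p] and [z]. The noise is additive: along almost every path [x - D W] is absolutely continuous
    and solves a linear equation with a forcing term, so no stochastic integral occurs. Since the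
    perturbation [z] is deterministic, the process enters the part of the cost linear in [g] through
    its mean; this is why a deterministic [p] can cancel that part. [Jbar] is evaluated along a
    solution picked by [epsilon], so it can be computed once the state is known to be unique up to
    null sets. The coercivity in (H1) yields a quadratic gap between [Jbar] at [gam *: p] and at any
    other control; both uniqueness statements are read off this gap. *)

Definition L1 T f := leb.-integrable (Icc 0 T) (EFin \o f).

(** The class of multipliers that preserve [L1]; every primitive of an integrable function belongs
    to it, so products of a primitive with a density stay integrable. *)
Definition bounded_meas T f := measurable_fun (Icc 0 T) f /\
  exists K, forall t, Icc 0 T t -> `|f t| <= K.

Lemma leb_Icc_lty (a b : R) : (leb (Icc a b) < +oo)%E.
Proof. by rewrite /Icc lebesgue_measure_itv /=; case: ifP => // _; exact: ltry. Qed.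

Lemma L1D T f g : L1 T f -> L1 T g -> L1 T (fun t => f t + g t).
Proof.
move=> Lf Lg; rewrite /L1.
by have := integrableD _ Lf Lg; apply; exact: measurable_itv.
Qed.

Lemma L1Z T k f : L1 T f -> L1 T (fun t => k * f t).
Proof.
move=> Lf; rewrite /L1.
by have := integrableZl _ k Lf; apply; exact: measurable_itv.
Qed.

Lemma L1N T f : L1 T f -> L1 T (fun t => - f t).
Proof.
move=> Lf; rewrite /L1.
exact: (integrableN Lf).
Qed.

Lemma L1_0 T : L1 T (fun=> 0).
Proof. exact: integrable0. Qed.

Lemma L1_sum T (I : Type) (s : seq I) (F : I -> R -> R) :
  (forall i, L1 T (F i)) -> L1 T (fun t => \sum_(i <- s) F i t).
Proof.
move=> LF; elim: s => [|i s IH].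
  by apply: eq_integrable (L1_0 T) => // t _ /=; rewrite big_nil.
by apply: eq_integrable (L1D (LF i) IH) => // t _ /=; rewrite big_cons.
Qed.

Lemma eq_L1 T f g : (forall t, Icc 0 T t -> f t = g t) -> L1 T f -> L1 T g.
Proof.
move=> fg; apply: eq_integrable => // t; rewrite inE => /fg /= ->.
by [].
Qed.

Lemma L1_le T t f : t <= T -> L1 T f -> L1 t f.
Proof.
move=> tT; apply: integrableS => //.
by apply: (@subset_itvl _ _ (BLeft 0)); rewrite bnd_simp.
Qed.

Lemma boundedE T f K : (forall t, Icc 0 T t -> `|f t| <= K) ->
  [bounded f x | x in Icc 0 T].
Proof.
move=> fK; exists K; split; first exact: num_real.
by move=> M KM t Tt; exact: le_trans (fK t Tt) (ltW KM).
Qed.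

Lemma bounded_meas_L1 T f : bounded_meas T f -> L1 T f.
Proof.
move=> [mf [K fK]]; apply: measurable_bounded_integrable => //.
  exact: leb_Icc_lty.
exact: boundedE fK.
Qed.

Lemma L1_mul T f g : bounded_meas T f -> L1 T g -> L1 T (fun t => f t * g t).
Proof.
move=> [mf [K fK]] Lg; rewrite /L1.
exact: (@integrableMr _ _ _ leb (Icc 0 T) (measurable_itv _) f _ mf (boundedE fK) Lg).
Qed.

Lemma eq_int t f g : (forall s, Icc 0 t s -> f s = g s) ->
  \int[leb]_(s in Icc 0 t) f s = \int[leb]_(s in Icc 0 t) g s.
Proof. by move=> fg; apply: eq_Rintegral => s; rewrite inE => /fg. Qed.

Lemma Icc0_nil : Icc 0 0 = [set (0 : R)].
Proof. by rewrite /Icc set_itv1. Qed.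

Lemma int_00 f : \int[leb]_(s in Icc 0 0) f s = 0.
Proof. by rewrite Icc0_nil Rintegral_set1. Qed.

Lemma Icc_le T t s : t <= T -> Icc 0 t s -> Icc 0 T s.
Proof.
by rewrite /Icc /= !in_itv /= => tT /andP[-> st] /=; exact: le_trans tT.
Qed.

Lemma IccP (a b t : R) : Icc a b t <-> a <= t <= b.
Proof. by rewrite /Icc /= in_itv. Qed.

Lemma bounded_meas_int T f : 0 <= T -> L1 T f ->
  bounded_meas T (fun t => \int[leb]_(s in Icc 0 t) f s).
Proof.
move=> T0 Lf; split.
  apply: subspace_continuous_measurable_fun; first exact: measurable_itv.
  exact: parameterized_integral_continuous.
exists (\int[leb]_(s in Icc 0 T) `|f s|) => t /IccP/andP[t0 tT].
have Lt := L1_le tT Lf.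
apply: le_trans (le_normr_Rintegral _ Lt) _ => //.
rewrite -lee_fin /Rintegral !fineK; last 2 first.
- by apply: integrable_fin_num => //; exact: integrable_norm Lf.
- by apply: integrable_fin_num => //; exact: integrable_norm Lt.
apply: ge0_subset_integral => //.
- apply/measurable_EFinP; apply: measurableT_comp => //.
  by apply/measurable_EFinP; exact: measurable_int Lf.
- by apply: (@subset_itvl _ _ (BLeft 0)); rewrite bnd_simp.
Qed.

Lemma int_split T t f : 0 <= t <= T -> L1 T f ->
  \int[leb]_(s in Icc 0 T) f s =
  \int[leb]_(s in Icc 0 t) f s + \int[leb]_(s in `]t, T]) f s.
Proof.
move=> /andP[t0 tT] Lf.
have := @Rintegral_itvB R f (BLeft 0) (BRight T) t Lf.
by rewrite !bnd_simp => /(_ t0 tT) <-; rewrite addrC subrK.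
Qed.

Lemma int_tail T t f : 0 <= t <= T -> L1 T f ->
  \int[leb]_(s in Icc t T) f s =
  \int[leb]_(s in Icc 0 T) f s - \int[leb]_(s in Icc 0 t) f s.
Proof.
move=> tT Lf; rewrite (int_split tT Lf) addrC addKr.
rewrite /Icc -Rintegral_itv_obnd_cbnd //.
case/andP: tT => t0 tT.
by apply: integrableS Lf => //; apply: subset_itvr; rewrite bnd_simp.
Qed.

(** Integrands on an interval are extended by zero so that Fubini and Tonelli can be applied on the
    full product space; this lemma restricts the result back. *)
Lemma integral_restr_eq (D : set R) (f g : R -> \bar R) :
  (forall s, D s -> f s = g s) -> (forall s, ~ D s -> f s = 0%E) ->
  (\int[leb]_s f s = \int[leb]_(s in D) g s)%E.
Proof.
move=> fg f0; rewrite [RHS]integral_mkcond; apply: eq_integral => s _.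
rewrite patchE; case: ifPn => [|]; first by rewrite inE => /fg ->.
by move=> /negP; rewrite inE => /f0 ->.
Qed.

Lemma L1_restrict T f : L1 T f -> leb.-integrable setT (EFin \o (f \_ (Icc 0 T))).
Proof.
move=> Lf; rewrite -restrict_EFin.
exact: (proj1 (@integrable_mkcond _ _ _ leb _ _ (measurable_itv _)) Lf).
Qed.

Lemma intZ_EFin (D : set R) k f : leb.-integrable D (EFin \o f) -> measurable D ->
  (\int[leb]_(s in D) (k * f s)%:E = (k * \int[leb]_(s in D) f s)%:E)%E.
Proof.
move=> Lf mD; rewrite -RintegralZl // /Rintegral fineK//.
by apply: integrable_fin_num => //; exact: (integrableZl _ k Lf).
Qed.

(* Fubini on the two triangles of the square [0, T]^2. *)
Lemma int_mul T a b : 0 <= T -> L1 T a -> L1 T b ->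
  (\int[leb]_(s in Icc 0 T) a s) * (\int[leb]_(s in Icc 0 T) b s) =
  \int[leb]_(s in Icc 0 T) (a s * \int[leb]_(r in Icc 0 s) b r) +
  \int[leb]_(r in Icc 0 T) ((\int[leb]_(s in Icc 0 r) a s) * b r).
Proof.
move=> T0 La Lb.
pose a' := a \_ (Icc 0 T); pose b' := b \_ (Icc 0 T).
have ia' : leb.-integrable setT (EFin \o a').
  exact: L1_restrict.
have ib' : leb.-integrable setT (EFin \o b').
  exact: L1_restrict.
have ma' : measurable_fun setT a' by apply/measurable_EFinP; exact: measurable_int ia'.
have mb' : measurable_fun setT b' by apply/measurable_EFinP; exact: measurable_int ib'.
(* The product [a(s) b(r)] cut down to the triangle s < r. Integrating in r first gives
   [a(s) (B T - B s)] ([FE]), integrating in s first gives [A r * b r] ([GE]); equating the two and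
   moving the integral of [a * B] across is the claim. *)
pose k (z : R * R) : R := a' z.1 * b' z.2 * (z.1 < z.2)%R%:R.
have mk : measurable_fun setT k.
  apply: measurable_funM.
    by apply: measurable_funM; exact: measurableT_comp.
  apply: (measurableT_comp (f := fun x : bool => x%:R : R)) => //.
  exact: measurable_fun_ltr.
have ik : (leb \x leb)%E.-integrable setT (EFin \o k).
  apply/integrable12ltyP; first exact/measurable_EFinP.
  have Ib : (\int[leb]_r `|(b' r)%:E| < +oo)%E by case/integrableP: ib'.
  have Ia : (\int[leb]_r `|(a' r)%:E| < +oo)%E by case/integrableP: ia'.
  apply: (@le_lt_trans _ _ (\int[leb]_s (`|(a' s)%:E| * \int[leb]_r `|(b' r)%:E|))%E).
    apply: ge0_le_integral => //.
    - by move=> s _; exact: integral_ge0.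
    - apply: (measurable_fun_fubini_tonelli_F (m2 := leb) (abse \o (EFin \o k))) => //=.
      by apply: measurableT_comp => //; exact/measurable_EFinP.
    - apply: emeasurable_funM => //.
      by apply: measurableT_comp => //; exact/measurable_EFinP.
    move=> s _; rewrite -ge0_integralZl//; last first.
      by apply: measurableT_comp => //; exact/measurable_EFinP.
    apply: ge0_le_integral => //.
    - apply/measurable_EFinP; apply: measurableT_comp => //.
      by apply: (measurableT_comp mk); exact: measurable_pair1.
    - apply: emeasurable_funM => //.
      by apply: measurableT_comp => //; exact/measurable_EFinP.
    move=> r _; rewrite /k /= !normrM -EFinM lee_fin -[leRHS]mulr1 ler_wpM2l//.
    by case: (s < r); rewrite ?normr1 ?normr0.
  rewrite ge0_integralZr//; last first.
  - exact: integral_ge0.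
  - by apply: measurableT_comp => //; exact/measurable_EFinP.
  apply: lte_mul_pinfty => //; first exact: integral_ge0.
  by rewrite ge0_fin_numE//; exact: integral_ge0.
have := Fubini ik.
pose B r := \int[leb]_(s in Icc 0 r) b s; pose A r := \int[leb]_(s in Icc 0 r) a s.
have bA : bounded_meas T A by exact: bounded_meas_int.
have bB : bounded_meas T B by exact: bounded_meas_int.
have FE s : (\int[leb]_r (EFin \o k) (s, r))%E = ((a * (cst (B T) - B)) \_ (Icc 0 T) s)%:E.
  rewrite patchE; case: ifPn => [|sT].
    rewrite inE => sT; have /IccP s0T := sT.
    rewrite (@integral_restr_eq `]s, T] _ (fun r => (a s * b r)%:E)).
    - rewrite intZ_EFin//.
        by congr (_ * _)%:E; rewrite -[RHS]/(B T - B s) /B (int_split s0T Lb) [in RHS]addrC addKr.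
      apply: integrableS Lb; [exact: measurable_itv|exact: measurable_itv|].
      by apply: subset_itvr; rewrite bnd_simp; case/andP: s0T.
    - move=> r; rewrite /= in_itv /= => /andP[sr rT].
      have rI : Icc 0 T r by apply/IccP; case/andP: s0T => s0 _; rewrite rT (le_trans s0 (ltW sr)).
      by rewrite /k /= /a' /b' !patchE !mem_set// sr mulr1.
    - move=> r /= /negP; rewrite in_itv /= negb_and => /orP[/negbTE sr|rT].
        by rewrite /k /= sr mulr0.
      rewrite /k /= /b' patchE memNset ?mulr0 ?mul0r//.
      by move/IccP => /andP[_]; apply/negP.
  rewrite integral0_eq // => r _.
  by rewrite /k /= /a' patchE (negbTE sT) !mul0r.
have GE r : (\int[leb]_s (EFin \o k) (s, r))%E = ((A * b) \_ (Icc 0 T) r)%:E.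
  rewrite patchE; case: ifPn => [|rT].
    rewrite inE => rT; have /IccP r0T := rT.
    rewrite (@integral_restr_eq `[0, r[ _ (fun s => (b r * a s)%:E)).
    - have La' : leb.-integrable `[0, r[ (EFin \o a).
        apply: integrableS La; [exact: measurable_itv|exact: measurable_itv|].
        by apply: subset_itvl; rewrite bnd_simp; case/andP: r0T.
      rewrite intZ_EFin// mulrC; congr (_ * _)%:E.
      by rewrite /A /Icc -[RHS]Rintegral_itv_bndo_bndc//.
    - move=> s; rewrite /= in_itv /= => /andP[s0 sr].
      have sI : Icc 0 T s by apply/IccP; case/andP: r0T => _ rT'; rewrite s0 (le_trans (ltW sr) rT').
      by rewrite /k /= /a' /b' !patchE !mem_set// sr mulr1 mulrC.
    - move=> s /= /negP; rewrite in_itv /= negb_and => /orP[s0|/negbTE sr].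
        rewrite /k /= /a' patchE memNset ?mulr0 ?mul0r//.
        by move/IccP => /andP[+ _]; apply/negP.
      by rewrite /k /= sr mulr0.
  rewrite integral0_eq // => s _.
  by rewrite /k /= /b' patchE (negbTE rT) mulr0 mul0r.
have LaB : L1 T (fun s => a s * B s) by apply: eq_L1 (L1_mul bB La) => s _; rewrite mulrC.
under eq_integral do rewrite FE.
under [in RHS]eq_integral do rewrite GE.
move=> /(congr1 fine) E.
have {E} : \int[leb]_s ((fun s => a s * (B T - B s)) \_ (Icc 0 T)) s =
  \int[leb]_s ((fun s => A s * b s) \_ (Icc 0 T)) s by exact: E.
rewrite -!Rintegral_mkcond => <-.
rewrite -RintegralZr//.
rewrite -RintegralD //.
- by apply: eq_int => s _; rewrite -mulrDr addrC subrK.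
- apply: (@eq_L1 _ (fun s => B T * a s + - (a s * B s))).
    by move=> s _; ring.
  by apply: L1D; [exact: L1Z|exact: L1N].
Qed.

Lemma eq_bounded_meas T f g : (forall t, Icc 0 T t -> f t = g t) ->
  bounded_meas T f -> bounded_meas T g.
Proof.
move=> fg [mf [K fK]]; split.
  by apply: eq_measurable_fun mf => t; rewrite inE => /fg.
by exists K => t tT; rewrite -fg//; exact: fK.
Qed.

Lemma bounded_meas_cst T k : bounded_meas T (cst k).
Proof. by split; [exact: measurable_cst|exists `|k|]. Qed.

Lemma bounded_measD T f g : bounded_meas T f -> bounded_meas T g ->
  bounded_meas T (fun t => f t + g t).
Proof.
move=> [mf [K fK]] [mg [K' gK']]; split; first exact: measurable_funD.
exists (K + K') => t tT; apply: le_trans (ler_normD _ _) _.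
by apply: lerD; [exact: fK|exact: gK'].
Qed.

Lemma bounded_measM T f g : bounded_meas T f -> bounded_meas T g ->
  bounded_meas T (fun t => f t * g t).
Proof.
move=> [mf [K fK]] [mg [K' gK']]; split; first exact: measurable_funM.
exists (K * K') => t tT; rewrite normrM.
by apply: ler_pM => //; [exact: fK|exact: gK'].
Qed.

Lemma bounded_meas_sum T (I : Type) (s : seq I) (F : I -> R -> R) :
  (forall i, bounded_meas T (F i)) ->
  bounded_meas T (fun t => \sum_(i <- s) F i t).
Proof.
move=> LF; elim: s => [|i s IH].
  by apply: eq_bounded_meas (bounded_meas_cst T 0) => // t _ /=; rewrite big_nil.
by apply: eq_bounded_meas (bounded_measD (LF i) IH) => // t _ /=; rewrite big_cons.
Qed.

(** The density [a] is carried along instead of an almost everywhere derivative: it is determined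
    only up to null sets, and the equations below supply a specific one. *)
Definition abscont T f a := L1 T a /\
  forall t, Icc 0 T t -> f t = f 0 + \int[leb]_(s in Icc 0 t) a s.

Lemma abscont_bounded T f a : 0 <= T -> abscont T f a -> bounded_meas T f.
Proof.
move=> T0 [La fE].
apply: eq_bounded_meas (bounded_measD (bounded_meas_cst T (f 0)) (bounded_meas_int T0 La)).
by move=> t /fE ->.
Qed.

Lemma eq_abscont T f a f' a' : 0 <= T -> (forall t, Icc 0 T t -> f t = f' t) ->
  (forall t, Icc 0 T t -> a t = a' t) -> abscont T f a -> abscont T f' a'.
Proof.
move=> T0 ff aa [La fE]; split; first exact: eq_L1 La.
move=> t tT; rewrite -!ff//; last by apply/IccP; rewrite lexx.
rewrite fE//; congr (_ + _); apply: eq_int => s st; apply: aa.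
by apply: Icc_le st; move/IccP: tT => /andP[].
Qed.

Lemma intD T t f g : Icc 0 T t -> L1 T f -> L1 T g ->
  \int[leb]_(s in Icc 0 t) (f s + g s) =
  \int[leb]_(s in Icc 0 t) f s + \int[leb]_(s in Icc 0 t) g s.
Proof.
move=> /IccP/andP[t0 tT] Lf Lg; rewrite RintegralD//.
  exact: L1_le Lf.
exact: L1_le Lg.
Qed.

Lemma intZ T t k f : Icc 0 T t -> L1 T f ->
  \int[leb]_(s in Icc 0 t) (k * f s) = k * \int[leb]_(s in Icc 0 t) f s.
Proof. by move=> /IccP/andP[t0 tT] Lf; rewrite RintegralZl//; exact: L1_le Lf. Qed.

Lemma abscont_cst T k : abscont T (cst k) (cst 0).
Proof.
split=> [|t tT]; first exact: L1_0.
rewrite -[LHS]addr0; congr (_ + _).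
rewrite -[LHS](mul0r (\int[leb]_(r in Icc 0 t) 0)) -(intZ _ tT (L1_0 T)).
by apply: eq_int => r _; rewrite mul0r.
Qed.

Lemma abscontD T f a g b : abscont T f a -> abscont T g b ->
  abscont T (fun t => f t + g t) (fun t => a t + b t).
Proof.
move=> [La fE] [Lb gE]; split; first exact: L1D.
by move=> t tT; rewrite (intD tT La Lb) fE// gE//; ring.
Qed.

Lemma abscont_sum T (I : Type) (s : seq I) (F F' : I -> R -> R) : 0 <= T ->
  (forall i, abscont T (F i) (F' i)) ->
  abscont T (fun t => \sum_(i <- s) F i t) (fun t => \sum_(i <- s) F' i t).
Proof.
move=> T0 LF; elim: s => [|i s IH].
  by apply: eq_abscont (abscont_cst T 0) => // t _ /=; rewrite big_nil.
by apply: eq_abscont (abscontD (LF i) IH) => // t _ /=; rewrite big_cons.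
Qed.

(** Both factors are written as initial value plus primitive. In the product over [0, t], the only
    term that is not linear is the product of the two primitives, which [int_mul] splits into the
    two halves of the product rule. *)
Lemma abscontM T f a g b : 0 <= T -> abscont T f a -> abscont T g b ->
  abscont T (fun t => f t * g t) (fun t => a t * g t + f t * b t).
Proof.
move=> T0 fa gb; have bf := abscont_bounded T0 fa; have bg := abscont_bounded T0 gb.
have [La fE] := fa; have [Lb gE] := gb.
have Lag : L1 T (fun t => a t * g t).
  by apply: eq_L1 (L1_mul bg La) => t _; rewrite mulrC.
have Lfb := L1_mul bf Lb.
split; first exact: L1D.
move=> t tT; have /IccP/andP[t0 tT'] := tT.
have La' := L1_le tT' La; have Lb' := L1_le tT' Lb.
rewrite (intD tT Lag Lfb).
have -> : \int[leb]_(s in Icc 0 t) (a s * g s) =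
    g 0 * \int[leb]_(s in Icc 0 t) a s +
    \int[leb]_(s in Icc 0 t) (a s * \int[leb]_(r in Icc 0 s) b r).
  rewrite -(intZ _ tT La) -(@intD t).
  - by apply: eq_int => s st; rewrite (gE s (Icc_le tT' st)); ring.
  - by apply/IccP; rewrite t0 lexx.
  - exact: L1Z.
  - apply: eq_L1 (L1_mul (bounded_meas_int t0 Lb') La') => s _.
    by rewrite mulrC.
have -> : \int[leb]_(s in Icc 0 t) (f s * b s) =
    f 0 * \int[leb]_(s in Icc 0 t) b s +
    \int[leb]_(s in Icc 0 t) ((\int[leb]_(r in Icc 0 s) a r) * b s).
  rewrite -(intZ _ tT Lb) -(@intD t).
  - by apply: eq_int => s st; rewrite (fE s (Icc_le tT' st)); ring.
  - by apply/IccP; rewrite t0 lexx.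
  - exact: L1Z.
  - exact: (L1_mul (bounded_meas_int t0 La') Lb').
rewrite fE// gE//.
have := int_mul t0 La' Lb'.
set AB := _ * _; set p := \int[leb]_(s in _) _; set q := \int[leb]_(r in _) _.
move=> E; rewrite mulrDl !mulrDr -/AB E; ring.
Qed.

Definition L1m m n T (F : R -> 'M[R]_(m, n)) := forall i j, L1 T (fun t => F t i j).

Definition abscont_mx m n T (F F' : R -> 'M[R]_(m, n)) :=
  forall i j, abscont T (fun t => F t i j) (fun t => F' t i j).

Lemma abscont_mxM m n p T (F F' : R -> 'M[R]_(m, n)) (K K' : R -> 'M[R]_(n, p)) :
  0 <= T -> abscont_mx T F F' -> abscont_mx T K K' ->
  abscont_mx T (fun t => F t *m K t) (fun t => F' t *m K t + F t *m K' t).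
Proof.
move=> T0 HF HK i j.
apply: eq_abscont (abscont_sum (index_enum 'I_n) T0 (fun k => abscontM T0 (HF i k) (HK k j))) => //.
- by move=> t _; rewrite mxE.
- by move=> t _; rewrite !mxE -big_split.
Qed.

Lemma abscont_mx_cst m n T (M : 'M[R]_(m, n)) : abscont_mx T (cst M) (cst 0).
Proof. by move=> i j; have := abscont_cst T (M i j); congr abscont; apply/funext => t; rewrite /= !mxE. Qed.

Lemma abscont_mxD m n T (F F' K K' : R -> 'M[R]_(m, n)) : 0 <= T ->
  abscont_mx T F F' -> abscont_mx T K K' -> abscont_mx T (fun t => F t + K t) (fun t => F' t + K' t).
Proof.
by move=> T0 HF HK i j; apply: eq_abscont (abscontD (HF i j) (HK i j)) => // t _; rewrite mxE.
Qed.

Lemma eq_abscont_mx m n T (F F' K K' : R -> 'M[R]_(m, n)) : 0 <= T ->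
  (forall t, Icc 0 T t -> F t = K t) -> (forall t, Icc 0 T t -> F' t = K' t) ->
  abscont_mx T F F' -> abscont_mx T K K'.
Proof.
move=> T0 FK FK' HF i j; apply: eq_abscont (HF i j) => // t tT; first by rewrite FK.
by rewrite FK'.
Qed.

Lemma abscont_mxZl m n p T (M : 'M[R]_(p, m)) (F F' : R -> 'M[R]_(m, n)) : 0 <= T ->
  abscont_mx T F F' -> abscont_mx T (fun t => M *m F t) (fun t => M *m F' t).
Proof.
move=> T0 HF; apply: eq_abscont_mx (abscont_mxM T0 (abscont_mx_cst T M) HF) => // t _.
by rewrite mul0mx add0r.
Qed.

(** The form in which conserved quantities are used: once the product rule makes a density vanish,
    the function keeps its initial value. *)
Lemma abscont_mx_eq0 m n T (F : R -> 'M[R]_(m, n)) : 0 <= T -> abscont_mx T F (cst 0) ->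
  forall t, Icc 0 T t -> F t = F 0.
Proof.
move=> T0 HF t tT; apply/matrixP => i j; have [_ ->//] := HF i j.
have [_ /(_ t tT)] := abscont_cst T 0.
rewrite add0r => E; rewrite -[RHS]addr0; congr (_ + _).
by rewrite [RHS]E; apply: eq_int => s _; rewrite mxE.
Qed.

Lemma intv_00 n (g : R -> 'cV[R]_n) : intv 0 0 g = 0.
Proof. by apply/matrixP => i j; rewrite !mxE int_00. Qed.

(** Together with [abscont_mx_intv], this translates between the integral equations of the
    definitions and the pairs to which the product rule applies. *)
Lemma intv_abscont n T (z g : R -> 'cV[R]_n) c : 0 <= T -> L1m T g ->
  (forall t, Icc 0 T t -> z t = c + intv 0 t g) -> abscont_mx T z g.
Proof.
move=> T0 Lg zE i j; split; first exact: Lg.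
move=> t tT; rewrite zE// (zE 0) ?intv_00 ?addr0; last by apply/IccP; rewrite lexx.
by rewrite !mxE (ord1 j).
Qed.

Lemma abscont_mx_intv n T (z g : R -> 'cV[R]_n) : abscont_mx T z g ->
  forall t, Icc 0 T t -> z t = z 0 + intv 0 t g.
Proof.
by move=> H t tT; apply/matrixP => i j; rewrite (ord1 j) !mxE; have [_ ->] := H i 0.
Qed.

Lemma L1mD m n T (F K : R -> 'M[R]_(m, n)) : L1m T F -> L1m T K ->
  L1m T (fun t => F t + K t).
Proof. by move=> HF HK i j; apply: eq_L1 (L1D (HF i j) (HK i j)) => t _; rewrite mxE. Qed.

Lemma L1mN m n T (F : R -> 'M[R]_(m, n)) : L1m T F -> L1m T (fun t => - F t).
Proof. by move=> HF i j; apply: eq_L1 (L1N (HF i j)) => t _; rewrite mxE. Qed.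

Definition bounded_measm m n T (F : R -> 'M[R]_(m, n)) :=
  forall i j, bounded_meas T (fun t => F t i j).

Lemma L1mM m n p T (F : R -> 'M[R]_(m, n)) (K : R -> 'M[R]_(n, p)) :
  bounded_measm T F -> L1m T K -> L1m T (fun t => F t *m K t).
Proof.
move=> HF HK i j.
apply: eq_L1 (L1_sum (index_enum 'I_n) (fun k => L1_mul (HF i k) (HK k j))).
by move=> t _; rewrite mxE.
Qed.

Lemma L1mZ m n p T (M : 'M[R]_(m, n)) (K : R -> 'M[R]_(n, p)) :
  L1m T K -> L1m T (fun t => M *m K t).
Proof. by apply: L1mM => i j; exact: bounded_meas_cst. Qed.

Lemma abscont_mx_bounded m n T (F F' : R -> 'M[R]_(m, n)) : 0 <= T -> abscont_mx T F F' ->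
  bounded_measm T F.
Proof. by move=> T0 HF i j; exact: abscont_bounded (HF i j). Qed.

End AbsolutelyContinuous.

(** * Linear differential systems *)

Section MatrixExponential.
Context {R : realType}.
Notation leb := (@lebesgue_measure R).

Definition mpow n (M : 'M[R]_n) k := iter k (mulmx M) 1%:M.

(** Each entry is a scalar power series in t, so differentiation is the termwise differentiation of
    scalar power series. *)
Definition mexp n (M : 'M[R]_n) (t : R) : 'M[R]_n :=
  \matrix_(i, j) limn (pseries (fun k => mpow M k i j / k`!%:R) t).

Lemma mpowSr n (M : 'M[R]_n) k : mpow M k.+1 = mpow M k *m M.
Proof.
elim: k => [|k IH]; first by rewrite /mpow /= mulmx1 mul1mx.
by rewrite /mpow 2!iterS -/(mpow M k) -mulmxA -IH.
Qed.

(** The sum of all absolute entries dominates every row sum, so each further power costs one factor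
    of it. *)
Lemma mpow_le n (M : 'M[R]_n) k i j :
  `|mpow M k i j| <= (\sum_i \sum_j `|M i j|) ^+ k.
Proof.
set K := \sum_i _; have K0 : 0 <= K by apply: sumr_ge0 => a _; exact: sumr_ge0.
elim: k i j => [|k IH] i j.
  by rewrite /mpow /= mxE expr0; case: (i == j); rewrite ?normr1 ?normr0.
rewrite /mpow iterS -/(mpow M k) mxE exprS.
apply: le_trans (ler_norm_sum _ _ _) _.
apply: (@le_trans _ _ (\sum_l `|M i l| * K ^+ k)).
  by apply: ler_sum => l _; rewrite normrM ler_wpM2l.
rewrite -mulr_suml ler_wpM2r ?exprn_ge0//.
rewrite /K [leRHS](bigD1 i)//= lerDl.
by apply: sumr_ge0 => a _; exact: sumr_ge0.
Qed.

(** Comparison with C times the exponential series at [K * |t|]. *)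
Lemma cvg_pseries_exp (c : nat -> R) (C K t : R) : 0 <= C -> 0 <= K ->
  (forall k, `|c k| <= C * (K ^+ k / k`!%:R)) -> cvgn (pseries c t).
Proof.
move=> C0 K0 cK; apply: normed_cvg.
apply: (@series_le_cvg _ _ (fun k => C * exp_coeff (K * `|t|) k)).
- by move=> k /=.
- by move=> k; rewrite mulr_ge0// /exp_coeff divr_ge0// exprn_ge0// mulr_ge0.
- move=> k /=; rewrite normrM normrX /exp_coeff /=.
  apply: le_trans (ler_wpM2r _ (cK k)) _; first by rewrite exprn_ge0.
  by rewrite -!mulrA ler_wpM2l// exprMn mulrA mulrAC.
- have -> : (fun k => C * exp_coeff (K * `|t|) k) = C *: exp_coeff (K * `|t|) by [].
  exact/is_cvg_seriesZ/is_cvg_series_exp_coeff.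
Qed.

Lemma lim_pseries_lin n (w : 'I_n -> R) (c : 'I_n -> nat -> R) t :
  (forall l, cvgn (pseries (c l) t)) ->
  limn (pseries (fun k => \sum_l w l * c l k) t) =
  \sum_l w l * limn (pseries (c l) t).
Proof.
move=> cc; apply: cvg_lim => //.
have -> : pseries (fun k => \sum_l w l * c l k) t =
    (fun N => \sum_l w l * pseries (c l) t N).
  apply/funext => N; rewrite /pseries /series /=.
  under eq_bigr do rewrite mulr_suml.
  rewrite exchange_big /=; apply: eq_bigr => l _; rewrite mulr_sumr.
  by apply: eq_bigr => k _; rewrite mulrA.
apply: cvg_big => [|l _]; first exact: add_continuous.
by apply: cvgMr => //; exact: cc.
Qed.

(** The coefficients of the p-th derivative of the (i, j) entry of the exponential: differentiating
    turns [M^k / k!] into [M^(k+1) / k!]. *)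
Definition mpow_coef n (M : 'M[R]_n) p i j k := mpow M (k + p) i j / k`!%:R.

Lemma cvg_mpow_coef n (M : 'M[R]_n) p i j t : cvgn (pseries (mpow_coef M p i j) t).
Proof.
set K := \sum_i \sum_j `|M i j|.
have K0 : 0 <= K by apply: sumr_ge0 => a _; exact: sumr_ge0.
apply: (@cvg_pseries_exp _ (K ^+ p) K) => //; first exact: exprn_ge0.
move=> k; rewrite /mpow_coef normrM mulrA -exprD addnC.
by rewrite [X in _ * X <= _]ger0_norm ?ler_wpM2r ?invr_ge0// mpow_le.
Qed.

Lemma pseries_diffs_mpow n (M : 'M[R]_n) p i j :
  pseries_diffs (mpow_coef M p i j) = mpow_coef M p.+1 i j.
Proof.
apply/funext => k; rewrite /pseries_diffs /mpow_coef addSnnS factS natrM invfM.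
rewrite mulrCA mulVKf//.
Qed.

Lemma is_derive_mpow_coef n (M : 'M[R]_n) p i j (t : R) :
  is_derive t (1 : R) (fun t => limn (pseries (mpow_coef M p i j) t))
    (limn (pseries (mpow_coef M p.+1 i j) t)).
Proof.
(* Termwise differentiation asks for convergence of the series and of its first two derived series
   at a radius exceeding the modulus of t; all of them converge everywhere, so that modulus plus 1
   will do. *)
rewrite -pseries_diffs_mpow; apply: (@pseries_snd_diffs _ _ (`|t| + 1)).
- exact: cvg_mpow_coef.
- by rewrite pseries_diffs_mpow; exact: cvg_mpow_coef.
- by rewrite !pseries_diffs_mpow; exact: cvg_mpow_coef.
- by rewrite [ltRHS]ger0_norm ?ltrDl// addr_ge0.
Qed.

Lemma mexpE n (M : 'M[R]_n) t i j : mexp M t i j = limn (pseries (mpow_coef M 0 i j) t).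
Proof.
by rewrite mxE; congr (limn (pseries _ t)); apply/funext => k; rewrite /mpow_coef addn0.
Qed.

Lemma mul_mexp n (M : 'M[R]_n) t i j :
  (M *m mexp M t) i j = limn (pseries (mpow_coef M 1 i j) t).
Proof.
rewrite mxE; under eq_bigr do rewrite mexpE.
rewrite -lim_pseries_lin; last by move=> l; exact: cvg_mpow_coef.
congr (limn (pseries _ t)); apply/funext => k; rewrite /mpow_coef addn0 addn1.
by rewrite /mpow iterS -/(mpow M k) mxE mulr_suml; apply: eq_bigr => l _; rewrite mulrA.
Qed.

(** Same series as in [mul_mexp], because powers of [M] can be extended on either side. The two
    lemmas together say that [M] commutes with its exponential. *)
Lemma mexp_mul n (M : 'M[R]_n) t i j :
  (mexp M t *m M) i j = limn (pseries (mpow_coef M 1 i j) t).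
Proof.
rewrite mxE; under eq_bigr do rewrite mexpE mulrC.
rewrite -lim_pseries_lin; last by move=> l; exact: cvg_mpow_coef.
congr (limn (pseries _ t)); apply/funext => k; rewrite /mpow_coef addn0 addn1.
rewrite mpowSr mxE mulr_suml; apply: eq_bigr => l _; ring.
Qed.

Lemma mexp0 n (M : 'M[R]_n) : mexp M 0 = 1%:M.
Proof.
apply/matrixP => i j; rewrite mexpE.
have -> : (1%:M : 'M[R]_n) i j = mpow_coef M 0 i j 0 by rewrite /mpow_coef /mpow /= fact0 divr1.
apply: lim_near_cst => //; near=> m.
rewrite -[m]prednK; last by near: m; exact: nbhs_infty_gt.
rewrite /pseries /series /= big_nat_recl// expr0 mulr1 big1 ?addr0// => k _.
by rewrite expr0n mulr0.
Unshelve. all: by end_near. Qed.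

Lemma mexp_abscont n (M : 'M[R]_n) T : 0 <= T -> abscont_mx T (mexp M) (fun t => M *m mexp M t).
Proof.
move=> T0 i j.
pose F p t := limn (pseries (mpow_coef M p i j) t).
have cF p : continuous (F p).
  move=> x; apply/differentiable_continuous/derivable1_diffP.
  exact: (@ex_derive _ _ _ _ _ _ _ (is_derive_mpow_coef M p i j x)).
apply: (@eq_abscont _ T (F 0) (F 1)) => //.
- by move=> t _; rewrite mexpE.
- by move=> t _; rewrite mul_mexp.
split.
  apply: continuous_compact_integrable; first exact: segment_compact.
  exact/continuous_subspaceT/cF.
move=> t /IccP/andP[]; rewrite le_eqVlt => /predU1P[<- _|t0 tT].
  by rewrite int_00 addr0.
rewrite /Rintegral (@continuous_FTC2 _ (F 1) (F 0))//=; last 3 first.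
- exact/continuous_subspaceT/cF.
- split.
  + by move=> x _; exact: (@ex_derive _ _ _ _ _ _ _ (is_derive_mpow_coef M 0 i j x)).
  + exact/cvg_at_right_filter/cF.
  + exact/cvg_at_left_filter/cF.
- move=> x _; rewrite derive1E.
  exact: (@derive_val _ _ _ _ _ _ _ (is_derive_mpow_coef M 0 i j x)).
by rewrite [RHS]addrC subrK.
Qed.

(** The product has density [- E M F + E M F = 0], where E and F are the two exponentials, so it
    keeps the value 1 that it has at time 0. *)
Lemma mexp_inv n (M : 'M[R]_n) T : 0 <= T -> forall t, Icc 0 T t ->
  mexp (- M) t *m mexp M t = 1%:M.
Proof.
move=> T0 t tT.
have H := abscont_mxM T0 (mexp_abscont (- M) T0) (mexp_abscont M T0).
rewrite (abscont_mx_eq0 (F := fun t => mexp (- M) t *m mexp M t) T0 _ tT) ?mexp0 ?mulmx1//.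
apply: eq_abscont_mx H => // s _.
have -> : - M *m mexp (- M) s = mexp (- M) s *m - M.
  by apply/matrixP => i j; rewrite mul_mexp mexp_mul.
by rewrite mulmxN mulNmx mulmxA addNr.
Qed.

Lemma mexpN_abscont n (M : 'M[R]_n) T : 0 <= T ->
  abscont_mx T (mexp (- M)) (fun t => - (mexp (- M) t *m M)).
Proof.
move=> T0; apply: eq_abscont_mx (mexp_abscont (- M) T0) => // s _.
by rewrite -mulmxN; apply/matrixP => i j; rewrite mul_mexp mexp_mul.
Qed.

(** [mexp (- M) t *m v t] is conserved and starts at 0; multiplying by the inverse exponential
    recovers [v t]. No Gronwall estimate is involved. *)
Lemma linear_ode_unique n (M : 'M[R]_n) T (v : R -> 'cV[R]_n) : 0 <= T ->
  abscont_mx T v (fun t => M *m v t) -> v 0 = 0 -> forall t, Icc 0 T t -> v t = 0.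
Proof.
move=> T0 Hv v0 t tT.
have H := abscont_mxM T0 (mexpN_abscont M T0) Hv.
have E : mexp (- M) t *m v t = 0.
  rewrite (abscont_mx_eq0 (F := fun t => mexp (- M) t *m v t) T0 _ tT) ?v0 ?mulmx0//.
  by apply: eq_abscont_mx H => // s _; rewrite mulmxA mulNmx addNr.
by rewrite -[v t]mul1mx -(mulmx1C (mexp_inv M T0 tT)) -mulmxA E mulmx0.
Qed.

(** The variation of constants formula for [z' = M z + g], [z(0) = z0]. *)
Definition ode_sol n (M : 'M[R]_n) (z0 : 'cV[R]_n) (g : R -> 'cV[R]_n) t :=
  mexp M t *m (z0 + intv 0 t (fun s => mexp (- M) s *m g s)).

Lemma bounded_mexp n (M : 'M[R]_n) T : 0 <= T -> bounded_measm T (mexp M).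
Proof. by move=> T0; apply: abscont_mx_bounded (mexp_abscont M T0). Qed.

Lemma ode_sol0 n (M : 'M[R]_n) z0 g : ode_sol M z0 g 0 = z0.
Proof. by rewrite /ode_sol mexp0 mul1mx intv_00 addr0. Qed.

Lemma ode_sol_abscont n (M : 'M[R]_n) z0 g T : 0 <= T -> L1m T g ->
  abscont_mx T (ode_sol M z0 g) (fun t => M *m ode_sol M z0 g t + g t).
Proof.
move=> T0 Lg.
have Lh : L1m T (fun s => mexp (- M) s *m g s) by apply: L1mM => //; exact: bounded_mexp.
have Hc : abscont_mx T (fun t => z0 + intv 0 t (fun s => mexp (- M) s *m g s))
    (fun s => mexp (- M) s *m g s) by exact: intv_abscont.
apply: eq_abscont_mx (abscont_mxM T0 (mexp_abscont M T0) Hc) => // t tT.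
by rewrite /ode_sol -mulmxA [X in _ + X]mulmxA (mulmx1C (mexp_inv M T0 tT)) mul1mx.
Qed.

End MatrixExponential.

(** * Integration on [0, T] x Om *)

Section ProductIntegration.
Context {R : realType} {d : measure_display} {Om : measurableType d}.
Variable P : probability Om R.
Notation leb := (@lebesgue_measure R).
Implicit Types (T t s : R) (F : R -> Om -> R) (w : Om).

Definition pmeas T F :=
  measurable_fun (Icc 0 T `*` [set: Om]) (fun z : R * Om => F z.1 z.2).

(** Extension by zero in time, which turns a process on [0, T] into a function on the whole of R x
    Om. *)
Definition ext0 T F s w := ((F ^~ w) \_ (Icc 0 T)) s.

Lemma ext0_in T F s w : Icc 0 T s -> ext0 T F s w = F s w.
Proof. by move=> sT; rewrite /ext0 patchE mem_set. Qed.

Lemma ext0_out T F s w : ~ Icc 0 T s -> ext0 T F s w = 0.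
Proof. by move=> sT; rewrite /ext0 patchE memNset. Qed.

Lemma measurable_cyl T : measurable (Icc 0 T `*` [set: Om]).
Proof. by apply: measurableX => //; exact: measurable_itv. Qed.

Lemma measurable_ext0 T F : pmeas T F ->
  measurable_fun setT (fun z : R * Om => ext0 T F z.1 z.2).
Proof.
move=> mF.
have -> : (fun z : R * Om => ext0 T F z.1 z.2) =
    (fun z : R * Om => F z.1 z.2) \_ (Icc 0 T `*` [set: Om]).
  apply/funext => -[s w]; rewrite /ext0 !patchE /=; congr (if _ then _ else _).
  by apply/idP/idP; rewrite !inE => // -[].
by apply/(measurable_restrictT _ (measurable_cyl T)).
Qed.

Lemma pmeas_secl T F s : pmeas T F -> Icc 0 T s -> measurable_fun setT (F s).
Proof.
move=> mF sT; apply: eq_measurable_fun (measurableT_comp (measurable_ext0 mF) (measurable_pair1 s)).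
by move=> w _ /=; rewrite ext0_in.
Qed.

Lemma pmeas_secr T F w : pmeas T F -> measurable_fun (Icc 0 T) (F ^~ w).
Proof.
move=> mF; apply: (@eq_measurable_fun _ _ _ _ _ (ext0 T F ^~ w)).
  by move=> s; rewrite inE => sT; rewrite ext0_in.
apply: measurable_funTS.
exact: (measurableT_comp (measurable_ext0 mF) (measurable_pair2 w)).
Qed.

Lemma integral_ext0 T (F : R -> Om -> R) w :
  (\int[leb]_s (ext0 T F s w)%:E = \int[leb]_(s in Icc 0 T) (F s w)%:E)%E.
Proof.
apply: integral_restr_eq => s sT; first by rewrite ext0_in.
by rewrite ext0_out.
Qed.

Lemma tonelli T F : pmeas T F -> (forall s w, 0 <= F s w) ->
  [/\ measurable_fun setT (fun w => \int[leb]_(s in Icc 0 T) (F s w)%:E)%E,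
      measurable_fun (Icc 0 T) (fun s => \int[P]_w (F s w)%:E)%E &
      (\int[P]_w \int[leb]_(s in Icc 0 T) (F s w)%:E =
       \int[leb]_(s in Icc 0 T) \int[P]_w (F s w)%:E)%E ].
Proof.
move=> mF F0; have mE := measurable_ext0 mF.
pose k z := (ext0 T F z.1 z.2)%:E.
have mk : measurable_fun setT k by exact/measurable_EFinP.
have k0 z : (0 <= k z)%E.
  by rewrite lee_fin /ext0 patchE; case: ifPn.
split.
- apply: eq_measurable_fun (measurable_fun_fubini_tonelli_G (m1 := leb) k mk k0).
  by move=> w _; rewrite /fubini_G integral_ext0.
- apply: (@eq_measurable_fun _ _ _ _ _ (fun s => \int[P]_w k (s, w))%E).
    by move=> s; rewrite inE => sT; apply: eq_integral => w _; rewrite /k /= ext0_in.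
  apply: measurable_funTS.
  exact: (measurable_fun_fubini_tonelli_F (m2 := P) k mk k0).
- have := fubini_tonelli (m1 := leb) (m2 := P) k mk k0.
  rewrite (@integral_restr_eq R (Icc 0 T) _ (fun s => \int[P]_w (F s w)%:E)%E).
  + by move=> ->; apply: eq_integral => w _; rewrite integral_ext0.
  + by move=> s sT; apply: eq_integral => w _; rewrite /k /= ext0_in.
  + by move=> s sT; apply: integral0_eq => w _; rewrite /k /= ext0_out.
Qed.

(** The iterated integral has time inside and expectation outside, the same order as in [L2F] and
    [cost]. *)
Definition L1P T F := pmeas T F /\
  (\int[P]_w \int[leb]_(s in Icc 0 T) `|F s w|%:E < +oo)%E.

Lemma pmeas_norm T F : pmeas T F -> pmeas T (fun s w => `|F s w|).
Proof. by move=> mF; exact: measurableT_comp. Qed.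

(** Inner integrals may be infinite on null sets, where the real-valued integral takes the default
    value 0. The five conclusions record that this default is harmless. *)
Lemma L1P_fubini T F : L1P T F ->
  [/\ {ae P, forall w, L1 T (F ^~ w)},
      P.-integrable setT (EFin \o (fun w => \int[leb]_(s in Icc 0 T) F s w)),
      L1 T (fun s => \int[P]_w F s w),
      {ae leb, forall s, Icc 0 T s -> P.-integrable setT (EFin \o F s)} &
      \int[P]_w \int[leb]_(s in Icc 0 T) F s w =
      \int[leb]_(s in Icc 0 T) \int[P]_w F s w].
Proof.
move=> [mF iF]; have mE := measurable_ext0 mF.
pose k z := (ext0 T F z.1 z.2)%:E.
have mk : measurable_fun setT k by exact/measurable_EFinP.
have ik : (leb \x P)%E.-integrable setT k.
  apply: (proj2 (integrable21ltyP leb P mk)); apply: le_lt_trans iF.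
  under eq_integral => w _.
    have -> : (\int[leb]_x `|k (x, w)| = \int[leb]_(s in Icc 0 T) `|F s w|%:E)%E.
      apply: integral_restr_eq => s sT; rewrite /k /=; first by rewrite ext0_in.
      by rewrite ext0_out// normr0.
    over.
  by [].
have aew : {ae P, forall w, L1 T (F ^~ w)}.
  have := ae_integrable2 ik; apply: filterS => w iw.
  apply: (proj2 (@integrable_mkcond _ _ _ leb _ _ (measurable_itv _))).
  by rewrite restrict_EFin.
have aes : {ae leb, forall s, Icc 0 T s -> P.-integrable setT (EFin \o F s)}.
  have := ae_integrable1 ik; apply: filterS => s is_ sT.
  by apply: eq_integrable is_ => // w _; rewrite /k /= ext0_in.
have KG w : (\int[leb]_s k (s, w) = \int[leb]_(s in Icc 0 T) (F s w)%:E)%E.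
  exact: integral_ext0.
have iF' := integrable_fubini_F ik.
have FI s : Icc 0 T s -> (\int[P]_w k (s, w) = \int[P]_w (F s w)%:E)%E.
  by move=> sT; apply: eq_integral => w _; rewrite /k /= ext0_in.
(* Since [fine] sends both infinities to 0, it never increases the modulus; integrability of the
   extended inner integral passes to its real version. *)
have fin_abse (x : \bar R) : (`|(fine x)%:E| <= `|x|)%E.
  by case: x => [r| |] /=; rewrite ?normr0 ?leey ?lexx.
split => //.
- apply: (@le_integrable _ _ _ P setT measurableT _ (fun w => \int[leb]_s k (s, w))%E).
  + apply/measurable_EFinP; apply: (measurableT_comp (fine_measurable measurableT)).
    apply: eq_measurable_fun (measurable_fubini_G ik) => w _.
    by rewrite /fubini_G KG.
  + by move=> w _; rewrite KG; exact: fin_abse.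
  + apply/integrableP; split; first exact: measurable_fubini_G ik.
    apply: le_lt_trans iF; apply: ge0_le_integral => //.
    * by apply: measurableT_comp => //; exact: measurable_fubini_G ik.
    * by case: (tonelli (pmeas_norm mF) (fun s w => normr_ge0 (F s w))).
    * move=> w _; rewrite KG; apply: le_abse_integral => //.
      by apply/measurable_EFinP; exact: pmeas_secr.
- have iF0 : leb.-integrable (Icc 0 T) (fun s => \int[P]_w k (s, w))%E.
    by apply: integrableS iF' => //; exact: measurable_itv.
  apply: (@le_integrable _ _ _ leb _ (measurable_itv _) _ _ _ _ iF0).
  + apply/measurable_EFinP; apply: (measurableT_comp (fine_measurable measurableT)).
    apply: eq_measurable_fun (measurable_int _ iF0) => s; rewrite inE => sT.
    by rewrite FI.
  + by move=> s sT; rewrite FI//; exact: fin_abse.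
- have E := Fubini ik; rewrite /Rintegral; congr fine.
  have mG := measurable_fubini_G ik.
  have -> : (\int[P]_w (fine (\int[leb]_(s in Icc 0 T) (F s w)%:E))%:E =
      \int[P]_w \int[leb]_s k (s, w))%E.
    apply: ae_eq_integral => //.
    + apply/measurable_EFinP; apply: (measurableT_comp (fine_measurable measurableT)).
      by apply: eq_measurable_fun mG => w _; rewrite /fubini_G KG.
    + apply: filterS aew => w iw _; rewrite KG fineK//.
      by apply: integrable_fin_num => //; exact: measurable_itv.
  rewrite -E (@integral_restr_eq R (Icc 0 T) _ (fun s => \int[P]_w (F s w)%:E)%E).
  + apply: ae_eq_integral; [exact: measurable_itv| | |].
    * apply: (@eq_measurable_fun _ _ _ _ _ (fun s => \int[P]_w k (s, w))%E).
        by move=> s; rewrite inE => sT; rewrite FI.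
      by apply: measurable_funTS; exact: measurable_int iF'.
    * apply/measurable_EFinP; apply: (measurableT_comp (fine_measurable measurableT)).
      apply: (@eq_measurable_fun _ _ _ _ _ (fun s => \int[P]_w k (s, w))%E).
        by move=> s; rewrite inE => sT; rewrite FI.
      by apply: measurable_funTS; exact: measurable_int iF'.
    * have H := @filterS _ _ (ae_filter_ringOfSetsType leb) _ _ _ aes; apply: H => s is_ sT; rewrite fineK//.
      by apply: integrable_fin_num => //; exact: is_.
  + by move=> s sT; exact: FI.
  + by move=> s sT; apply: integral0_eq => w _; rewrite /k /= ext0_out.
Qed.

Lemma eq_L1P T F F' : (forall s w, Icc 0 T s -> F s w = F' s w) ->
  L1P T F -> L1P T F'.
Proof.
move=> FF' [mF iF]; split.
  by apply: eq_measurable_fun mF => -[s w]; rewrite inE => -[/= sT _]; exact: FF'.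
apply: le_lt_trans iF; under eq_integral => w _.
  under eq_integral => s; first (rewrite inE => sT; rewrite -FF'//; over).
  over.
by [].
Qed.

Lemma L1P_le T F F' : pmeas T F -> (forall s w, `|F s w| <= `|F' s w|) ->
  L1P T F' -> L1P T F.
Proof.
move=> mF FF' [mF' iF']; split; first exact: mF.
apply: le_lt_trans iF'.
have [m1 _ _] := tonelli (pmeas_norm mF) (fun s w => normr_ge0 (F s w)).
have [m2 _ _] := tonelli (pmeas_norm mF') (fun s w => normr_ge0 (F' s w)).
apply: ge0_le_integral => //.
- by move=> w _; exact: integral_ge0.
- move=> w _; apply: ge0_le_integral => //.
  + by apply/measurable_EFinP/measurableT_comp => //; exact: pmeas_secr.
  + by apply/measurable_EFinP/measurableT_comp => //; exact: pmeas_secr.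
  + by move=> s _; rewrite lee_fin.
Qed.

Lemma pmeasD T F F' : pmeas T F -> pmeas T F' -> pmeas T (fun s w => F s w + F' s w).
Proof. exact: measurable_funD. Qed.

Lemma pmeasM T F F' : pmeas T F -> pmeas T F' -> pmeas T (fun s w => F s w * F' s w).
Proof. exact: measurable_funM. Qed.

Lemma pmeas_det T (f : R -> R) : measurable_fun (Icc 0 T) f -> pmeas T (fun s _ => f s).
Proof.
move=> mf; rewrite /pmeas.
apply: (@measurable_comp _ _ _ _ _ _ (Icc 0 T) f (Icc 0 T `*` [set: Om]) fst) => //.
  by move=> _ [[s w] [/= sT _] <-].
exact: measurable_funTS.
Qed.

Lemma pmeas_rv T (X : Om -> R) : measurable_fun setT X -> pmeas T (fun _ => X).
Proof. by move=> mX; apply: measurable_funTS; exact: (measurableT_comp mX measurable_snd). Qed.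

Lemma L1PD T F F' : L1P T F -> L1P T F' -> L1P T (fun s w => F s w + F' s w).
Proof.
move=> HF HF'; have [mF iF] := HF; have [mF' iF'] := HF'.
have mFF := pmeasD mF mF'; split; first exact: mFF.
have [m1 _ _] := tonelli (pmeas_norm mFF) (fun s w => normr_ge0 (F s w + F' s w)).
have [m2 _ _] := tonelli (pmeas_norm mF) (fun s w => normr_ge0 (F s w)).
have [m3 _ _] := tonelli (pmeas_norm mF') (fun s w => normr_ge0 (F' s w)).
apply: (@le_lt_trans _ _ (\int[P]_w (\int[leb]_(s in Icc 0 T) `|F s w|%:E +
    \int[leb]_(s in Icc 0 T) `|F' s w|%:E))%E).
  apply: ge0_le_integral => //.
  - by move=> w _; exact: integral_ge0.
  - exact: emeasurable_funD.
  move=> w _; rewrite -ge0_integralD//; last 2 first.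
  - by apply/measurable_EFinP/measurableT_comp => //; exact: pmeas_secr.
  - by apply/measurable_EFinP/measurableT_comp => //; exact: pmeas_secr.
  apply: ge0_le_integral => //.
  - by apply/measurable_EFinP/measurableT_comp => //; exact: (pmeas_secr _ mFF).
  - apply: emeasurable_funD.
      by apply/measurable_EFinP/measurableT_comp => //; exact: pmeas_secr.
    by apply/measurable_EFinP/measurableT_comp => //; exact: pmeas_secr.
  - by move=> s _; rewrite -EFinD lee_fin ler_normD.
rewrite ge0_integralD; [exact: lte_add_pinfty|by []| |exact: m2| |exact: m3].
- by move=> w _; exact: integral_ge0.
- by move=> w _; exact: integral_ge0.
Qed.

Lemma L1PZ T k F : L1P T F -> L1P T (fun s w => k * F s w).
Proof.
move=> [mF iF]; split; first by apply: measurable_funM => //; exact: measurable_cst.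
have [m1 _ _] := tonelli (pmeas_norm mF) (fun s w => normr_ge0 (F s w)).
under eq_integral => w _.
  under eq_integral => s _ do rewrite normrM EFinM.
  rewrite ge0_integralZl//; [over|].
  by apply/measurable_EFinP/measurableT_comp => //; exact: pmeas_secr.
rewrite ge0_integralZl//; first by apply: lte_mul_pinfty => //; exact: integral_ge0.
by move=> w _; exact: integral_ge0.
Qed.

Lemma L1P_sum T (I : Type) (r : seq I) (F : I -> R -> Om -> R) :
  (forall i, L1P T (F i)) -> L1P T (fun s w => \sum_(i <- r) F i s w).
Proof.
move=> LF; elim: r => [|i r IH].
  split; first by rewrite /pmeas; under eq_fun do rewrite big_nil; exact: measurable_cst.
  rewrite integral0_eq ?ltry// => w _; rewrite integral0_eq// => s _.
  by rewrite big_nil normr0.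
by apply: eq_L1P (L1PD (LF i) IH) => s w _; rewrite big_cons.
Qed.

Lemma L1P_mul_det T (f : R -> R) F : bounded_meas T f -> L1P T F ->
  L1P T (fun s w => f s * F s w).
Proof.
move=> [mf [K fK]] LF.
(* The bound on [f] is known on [0, T] only, whereas [L1P_le] compares at all times; cutting [f] off
   to zero makes the bound global. *)
pose F' s w := (f \_ (Icc 0 T)) s * F s w.
have FE s w : Icc 0 T s -> f s * F s w = F' s w by move=> sT; rewrite /F' patchE mem_set.
apply: (@eq_L1P T F') => [s w /FE->//|].
apply: (L1P_le _ _ (L1PZ `|K| LF)).
- apply: (@eq_measurable_fun _ _ _ _ _ (fun z : R * Om => f z.1 * F z.1 z.2)).
    by move=> -[s w]; rewrite inE => -[/= sT _]; exact: FE.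
  by apply: measurable_funM; [exact: pmeas_det|case: LF].
- move=> s w; rewrite /F' !normrM ler_wpM2r// normr_id patchE; case: ifPn => [|_].
    by rewrite inE => /fK/le_trans; apply; exact: ler_norm.
  by rewrite normr0.
Qed.

End ProductIntegration.

(** * Adapted versions of time integrals *)

Section AdaptedIntegral.
Context {R : realType} {d : measure_display} {Om : measurableType d}.
Variable P : probability Om R.
Notation leb := (@lebesgue_measure R).
Implicit Types (T t s : R) (F : R -> Om -> R) (w : Om).

Definition L2P T F := pmeas T F /\
  (\int[P]_w \int[leb]_(s in Icc 0 T) (F s w ^+ 2)%:E < +oo)%E.

Lemma pmeas_sq T F : pmeas T F -> pmeas T (fun s w => F s w ^+ 2).
Proof. by move=> mF; exact: pmeasM. Qed.

Lemma L2P_sq T F : L2P T F -> L1P P T (fun s w => F s w ^+ 2).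
Proof.
move=> [mF iF]; split; first exact: pmeas_sq.
apply: le_lt_trans iF; under eq_integral => w _.
  under eq_integral => s _ do rewrite ger0_norm ?sqr_ge0//.
  over.
by [].
Qed.

Lemma sq_L2P T F : pmeas T F -> L1P P T (fun s w => F s w ^+ 2) -> L2P T F.
Proof.
move=> mF [_ iF]; split; first exact: mF.
apply: le_lt_trans iF; under eq_integral => w _.
  under eq_integral => s _ do rewrite -[X in X%:E]ger0_norm ?sqr_ge0//.
  over.
by [].
Qed.

Lemma leb_Icc0 T : 0 <= T -> leb (Icc 0 T) = T%:E.
Proof.
rewrite /Icc lebesgue_measure_itv /= lte_fin oppr0 adde0 le_eqVlt.
by move=> /predU1P[<-|->//]; rewrite ltxx.
Qed.

Lemma L1P_cst T k : L1P P T (fun _ _ => k).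
Proof.
split; first exact: measurable_cst.
under eq_integral do rewrite integral_cst//.
rewrite integral_cst//.
apply: (@le_lt_trans _ _ (`|k|%:E * leb (Icc 0 T) * P setT)%E) => //.
rewrite probability_setT mule1.
by apply: lte_mul_pinfty => //; exact: leb_Icc_lty.
Qed.

(** This gives the inclusion of L^2 in L^1 on a finite measure space by domination. *)
Lemma le_1sq (x : R) : `|x| <= 1 + x ^+ 2.
Proof.
have := sqr_ge0 (`|x| - 1); rewrite sqrrB real_normK ?num_real// => H.
have := normr_ge0 x; nra.
Qed.

Lemma L2P_L1P T F : L2P T F -> L1P P T F.
Proof.
move=> HF; apply: (L1P_le _ _ (L1PD (L1P_cst T 1) (L2P_sq HF))); first by case: HF.
by move=> s w; apply: le_trans (le_1sq _) (ler_norm _).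
Qed.

Lemma L2PD T F F' : L2P T F -> L2P T F' -> L2P T (fun s w => F s w + F' s w).
Proof.
move=> HF HF'; apply: sq_L2P.
  by apply: pmeasD; [case: HF|case: HF'].
apply: (L1P_le _ _ (L1PZ 2 (L1PD (L2P_sq HF) (L2P_sq HF')))).
  by apply: pmeas_sq; apply: pmeasD; [case: HF|case: HF'].
move=> s w; rewrite ger0_norm ?sqr_ge0//; apply: le_trans (ler_norm _).
have := sqr_ge0 (F s w - F' s w); nra.
Qed.

Lemma L1_sq T (f : R -> R) : measurable_fun (Icc 0 T) f -> L1 T (fun s => f s ^+ 2) -> L1 T f.
Proof.
move=> mf Lf.
have L1f : L1 T (fun s => 1 + f s ^+ 2).
  by apply: L1D => //; apply: bounded_meas_L1; exact: bounded_meas_cst.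
apply: (@le_integrable _ _ _ leb _ (measurable_itv _) _ _ _ _ L1f).
  exact/measurable_EFinP.
by move=> s _; rewrite /= lee_fin; apply: le_trans (le_1sq _) (ler_norm _).
Qed.

(* Parallel axis identity: [T b - int b] has zero mean over [0, T]. *)
Lemma int_shift_sq T (b : R -> R) (a : R) : 0 <= T ->
  measurable_fun (Icc 0 T) b -> L1 T (fun s => b s ^+ 2) ->
  let X := \int[leb]_(s in Icc 0 T) b s in
  L1 T (fun s => (a + (T * b s - X)) ^+ 2) /\
  \int[leb]_(s in Icc 0 T) (a + (T * b s - X)) ^+ 2 =
    T * a ^+ 2 + T ^+ 2 * (\int[leb]_(s in Icc 0 T) b s ^+ 2) - T * X ^+ 2.
Proof.
move=> T0 mb Lb2 X; have Lb := L1_sq mb Lb2.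
have TT : Icc 0 T T by apply/IccP; rewrite T0 lexx.
have LC k : L1 T (fun=> k) by apply: bounded_meas_L1; exact: bounded_meas_cst.
have intC k : \int[leb]_(s in Icc 0 T) k = T * k.
  rewrite Rintegral_cst; last exact: measurable_itv.
  rewrite mulrC; congr (_ * _); exact: (congr1 fine (leb_Icc0 T0)).
have E s : (a + (T * b s - X)) ^+ 2 =
    ((a - X) ^+ 2 + (2 * (a - X) * T) * b s) + T ^+ 2 * b s ^+ 2 by ring.
have LA : L1 T (fun s => (a - X) ^+ 2 + (2 * (a - X) * T) * b s).
  by apply: L1D => //; exact: L1Z.
split; first by under eq_fun do rewrite E; apply: L1D => //; exact: L1Z.
under eq_Rintegral do rewrite E.
rewrite (intD TT LA (L1Z _ Lb2)) (intD TT (LC _) (L1Z _ Lb)) !(intZ _ TT)// intC -/X.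
ring.
Qed.

(** The Cauchy-Schwarz inequality against the constant 1, read off from the nonnegativity of the
    integral in [int_shift_sq] with [a = 0]. *)
Lemma int_sq_le T (b : R -> R) : 0 < T ->
  measurable_fun (Icc 0 T) b -> L1 T (fun s => b s ^+ 2) ->
  (\int[leb]_(s in Icc 0 T) b s) ^+ 2 <= T * \int[leb]_(s in Icc 0 T) b s ^+ 2.
Proof.
move=> T0 mb Lb.
have [_] := int_shift_sq 0 (ltW T0) mb Lb.
set X := \int[leb]_(s in _) b s; set B := \int[leb]_(s in Icc 0 T) b s ^+ 2 => E.
have : 0 <= T * 0 ^+ 2 + T ^+ 2 * B - T * X ^+ 2.
  by rewrite -E; apply: Rintegral_ge0 => s _; exact: sqr_ge0.
rewrite expr0n mulr0 add0r subr_ge0 exprS expr1 -mulrA ler_pM2l//.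
Qed.

Lemma L2P_ae T F : L2P T F -> {ae P, forall w, L1 T (fun s => F s w ^+ 2)}.
Proof. by move=> /L2P_sq /L1P_fubini []. Qed.

(* Averaged over s in [0, T], the left-hand side exceeds E S^2 by at most
   T E(int b^2), because T b(s) - X has zero mean in s; so some s does it. *)
Lemma greedy_step T b (S : Om -> R) : 0 < T -> L2P T b -> measurable_fun setT S ->
  let X w := \int[leb]_(s in Icc 0 T) b s w in
  exists s, Icc 0 T s /\
   (\int[P]_w ((S w + (T * b s w - X w)) ^+ 2)%:E <=
    \int[P]_w (S w ^+ 2)%:E +
     (T * fine (\int[P]_w \int[leb]_(s in Icc 0 T) (b s w ^+ 2)%:E) + 1)%:E)%E.
Proof.
move=> T0 Hb mS X; set beta := fine _; set K := (T * beta + 1)%R.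
have [mb ib] := Hb.
have [_ iX _ _ _] := L1P_fubini (L2P_L1P Hb).
have mX : measurable_fun setT X by apply/measurable_EFinP; exact: measurable_int iX.
pose F s w := (S w + (T * b s w - X w)) ^+ 2.
have mF : pmeas T F.
  apply: pmeas_sq; apply: pmeasD; first exact: pmeas_rv.
  apply: measurable_funB; last exact: pmeas_rv.
  by apply: measurable_funM => //; exact: measurable_cst.
have F0 s w : 0 <= F s w by exact: sqr_ge0.
have [m1 m2 FT] := tonelli P mF F0.
have [m3 _ _] := tonelli P (pmeas_sq mb) (fun s w => sqr_ge0 (b s w)).
have mS2 : measurable_fun setT (fun w => (S w ^+ 2)%:E) by exact/measurable_EFinP/measurable_funX.
have S0 w : (0 <= (S w ^+ 2)%:E)%E by rewrite lee_fin sqr_ge0.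
have ES0 : (0 <= \int[P]_w (S w ^+ 2)%:E)%E by exact: integral_ge0.
(* By contradiction: every s then violates the bound, and integrating the violations over [0, T]
   overshoots the exact average. The summand 1 in [K] provides the strict gap, so no minimizing s is
   needed. *)
apply: contrapT => /forallNP H.
have {}H s : Icc 0 T s -> (\int[P]_w (S w ^+ 2)%:E + K%:E < \int[P]_w (F s w)%:E)%E.
  by move=> sT; rewrite ltNge; apply/negP => h; apply: (H s).
(* An infinite second moment of [S] would make the claimed bound trivial at s = 0, so the negated
   claim forces it to be finite. *)
have : (\int[P]_w (S w ^+ 2)%:E < +oo)%E.
  rewrite ltNge leye_eq; apply/negP => /eqP E.
  have /H : Icc 0 T 0 by apply/IccP; rewrite lexx ltW.
  by rewrite E addye// ltNge leey.
rewrite -ge0_fin_numE// => Sfin.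
have betaE : (\int[P]_w \int[leb]_(s in Icc 0 T) (b s w ^+ 2)%:E = beta%:E)%E.
  rewrite fineK// ge0_fin_numE//; apply: integral_ge0 => w _.
  by apply: integral_ge0 => s _; rewrite lee_fin sqr_ge0.
have lebT := leb_Icc0 (ltW T0).
have lower : (T%:E * (\int[P]_w (S w ^+ 2)%:E + K%:E) <=
    \int[leb]_(s in Icc 0 T) \int[P]_w (F s w)%:E)%E.
  rewrite muleC -lebT -integral_cst; last exact: measurable_itv.
  apply: ge0_le_integral => //.
  - move=> s _; apply: adde_ge0 => //; rewrite lee_fin /K addr_ge0// mulr_ge0 ?(ltW T0)//.
    rewrite fine_ge0// integral_ge0// => w _; apply: integral_ge0 => s' _.
    by rewrite lee_fin sqr_ge0.
  - by move=> s /H/ltW.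
have upper : (\int[P]_w \int[leb]_(s in Icc 0 T) (F s w)%:E <=
    T%:E * \int[P]_w (S w ^+ 2)%:E + (T ^+ 2 * beta)%:E)%E.
  rewrite EFinM -betaE -ge0_integralZl_EFin//; last exact: ltW.
  rewrite -ge0_integralZl_EFin//; last 2 first.
  - by move=> w _; apply: integral_ge0 => s _; rewrite lee_fin sqr_ge0.
  - by rewrite exprn_ge0 ?(ltW T0).
  rewrite -ge0_integralD//; last 4 first.
  - by move=> w _; rewrite mule_ge0// lee_fin ltW.
  - exact: measurable_funeM.
  - move=> w _; rewrite mule_ge0 ?lee_fin ?exprn_ge0 ?(ltW T0)//.
    by apply: integral_ge0 => s _; rewrite lee_fin sqr_ge0.
  - exact: measurable_funeM.
  apply: ae_ge0_le_integral => //.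
  - by move=> w _; apply: integral_ge0 => s _; rewrite lee_fin.
  - move=> w _; apply: adde_ge0; first by rewrite mule_ge0// lee_fin ltW.
    rewrite mule_ge0 ?lee_fin ?exprn_ge0 ?(ltW T0)//.
    by apply: integral_ge0 => s _; rewrite lee_fin sqr_ge0.
  - by apply: emeasurable_funD; exact: measurable_funeM.
  apply: filterS (L2P_ae Hb) => w Lbw _.
  have [LF FE] := int_shift_sq (S w) (ltW T0) (pmeas_secr w mb) Lbw.
  rewrite -[(\int[leb]_(s in Icc 0 T) (F s w)%:E)%E]fineK; last exact: integrable_fin_num.
  rewrite -[fine _]/(\int[leb]_(s in Icc 0 T) F s w) FE.
  rewrite -[(\int[leb]_(s in Icc 0 T) (b s w ^+ 2)%:E)%E]fineK; last exact: integrable_fin_num.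
  rewrite -!EFinM -EFinD lee_fin lerBlDr lerDl.
  by rewrite mulr_ge0 ?sqr_ge0 ?ltW.
(* With e the second moment of [S], the two bounds read [T (e + T beta + 1) <= T e + T^2 beta], that
   is [T <= 0]. *)
move: lower; rewrite -FT => /le_trans /(_ upper).
rewrite -(fineK Sfin) -EFinD -!EFinM -EFinD lee_fin /K.
set e := fine _; nra.
Qed.

(** The sigma-algebra is given by a generating family, so that it matches [natF] and lets
    measurability closure properties be imported through the measurable type generated by [G]. *)
Definition sub_meas (G : set (set Om)) (X : Om -> R) :=
  forall B : set R, measurable B -> <<s G>> [set w | B (X w)].

Lemma sub_measE (G : set (set Om)) (X : Om -> R) :
  sub_meas G X <-> @measurable_fun _ _ (g_sigma_algebraType G) R setT X.
Proof.
split=> [mX _ B mB|mX B mB]; first by rewrite setTI; exact: mX.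
by have := mX measurableT B mB; rewrite setTI.
Qed.

Lemma sub_meas_measurable (G : set (set Om)) (X : Om -> R) :
  G `<=` measurable -> sub_meas G X -> measurable_fun setT X.
Proof.
move=> Gm mX _ B mB; rewrite setTI.
have H := mX B mB; apply: (smallest_sub _ Gm H).
exact: sigma_algebra_measurable.
Qed.

Lemma sub_meas_le (G G' : set (set Om)) (X : Om -> R) :
  G `<=` G' -> sub_meas G X -> sub_meas G' X.
Proof. by move=> GG mX B mB; apply: sub_sigma_algebra2 GG _ (mX B mB). Qed.

Lemma sub_meas_cst (G : set (set Om)) (k : R) : sub_meas G (cst k).
Proof. by apply/sub_measE; exact: measurable_cst. Qed.

Lemma sub_measD (G : set (set Om)) (X Y : Om -> R) :
  sub_meas G X -> sub_meas G Y -> sub_meas G (fun w => X w + Y w).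
Proof.
move=> /sub_measE mX /sub_measE mY; apply/sub_measE.
exact: measurable_funD.
Qed.

Lemma sub_measM (G : set (set Om)) (X Y : Om -> R) :
  sub_meas G X -> sub_meas G Y -> sub_meas G (fun w => X w * Y w).
Proof.
move=> /sub_measE mX /sub_measE mY; apply/sub_measE.
exact: measurable_funM.
Qed.

Lemma sub_meas_sum (G : set (set Om)) (I : Type) (r : seq I) (X : I -> Om -> R) :
  (forall i, sub_meas G (X i)) -> sub_meas G (fun w => \sum_(i <- r) X i w).
Proof.
move=> mX; elim: r => [|i r IH].
  by under eq_fun do rewrite big_nil; exact: sub_meas_cst.
by under eq_fun do rewrite big_cons; exact: sub_measD.
Qed.

(** An upper limit is defined for every w and inherits measurability from the sequence; it equals
    the limit wherever that exists. The null set without convergence thus need not belong to the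
    sigma-algebra. *)
Definition rlimsup (X : nat -> Om -> R) w := fine (limn_esup (fun k => (X k w)%:E)).

Lemma rlimsupE (X : nat -> Om -> R) w l : (X ^~ w) k @[k --> \oo] --> l ->
  rlimsup X w = l.
Proof.
move=> Xl; rewrite /rlimsup.
have H : (X k w)%:E @[k --> \oo] --> l%:E by apply/fine_cvgP; split => //; exact: nearW.
rewrite is_cvg_limn_esupE; last by apply/cvg_ex; exists l%:E.
by rewrite (cvg_lim _ H).
Qed.

Lemma sub_meas_rlimsup (G : set (set Om)) (X : nat -> Om -> R) :
  (forall k, sub_meas G (X k)) -> sub_meas G (rlimsup X).
Proof.
move=> mX; apply/sub_measE; apply: (measurableT_comp (fine_measurable measurableT)).
apply: measurable_fun_limn_esup => k.
by apply/measurable_EFinP/sub_measE.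
Qed.

Lemma sqr_cvg0 (u : nat -> R) : u k ^+ 2 @[k --> \oo] --> 0 -> u k @[k --> \oo] --> 0.
Proof.
move=> H; apply/norm_cvg0P.
have -> : (fun k => `|u k|) = (fun k => Num.sqrt (u k ^+ 2)).
  by apply/funext => k; rewrite sqrtr_sqr.
rewrite -[X in _ --> X]sqrtr0.
exact: continuous_cvg (@sqrt_continuous R 0) H.
Qed.

(** The sum of all squares has finite expectation, hence is finite almost surely, and the terms of a
    convergent series tend to 0. The bound is written in the form of a geometric series of ratio one
    half with sum [C]. *)
Lemma sum_cvg_ae (S : nat -> Om -> R) (C : R) :
  (forall k, measurable_fun setT (S k)) ->
  (forall k, (\int[P]_w (S k w ^+ 2)%:E <= (C / (2 ^ (k + 1))%:R)%:E)%E) ->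
  {ae P, forall w, S k w @[k --> \oo] --> 0}.
Proof.
move=> mS SC.
have C0 : 0 <= C.
  have : (0 <= (C / (2 ^ (0 + 1))%:R)%:E)%E.
    by apply: le_trans (SC 0); apply: integral_ge0 => w _; rewrite lee_fin sqr_ge0.
  by rewrite lee_fin pmulr_lge0// invr_gt0 ltr0n.
have mS2 k : measurable_fun setT (fun w => (S k w ^+ 2)%:E).
  by apply/measurable_EFinP/measurable_funX.
have S0 k w : (0 <= (S k w ^+ 2)%:E)%E by rewrite lee_fin sqr_ge0.
pose g w := (\sum_(0 <= k <oo) (S k w ^+ 2)%:E)%E.
have mg : measurable_fun setT g by apply: ge0_emeasurable_sum.
have g0 w : (0 <= g w)%E by apply: nneseries_ge0.
have ig : (\int[P]_w g w < +oo)%E.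
  rewrite integral_nneseries//.
  apply: (@le_lt_trans _ _ (\sum_(0 <= k <oo) (C / (2 ^ (k + 1))%:R)%:E)%E).
    apply: lee_nneseries => // k _ _; exact: integral_ge0.
  have H := @cvg_geometric_eseries_half R C 0.
  by rewrite (cvg_lim _ H)// ltry.
have : P.-integrable setT g.
  apply/integrableP; split => //.
  by under eq_integral do rewrite gee0_abs//.
move=> /(integrable_ae measurableT); apply: filterS => w /(_ I) gw.
apply: sqr_cvg0; apply: cvg_series_cvg_0.
apply: nnseries_is_cvg => [k|]; first exact: sqr_ge0.
by rewrite -[X in (X < _)%E]/(g w) -ge0_fin_numE.
Qed.

(* Choosing the nodes s_i greedily keeps the second moment of
   T (sum of the b(s_i)) - k X linear in k, so the averages over 2^k nodes,
   which are G-measurable, converge to X in L^2 at a summable rate. *)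
Lemma adapted_integral (G : set (set Om)) T b : 0 < T -> G `<=` measurable ->
  L2P T b -> (forall s, Icc 0 T s -> sub_meas G (b s)) ->
  exists Y : Om -> R, sub_meas G Y /\
    {ae P, forall w, Y w = \int[leb]_(s in Icc 0 T) b s w}.
Proof.
move=> T0 Gm Hb bG.
pose X w := \int[leb]_(s in Icc 0 T) b s w.
pose K := (T * fine (\int[P]_w \int[leb]_(s in Icc 0 T) (b s w ^+ 2)%:E) + 1).
have [_ iX _ _ _] := L1P_fubini (L2P_L1P Hb).
have mX : measurable_fun setT X by apply/measurable_EFinP; exact: measurable_int iX.
have Ts : Icc 0 T 0 by apply/IccP; rewrite lexx ltW.
(* Measurability of [S] is placed inside the conclusion so that [choice] gives a selector on all
   functions; the node 0 is the default for the others. *)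
have step (S : Om -> R) : exists s, Icc 0 T s /\ (measurable_fun setT S ->
   (\int[P]_w ((S w + (T * b s w - X w)) ^+ 2)%:E <=
    \int[P]_w (S w ^+ 2)%:E + K%:E)%E).
  have [mS|nmS] := pselect (measurable_fun setT S); last by exists 0.
  by have [s [sT H]] := greedy_step T0 Hb mS; exists s.
have [sel selP] := choice step.
(* The running error: T times the sum of [b] over the first k nodes, minus k times the integral. The
   next node is selected from the current error. *)
pose Sg := fix Sg k := if k is k'.+1 then
  (fun w => Sg k' w + (T * b (sel (Sg k')) w - X w)) else (fun=> 0).
have mSg k : measurable_fun setT (Sg k).
  elim: k => [|k IH] /=; first exact: measurable_cst.
  apply: measurable_funD => //; apply: measurable_funB => //.
  apply: measurable_funM; first exact: measurable_cst.
  by apply: (pmeas_secl (proj1 Hb)); have [] := selP (Sg k).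
have SgK k : (\int[P]_w (Sg k w ^+ 2)%:E <= (k%:R * K)%:E)%E.
  elim: k => [|k IH].
    by rewrite mul0r integral0_eq// => w _; rewrite /= expr0n.
  have [_ /(_ (mSg k))] := selP (Sg k); move=> /le_trans; apply.
  have -> : (k.+1%:R * K)%:E = ((k%:R * K)%:E + K%:E)%E.
    by rewrite -EFinD -natr1 mulrDl mul1r.
  exact: leeD.
have SgE k w : Sg k w = T * (\sum_(i < k) b (sel (Sg i)) w) - k%:R * X w.
  elim: k => [|k IH]; first by rewrite big_ord0 mulr0 mul0r subr0.
  by rewrite big_ord_recr /= IH -natr1; ring.
pose A k w := T / (2 ^ k)%:R * (\sum_(i < 2 ^ k) b (sel (Sg i)) w).
have two0 k : (2 ^ k)%:R != 0 :> R by rewrite pnatr_eq0 expn_eq0.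
have AE k w : A k w - X w = Sg (2 ^ k)%N w / (2 ^ k)%:R.
  by rewrite SgE /A; field.
exists (rlimsup A); split.
  apply: sub_meas_rlimsup => k; apply: sub_measM; first exact: sub_meas_cst.
  by apply: sub_meas_sum => i; apply: bG; have [] := selP (Sg i).
have : {ae P, forall w, (A k w - X w) @[k --> \oo] --> 0}.
  (* The error of the average over [2^k] nodes has second moment at most [2^k K / 4^k], which is
     [2 K / 2^(k+1)]. *)
  apply: (@sum_cvg_ae _ (2 * K)).
    by move=> k; under eq_fun do rewrite AE; apply: measurable_funM.
  move=> k; under eq_integral => w _.
    rewrite AE exprMn mulrC EFinM; over.
  rewrite ge0_integralZl_EFin//; last 2 first.
  - by move=> w _; rewrite lee_fin sqr_ge0.
  - by apply/measurable_EFinP/measurable_funX.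
  apply: (@le_trans _ _ (((2 ^ k)%:R^-1 ^+ 2)%:E * ((2 ^ k)%:R * K)%:E)%E).
    by apply: lee_wpmul2l => //; rewrite lee_fin sqr_ge0.
  rewrite -EFinM lee_fin addn1 expnS natrM.
  rewrite le_eqVlt; apply/orP; left; apply/eqP; field.
  exact: two0.
apply: filterS => w H; apply: rlimsupE.
have : (A k w - X w) + X w @[k --> \oo] --> 0 + X w by apply: cvgD => //; exact: cvg_cst.
by under eq_fun do rewrite subrK; rewrite add0r.
Qed.

End AdaptedIntegral.

(** * Adapted and jointly measurable versions of primitives *)

Section AdaptedVersion.
Context {R : realType} {d : measure_display} {Om : measurableType d}.
Variable P : probability Om R.
Notation leb := (@lebesgue_measure R).
Implicit Types (T t s : R) (F : R -> Om -> R) (w : Om).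

(** Rounding down to level n. Staying at or before t keeps everything evaluated at [dyad n t]
    measurable with respect to the past of t. *)
Definition dyad n (t : R) : R := (Num.truncn (2 ^+ n * t))%:R / 2 ^+ n.

Lemma dyad_itv n t : 0 <= t -> 0 <= dyad n t <= t.
Proof.
move=> t0; have p0 : 0 < 2 ^+ n :> R by rewrite exprn_gt0.
rewrite /dyad divr_ge0 ?(ltW p0)//= ler_pdivrMr// [leRHS]mulrC.
by have /andP[] := truncn_itv (mulr_ge0 (ltW p0) t0).
Qed.

Lemma dyad_cvg t : 0 <= t -> dyad n t @[n --> \oo] --> t.
Proof.
move=> t0; apply/cvgrPdist_le => e e0.
have H : (2^-1 : R) ^+ n @[n --> \oo] --> 0.
  by apply: cvg_expr; rewrite ger0_norm// invf_lt1// ltr1n.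
move/cvgrPdist_lt : H => /(_ e e0); apply: filterS => n.
rewrite sub0r normrN ger0_norm ?exprn_ge0// => /ltW ne.
have p0 : 0 < 2 ^+ n :> R by rewrite exprn_gt0.
have /andP[_ dt] := dyad_itv n t0.
rewrite ger0_norm ?subr_ge0//; apply: le_trans ne.
have /andP[_ tn] := truncn_itv (mulr_ge0 (ltW p0) t0).
rewrite -(ler_pM2l p0) mulrBr /dyad [X in _ - X]mulrC divfK ?gt_eqF//.
rewrite -exprMn divff ?expr1n; last by rewrite pnatr_eq0.
by rewrite lerBlDl natr1 ltW.
Qed.

Lemma pmeas_dyad T (Z : R -> Om -> R) n :
  (forall q, Icc 0 T q -> measurable_fun setT (Z q)) ->
  pmeas T (fun t w => Z (dyad n t) w).
Proof.
move=> mZ _ B mB.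
pose q k : R := k%:R / 2 ^+ n.
have p0 : 0 < 2 ^+ n :> R by rewrite exprn_gt0.
(* The process is constant in time on each dyadic slab, so the preimage is a countable union of
   rectangles. Slabs starting after T miss [0, T]; they are replaced by the empty set because [Z] is
   controlled on [0, T] only. *)
have -> : (Icc 0 T `*` [set: Om]) `&` (fun z : R * Om => Z (dyad n z.1) z.2) @^-1` B =
    \bigcup_k (if q k <= T then
      (Icc 0 T `&` `[q k, q k.+1[) `*` (Z (q k) @^-1` B) else set0).
  apply/seteqP; split.
    move=> [t w] [[/= tT _] ZB]; exists (Num.truncn (2 ^+ n * t)) => //.
    have /IccP/andP[t0 t1] := tT.
    have /andP[d0 d1] := dyad_itv n t0.
    rewrite ifT; last exact: le_trans d1 t1.
    split => //=; split => //; rewrite in_itv /= d1 /= /q ltr_pdivlMr// mulrC.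
    by have /andP[] := truncn_itv (mulr_ge0 (ltW p0) t0).
  move=> [t w] [k _]; case: ifP => // qk [[/= tT]]; rewrite in_itv /= => /andP[h1 h2] ZB.
  have -> : dyad n t = q k; last by [].
  rewrite /dyad; congr (_%:R / _); apply: truncn_def; apply/andP; split.
    by rewrite mulrC -ler_pdivrMr.
  by rewrite mulrC -ltr_pdivlMr.
apply: bigcupT_measurable => k; case: ifP => // qk; apply: measurableX.
  by apply: measurableI; exact: measurable_itv.
rewrite -[X in measurable X]setTI; apply: mZ => //.
by apply/IccP; rewrite qk andbT divr_ge0// ltW.
Qed.

Lemma pmeas_rlimsup T (Z : nat -> R -> Om -> R) : (forall n, pmeas T (Z n)) ->
  pmeas T (fun t => rlimsup (fun n => Z n t)).
Proof.
move=> mZ; rewrite /pmeas.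
apply: (measurableT_comp (fine_measurable measurableT)).
apply: (measurable_fun_limn_esup (f := fun k z => (Z k z.1 z.2)%:E)) => k.
by apply/measurable_EFinP; exact: mZ.
Qed.

Lemma cvg_dyad T (f : R -> R) t : {within Icc 0 T, continuous f} -> Icc 0 T t ->
  f (dyad n t) @[n --> \oo] --> f t.
Proof.
move=> cf tT; have /IccP/andP[t0 t1] := tT.
have /subspace_continuousP/(_ t tT) := cf.
apply: cvg_comp.
move=> A; rewrite /nbhs /= /within /= => HA.
have H : \forall n \near \oo, Icc 0 T (dyad n t) -> A (dyad n t) := dyad_cvg t0 HA.
suff: \forall n \near \oo, A (dyad n t) by [].
apply: filterS H => n; apply.
apply/IccP; have /andP[-> d1] := dyad_itv n t0.
exact: le_trans d1 t1.
Qed.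

Lemma L2P_le T t F : t <= T -> L2P P T F -> L2P P t F.
Proof.
move=> tT [mF iF].
have sub : Icc 0 t `<=` Icc 0 T by move=> s; exact: Icc_le.
have mFt : pmeas t F.
  apply: measurable_funS mF; first exact: measurable_cyl.
  by move=> -[s w] [/= st _]; split => //; exact: sub.
split; first exact: mFt.
apply: le_lt_trans iF.
have [m1 _ _] := tonelli P (pmeas_sq mF) (fun s w => sqr_ge0 (F s w)).
have [m2 _ _] := tonelli P (pmeas_sq mFt) (fun s w => sqr_ge0 (F s w)).
apply: ge0_le_integral => //.
- by move=> w _; apply: integral_ge0 => s _; rewrite lee_fin sqr_ge0.
- move=> w _; apply: ge0_subset_integral => //.
  + by apply/measurable_EFinP; exact: (pmeas_secr _ (pmeas_sq mF)).
  + by move=> s _; rewrite lee_fin sqr_ge0.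
Qed.

(* Off a null set the primitive is continuous, so it can be recovered as a left
   limit along dyadic times, where adapted versions are available; this avoids
   completing the filtration. *)
Lemma adapted_primitive (G : R -> set (set Om)) T h : 0 < T ->
  (forall s t, s <= t -> G s `<=` G t) -> (forall t, G t `<=` measurable) ->
  L2P P T h -> (forall s, Icc 0 T s -> sub_meas (G s) (h s)) ->
  exists V : R -> Om -> R, [/\ pmeas T V,
    (forall t, Icc 0 T t -> sub_meas (G t) (V t)) &
    {ae P, forall w, forall t, Icc 0 T t -> V t w = \int[leb]_(s in Icc 0 t) h s w}].
Proof.
move=> T0 Gmono Gmeas Hh hG.
(* The condition on t is kept inside so that [choice] applies. The constant 0 serves outside [0, T],
   and also at t = 0, where [adapted_integral] does not apply but the integral vanishes. *)
have ex t : exists Y : Om -> R, Icc 0 T t -> sub_meas (G t) Y /\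
    {ae P, forall w, Y w = \int[leb]_(s in Icc 0 t) h s w}.
  have [/IccP/andP[]|] := pselect (Icc 0 T t); last by exists (cst 0).
  rewrite le_eqVlt => /predU1P[<- _|t0 tT].
    exists (cst 0) => _; split; first exact: sub_meas_cst.
    by apply: aeW => w; rewrite int_00.
  have [|Y [mY YE]] := adapted_integral t0 (Gmeas t) (L2P_le tT Hh).
    move=> s st; apply: (sub_meas_le (Gmono s t _)); last by apply: hG; exact: Icc_le tT st.
    by move/IccP: st => /andP[].
  by exists Y.
have [Y HY] := choice ex.
exists (fun t => rlimsup (fun n => Y (dyad n t))); split.
- apply: pmeas_rlimsup => n; apply: pmeas_dyad => q qT.
  by have [mY _] := HY q qT; exact: sub_meas_measurable mY.
- move=> t tT; apply: sub_meas_rlimsup => n.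
  have /IccP/andP[t0 t1] := tT.
  have /andP[d0 d1] := dyad_itv n t0.
  apply: (sub_meas_le (Gmono _ _ d1)).
  have dT : Icc 0 T (dyad n t) by apply/IccP; rewrite d0 (le_trans d1).
  by have [] := HY _ dT.
(* There are countably many dyadic times, so their exceptional sets combine into one null set. *)
- have ae1 : {ae P, forall w, forall n k, Icc 0 T (k%:R / 2 ^+ n) ->
      Y (k%:R / 2 ^+ n) w = \int[leb]_(s in Icc 0 (k%:R / 2 ^+ n)) h s w}.
    apply: ae_foralln => n; apply: ae_foralln => k.
    have [kT|kT] := pselect (Icc 0 T (k%:R / 2 ^+ n)); last by apply: aeW.
    by have [_] := HY _ kT; apply: filterS => w + _.
  have [ae2 _ _ _ _] := L1P_fubini (L2P_L1P Hh).
  apply: filterS2 ae1 ae2 => w H1 H2 t tT; apply: rlimsupE.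
  have /IccP/andP[t0 t1] := tT.
  have E n : Y (dyad n t) w = \int[leb]_(s in Icc 0 (dyad n t)) h s w.
    have /andP[d0 d1] := dyad_itv n t0.
    by apply: H1; apply/IccP; rewrite -/(dyad n t) d0 (le_trans d1).
  under eq_fun do rewrite E.
  apply: (@cvg_dyad T (fun t => \int[leb]_(s in Icc 0 t) h s w)) => //.
  exact: parameterized_integral_continuous (ltW T0) H2.
Qed.

End AdaptedVersion.

(** * Brownian motion *)

Section Brownian.
Context {R : realType}.
Notation leb := (@lebesgue_measure R).

(** The Radon-Nikodym derivative and [normal_pdf] have the same integral over every measurable set,
    hence agree almost everywhere. *)
Lemma ge0_integral_normal (s : R) (f : R -> \bar R) :
  s != 0 -> measurable_fun setT f -> (forall x, 0 <= f x)%E ->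
  (\int[normal_prob 0 s]_x f x = \int[leb]_x (f x * (normal_pdf 0 s x)%:E))%E.
Proof.
move=> s0 mf f0.
have dom := @normal_prob_dominates R 0 s.
rewrite -(Radon_Nikodym_SigmaFinite.change_of_variables dom f0 measurableT mf).
have irn := Radon_Nikodym_SigmaFinite.f_integrable dom.
apply: ae_eq_integral => //.
- by apply: emeasurable_funM => //; exact: measurable_int irn.
- apply: emeasurable_funM => //; apply/measurable_EFinP; exact: measurable_normal_pdf.
- apply: ae_eqe_mul2l; apply: integral_ae_eq => //.
  + by apply/measurable_EFinP; exact: measurable_normal_pdf.
  + move=> E _ mE; rewrite -Radon_Nikodym_SigmaFinite.f_integral//.
Qed.

(* The constant 16 is not sharp: x^2 times the density of N(0, s^2) is compared
   with the density of N(0, 4 s^2). *)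
Lemma normal_moment2_le (s : R) : 0 < s ->
  (\int[normal_prob 0 s]_x (x ^+ 2)%:E <= (16 * s ^+ 2)%:E)%E.
Proof.
move=> s0; rewrite ge0_integral_normal ?gt_eqF//; last 2 first.
- by apply/measurable_EFinP; apply: measurable_funX.
- by move=> x; rewrite lee_fin sqr_ge0.
pose t := 2 * s.
have t0 : 0 < t by rewrite mulr_gt0.
have t2 : t ^+ 2 = 4 * s ^+ 2 by rewrite /t; ring.
have s20 : 0 < s ^+ 2 by rewrite exprn_gt0.
have peak : normal_peak s = 2 * normal_peak t.
  rewrite /normal_peak t2.
  have -> : 4 * s ^+ 2 * pi *+ 2 = 2 ^+ 2 * (s ^+ 2 * pi *+ 2) by ring.
  by rewrite sqrtrM ?sqr_ge0// sqrtr_sqr ger0_norm// invfM mulVKf.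
have pdf_le x : x ^+ 2 * normal_pdf 0 s x <= 16 * s ^+ 2 * normal_pdf 0 t x.
  rewrite !normal_pdfE ?gt_eqF//= peak /normal_fun subr0 t2.
  (* With this y the two Gaussian exponents are [- 4 y] and [- y], and [x^2 = 8 s^2 y]. The claim
     reduces to [y exp(- 3 y) <= 1], and 16 is the product of 8 with the ratio 2 of the peaks. *)
  set y := x ^+ 2 / (8 * s ^+ 2).
  have y0 : 0 <= y by rewrite divr_ge0 ?sqr_ge0// mulr_ge0// ltW.
  have -> : - x ^+ 2 / (s ^+ 2 *+ 2) = - y - 3 * y by rewrite /y; field; rewrite gt_eqF.
  have -> : - x ^+ 2 / (4 * s ^+ 2 *+ 2) = - y by rewrite /y; field; rewrite gt_eqF.
  have -> : x ^+ 2 = 8 * s ^+ 2 * y by rewrite /y; field; rewrite gt_eqF.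
  rewrite expRD.
  have ye : y * expR (- (3 * y)) <= 1.
    rewrite expRN ler_pdivrMr ?expR_gt0// mul1r.
    by apply: le_trans (expR_ge1Dx _); lra.
  have := normal_peak_ge0 t; have := expR_ge0 (- y).
  set e := expR (- y) in ye *; set e3 := expR (- (3 * y)) in ye *; set p := normal_peak t.
  move=> e0 p0.
  have -> : 8 * s ^+ 2 * y * (2 * p * (e * e3)) = (16 * s ^+ 2 * (p * e)) * (y * e3) by ring.
  by rewrite ler_piMr// !mulr_ge0// ltW.
apply: (@le_trans _ _ (\int[leb]_x ((16 * s ^+ 2)%:E * (normal_pdf 0 t x)%:E))%E).
  apply: ge0_le_integral => //.
  - by move=> x _; rewrite -EFinM lee_fin mulr_ge0 ?sqr_ge0// normal_pdf_ge0.
  - by apply/measurable_EFinP; apply: measurable_funM; [exact: measurable_funX|exact: measurable_normal_pdf].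
  - by apply/measurable_EFinP; apply: measurable_funM => //; exact: measurable_normal_pdf.
  - by move=> x _; rewrite -!EFinM lee_fin.
rewrite ge0_integralZl_EFin//.
- by rewrite integral_normal_pdf mule1.
- by move=> x _; rewrite lee_fin normal_pdf_ge0.
- by apply/measurable_EFinP; exact: measurable_normal_pdf.
- by rewrite mulr_ge0// ltW.
Qed.

Context {d : measure_display} {Om : measurableType d}.
Variable P : probability Om R.

Lemma law_normal_moment2 (X : Om -> R) (s : R) : 0 < s -> measurable_fun setT X ->
  (forall B, measurable B -> P (X @^-1` B) = (fine (normal_prob 0 s B))%:E) ->
  (\int[P]_w (X w ^+ 2)%:E <= (16 * s ^+ 2)%:E)%E.
Proof.
move=> s0 mX law; apply: le_trans (normal_moment2_le s0).
pose nu : {measure set (measurableTypeR R) -> \bar R} :=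
  pushforward P (X : Om -> measurableTypeR R).
have E := @eq_measure_integral _ _ _ setT (normal_prob 0 s) (nu mX) (fun x => (x ^+ 2)%:E).
have E2 := @ge0_integral_pushforward _ _ Om (measurableTypeR R) R X mX P setT
  (fun x => (x ^+ 2)%:E) measurableT.
rewrite le_eqVlt; apply/orP; left; apply/eqP.
transitivity (\int[nu mX]_x (x ^+ 2)%:E)%E.
  apply/esym/E2; first by apply/measurable_EFinP; apply: measurable_funX.
  by move=> x _; rewrite lee_fin sqr_ge0.
apply: E => A mA _.
rewrite [LHS]law// fineK//.
exact: fin_num_measure.
Qed.

(** The generating family inside [natF], named so that the lemmas on [sub_meas] apply to the natural
    filtration. *)
Definition natgen k (W : R -> Om -> 'cV[R]_k) (t : R) : set (set Om) :=
  [set A | exists (r : R) (j : 'I_k) (B : set R),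
        [/\ 0 <= r <= t, measurable B & A = [set w | B (W r w j 0)]]].

Lemma natgen_le k (W : R -> Om -> 'cV[R]_k) s t : s <= t -> natgen W s `<=` natgen W t.
Proof.
move=> st A [r [j [B [/andP[r0 rs] mB ->]]]]; exists r, j, B; split => //.
by rewrite r0 (le_trans rs).
Qed.

Lemma natgen_measurable k (W : R -> Om -> 'cV[R]_k) t : std_BM P W ->
  natgen W t `<=` measurable.
Proof.
move=> [mW _ _ _] A [r [j [B [_ mB ->]]]].
by have := mW r j measurableT B mB; rewrite setTI.
Qed.

Lemma natgen_adapted k (W : R -> Om -> 'cV[R]_k) t j : 0 <= t ->
  sub_meas (natgen W t) (fun w => W t w j 0).
Proof.
by move=> t0 B mB; apply: sub_sigma_algebra; exists t, j, B; rewrite t0 lexx.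
Qed.

(** By continuity of paths, [W t] is the limit of its values at dyadic times, each of which gives a
    jointly measurable step process. *)
Lemma BM_pmeas k (W : R -> Om -> 'cV[R]_k) T j : std_BM P W ->
  pmeas T (fun t w => W t w j 0).
Proof.
move=> [mW _ cW _]; rewrite /pmeas.
apply: (@eq_measurable_fun _ _ _ _ _
  (fun z : R * Om => rlimsup (fun n w => W (dyad n z.1) w j 0) z.2)).
  move=> -[t w]; rewrite inE => -[/= tT _]; apply: rlimsupE.
  apply: (@cvg_dyad _ T (fun t => W t w j 0)) => //.
  apply: continuous_subspaceW (cW w j) => s /IccP/andP[s0 _].
  by rewrite /= in_itv /= s0.
apply: (pmeas_rlimsup (Z := fun n t w => W (dyad n t) w j 0)) => n.
by apply: (@pmeas_dyad _ _ _ T (fun t w => W t w j 0)) => q _; exact: mW.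
Qed.

Lemma BM_moment2 k (W : R -> Om -> 'cV[R]_k) t j : std_BM P W -> 0 <= t ->
  (\int[P]_w (W t w j 0 ^+ 2)%:E <= (16 * t)%:E)%E.
Proof.
move=> [mW W0 _ law]; rewrite le_eqVlt => /predU1P[<-|t0].
  rewrite mulr0 integral0_eq// => w _.
  by rewrite W0 mxE expr0n.
have st0 : 0 < Num.sqrt t by rewrite sqrtr_gt0.
apply: le_trans (law_normal_moment2 st0 (mW t j) _) _; last by rewrite sqr_sqrtr// ltW.
move=> B mB.
(* The law of one component is extracted from the increment over [0, t] by taking the sure event in
   the past and leaving the other components unconstrained: their factors are 1. *)
have mBi (i : 'I_k) : measurable (if i == j then B else setT : set R) by case: ifP.
have FT : natF W 0 setT.
  have := @measurableT _ (g_sigma_algebraType (natgen W 0)); exact.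
have := law 0 t (lexx _) t0 setT FT _ mBi.
rewrite setTI probability_setT mul1r subr0 (bigD1 j)//= eqxx big1 ?mulr1 => [<-|i /negbTE ->].
  congr (P _); apply/seteqP; split => w /=.
  + by move=> Bw i; case: ifP => // /eqP ->; rewrite W0 mxE subr0.
  + by move=> /(_ j); rewrite eqxx W0 mxE subr0.
by rewrite probability_setT.
Qed.

Lemma BM_L2P k (W : R -> Om -> 'cV[R]_k) T j : 0 <= T -> std_BM P W ->
  L2P P T (fun t w => W t w j 0).
Proof.
move=> T0 HW; have mW := BM_pmeas (T := T) j HW; split => //.
have [_ m2 ->] := tonelli P (pmeas_sq mW) (fun s w => sqr_ge0 _).
apply: (@le_lt_trans _ _ (\int[leb]_(s in Icc 0 T) (16 * T)%:E)%E).
  apply: ge0_le_integral => //.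
  - by move=> s _; apply: integral_ge0 => w _; rewrite lee_fin sqr_ge0.
  - move=> s /IccP/andP[s0 sT]; apply: le_trans (BM_moment2 j HW s0) _.
    by rewrite lee_fin ler_pM2l.
rewrite integral_cst//; apply: lte_mul_pinfty => //.
- by rewrite lee_fin mulr_ge0.
- exact: leb_Icc_lty.
Qed.

End Brownian.

(** * Square-integrable processes *)

Section ExpectedIntegral.
Context {R : realType} {d : measure_display} {Om : measurableType d}.
Variable P : probability Om R.
Notation leb := (@lebesgue_measure R).
Implicit Types (T t s : R) (F : R -> Om -> R) (w : Om).

Definition E2 T F := fine (\int[P]_w \int[leb]_(s in Icc 0 T) (F s w)%:E)%E.

Lemma integral_P_cst (c : \bar R) : (\int[P]_w c = c)%E.
Proof.
rewrite integral_cst//; transitivity (c * P setT)%E => //.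
by rewrite probability_setT mule1.
Qed.

Lemma L1P_ext0 T F : L1P P T F ->
  (leb \x P)%E.-integrable setT (fun z => (ext0 T F z.1 z.2)%:E).
Proof.
move=> [mF iF]; have mE := measurable_ext0 mF.
have mk : measurable_fun setT (fun z => (ext0 T F z.1 z.2)%:E) by exact/measurable_EFinP.
apply: (proj2 (integrable21ltyP leb P mk)); apply: le_lt_trans iF.
under eq_integral => w _.
  have -> : (\int[leb]_x `|(ext0 T F x w)%:E| = \int[leb]_(s in Icc 0 T) `|F s w|%:E)%E.
    apply: integral_restr_eq => s sT; rewrite /=; first by rewrite ext0_in.
    by rewrite ext0_out// normr0.
  over.
by [].
Qed.

(** An inner time integral may be infinite on a null set of paths, which obstructs linearity inside
    the iterated integral; over the product measure linearity is immediate. *)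
Lemma E2_prod T F : L1P P T F ->
  E2 T F = Rintegral (leb \x P)%E setT (fun z => ext0 T F z.1 z.2).
Proof.
move=> /L1P_ext0 iF; rewrite /E2 /Rintegral -(integral21_prod_meas1 iF).
by congr fine; apply: eq_integral => w _; rewrite -integral_ext0.
Qed.

Lemma E2D T F F' : L1P P T F -> L1P P T F' ->
  E2 T (fun s w => F s w + F' s w) = E2 T F + E2 T F'.
Proof.
move=> LF LF'; rewrite (E2_prod (L1PD LF LF')) (E2_prod LF) (E2_prod LF').
rewrite -RintegralD; [|exact: measurableT|exact: L1P_ext0 LF|exact: L1P_ext0 LF'].
apply: eq_Rintegral => -[s w] _ /=; rewrite /ext0 !patchE.
by case: ifP => // _; rewrite addr0.
Qed.

Lemma E2Z T k F : L1P P T F -> E2 T (fun s w => k * F s w) = k * E2 T F.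
Proof.
move=> LF; rewrite (E2_prod (L1PZ k LF)) (E2_prod LF).
rewrite -RintegralZl; [|exact: measurableT|exact: L1P_ext0 LF].
apply: eq_Rintegral => -[s w] _ /=; rewrite /ext0 !patchE.
by case: ifP => // _; rewrite mulr0.
Qed.

Lemma eq_E2 T F F' : (forall s w, Icc 0 T s -> F s w = F' s w) -> E2 T F = E2 T F'.
Proof.
move=> FF'; rewrite /E2; congr fine; apply: eq_integral => w _.
by apply: eq_integral => s; rewrite inE => sT; rewrite FF'.
Qed.

Lemma E2_fubini T F : L1P P T F ->
  E2 T F = \int[leb]_(s in Icc 0 T) \int[P]_w F s w.
Proof.
move=> LF; have [_ _ LG aes _] := L1P_fubini LF.
rewrite E2_prod// /Rintegral -(integral12_prod_meas1 (L1P_ext0 LF)).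
rewrite (@integral_restr_eq R (Icc 0 T) _ (fun s => \int[P]_w (F s w)%:E)%E).
- congr fine; apply: ae_eq_integral; [exact: measurable_itv| | |].
  + apply: (@eq_measurable_fun _ _ _ _ _ (fun s => \int[P]_w (ext0 T F s w)%:E)%E).
      by move=> s; rewrite inE => sT; apply: eq_integral => w _; rewrite ext0_in.
    apply: measurable_funTS; exact: measurable_int (integrable_fubini_F (L1P_ext0 LF)).
  + exact: measurable_int LG.
  + have H := @filterS _ _ (ae_filter_ringOfSetsType leb) _ _ _ aes.
    apply: H => s is_ sT; rewrite fineK//.
    by apply: integrable_fin_num => //; exact: is_.
- by move=> s sT; apply: eq_integral => w _; rewrite /= ext0_in.
- by move=> s sT; apply: integral0_eq => w _; rewrite /= ext0_out.
Qed.

Lemma L1P_det T (f : R -> R) : L1 T f -> L1P P T (fun s _ => f s).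
Proof.
move=> Lf; split.
  by apply: pmeas_det; apply/measurable_EFinP; exact: measurable_int Lf.
rewrite integral_P_cst.
by case/integrableP: Lf.
Qed.

Lemma E2_det T (f : R -> R) : E2 T (fun s _ => f s) = \int[leb]_(s in Icc 0 T) f s.
Proof. by rewrite /E2 integral_P_cst. Qed.

Lemma ae_eq_E2 T F F' : L1P P T F -> L1P P T F' ->
  {ae P, forall w, forall s, Icc 0 T s -> F s w = F' s w} -> E2 T F = E2 T F'.
Proof.
move=> LF LF' FF'; rewrite /E2; congr fine.
have mG K : L1P P T K ->
    measurable_fun setT (fun w => \int[leb]_(s in Icc 0 T) (K s w)%:E)%E.
  move=> LK; apply: eq_measurable_fun (measurable_fubini_G (L1P_ext0 LK)) => w _.
  by rewrite /fubini_G /= integral_ext0.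
apply: ae_eq_integral => //; [exact: mG|exact: mG|].
apply: filterS FF' => w H _; apply: eq_integral => s; rewrite inE => sT.
by rewrite H.
Qed.

Lemma L2P_mul_det T (f : R -> R) F : bounded_meas T f -> L2P P T F ->
  L2P P T (fun s w => f s * F s w).
Proof.
move=> bf HF; apply: sq_L2P.
  by apply: measurable_funM; [apply: pmeas_det; case: bf|case: HF].
have bf2 : bounded_meas T (fun s => f s ^+ 2) by exact: bounded_measM.
apply: eq_L1P (L1P_mul_det bf2 (L2P_sq HF)) => s w _; ring.
Qed.

Lemma L2P_det T (f : R -> R) : measurable_fun (Icc 0 T) f ->
  L1 T (fun s => f s ^+ 2) -> L2P P T (fun s _ => f s).
Proof.
move=> mf Lf; apply: sq_L2P; first exact: pmeas_det.
exact: (L1P_det Lf).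
Qed.

Lemma bounded_meas_L2P T (f : R -> R) : bounded_meas T f -> L2P P T (fun s _ => f s).
Proof.
move=> bf; apply: L2P_det; first by case: bf.
by apply: bounded_meas_L1; exact: bounded_measM.
Qed.

Lemma L2P_sum T (I : Type) (r : seq I) (F : I -> R -> Om -> R) :
  (forall i, L2P P T (F i)) -> L2P P T (fun s w => \sum_(i <- r) F i s w).
Proof.
move=> LF; elim: r => [|i r IH].
  under eq_fun do under eq_fun do rewrite big_nil.
  exact/bounded_meas_L2P/bounded_meas_cst.
by under eq_fun do under eq_fun do rewrite big_cons; exact: L2PD.
Qed.

Lemma L2P_mul T F F' : L2P P T F -> L2P P T F' -> L1P P T (fun s w => F s w * F' s w).
Proof.
move=> HF HF'; apply: (L1P_le _ _ (L1PD (L2P_sq HF) (L2P_sq HF'))).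
  by apply: pmeasM; [case: HF|case: HF'].
move=> s w; apply: le_trans (ler_norm _); rewrite ler_norml.
have := sqr_ge0 (F s w - F' s w); have := sqr_ge0 (F s w + F' s w).
have := sqr_ge0 (F s w); have := sqr_ge0 (F' s w).
by move=> *; apply/andP; split; nra.
Qed.

(** * Square-integrable random variables and primitives *)

Definition L2rv (X : Om -> R) := measurable_fun setT X /\
  P.-integrable setT (fun w => (X w ^+ 2)%:E).

Lemma L2rv_mul X Y : L2rv X -> L2rv Y -> P.-integrable setT (fun w => (X w * Y w)%:E).
Proof.
move=> [mX iX] [mY iY].
apply: (le_integrable measurableT _ _ (integrableD measurableT iX iY)).
  by apply/measurable_EFinP; exact: measurable_funM.
move=> w _; rewrite -EFinD !abse_EFin lee_fin; apply: (@le_trans _ _ (X w ^+ 2 + Y w ^+ 2)); last exact: ler_norm.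
rewrite ler_norml.
have := sqr_ge0 (X w - Y w); have := sqr_ge0 (X w + Y w).
have := sqr_ge0 (X w); have := sqr_ge0 (Y w).
by move=> *; apply/andP; split; nra.
Qed.

Lemma L2rv_cst k : L2rv (cst k).
Proof. by split; [exact: measurable_cst|exact: (finite_measure_integrable_cst P (k ^+ 2))]. Qed.

Lemma L2rv_integrable X : L2rv X -> P.-integrable setT (EFin \o X).
Proof.
move=> LX; have := L2rv_mul LX (L2rv_cst 1).
by apply: eq_integrable => // w _; rewrite /= mulr1.
Qed.

Lemma L2rvD X Y : L2rv X -> L2rv Y -> L2rv (fun w => X w + Y w).
Proof.
move=> LX LY; have [mX iX] := LX; have [mY iY] := LY; split; first exact: measurable_funD.
have iXY := integrableZl measurableT 2 (L2rv_mul LX LY).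
apply: eq_integrable (integrableD measurableT (integrableD measurableT iX iY) iXY) => // w _.
by rewrite /= -EFinM -!EFinD; congr EFin; ring.
Qed.

Lemma L2rvZ k X : L2rv X -> L2rv (fun w => k * X w).
Proof.
move=> [mX iX]; split; first by apply: measurable_funM => //; exact: measurable_cst.
apply: eq_integrable (integrableZl measurableT (k ^+ 2) iX) => // w _.
by rewrite /= -EFinM; congr EFin; ring.
Qed.

Lemma L2rv_sum (I : Type) (r : seq I) (X : I -> Om -> R) :
  (forall i, L2rv (X i)) -> L2rv (fun w => \sum_(i <- r) X i w).
Proof.
move=> LX; elim: r => [|i r IH].
  by under eq_fun do rewrite big_nil; exact: L2rv_cst.
by under eq_fun do rewrite big_cons; exact: L2rvD.
Qed.

Lemma ae_L2rv X Y : measurable_fun setT Y -> {ae P, forall w, X w = Y w} -> L2rv X -> L2rv Y.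
Proof.
move=> mY XY [mX iX]; split; first exact: mY.
apply/integrableP; split; first by apply/measurable_EFinP/measurable_funX.
have /integrableP[_] := iX; congr (_ < _)%E; apply: ae_eq_integral => //.
- by apply/measurable_EFinP/measurableT_comp => //; exact: measurable_funX.
- by apply/measurable_EFinP/measurableT_comp => //; exact: measurable_funX.
- by apply: filterS XY => w -> _.
Qed.

Lemma L2rv_int T b : 0 < T -> L2P P T b -> L2rv (fun w => \int[leb]_(s in Icc 0 T) b s w).
Proof.
move=> T0 Hb; have [mb ib] := Hb.
have [_ iX _ _ _] := L1P_fubini (L2P_L1P Hb).
have [_ iB _ _ _] := L1P_fubini (L2P_sq Hb).
have mX : measurable_fun setT (fun w => \int[leb]_(s in Icc 0 T) b s w).
  by apply/measurable_EFinP; exact: measurable_int iX.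
split; first exact: mX.
apply/integrableP; split; first by apply/measurable_EFinP/measurable_funX.
have /integrableP[mTB] := integrableZl measurableT T iB.
apply: le_lt_trans; apply: ae_ge0_le_integral => //.
- by apply/measurable_EFinP/measurableT_comp => //; exact: measurable_funX.
- exact: measurableT_comp.
apply: filterS (L2P_ae Hb) => w Lw _.
rewrite -EFinM !abse_EFin lee_fin ger0_norm ?sqr_ge0//.
apply: le_trans (int_sq_le T0 (pmeas_secr w mb) Lw) _.
exact: ler_norm.
Qed.

Lemma L2P_primitive T b V : 0 < T -> L2P P T b -> pmeas T V ->
  {ae P, forall w, forall t, Icc 0 T t -> V t w = \int[leb]_(s in Icc 0 t) b s w} ->
  L2P P T V.
Proof.
move=> T0 Hb mV VE; have [mb ib] := Hb; split; first exact: mV.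
have [m1 _ _] := tonelli P (pmeas_sq mV) (fun s w => sqr_ge0 (V s w)).
have [m2 _ _] := tonelli P (pmeas_sq mb) (fun s w => sqr_ge0 (b s w)).
have b0 w : (0 <= \int[leb]_(s in Icc 0 T) (b s w ^+ 2)%:E)%E.
  by apply: integral_ge0 => s _; rewrite lee_fin sqr_ge0.
apply: (@le_lt_trans _ _ (\int[P]_w ((T ^+ 2)%:E * \int[leb]_(s in Icc 0 T) (b s w ^+ 2)%:E))%E); last first.
  rewrite ge0_integralZl_EFin//; last by rewrite sqr_ge0.
  by apply: lte_mul_pinfty => //; rewrite lee_fin sqr_ge0.
apply: ae_ge0_le_integral => //.
- by move=> w _; apply: integral_ge0 => s _; rewrite lee_fin sqr_ge0.
- by move=> w _; apply: mule_ge0 => //; rewrite lee_fin sqr_ge0.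
- exact: measurable_funeM.
apply: filterS2 VE (L2P_ae Hb) => w VE Lw _.
have Bfin : (\int[leb]_(s in Icc 0 T) (b s w ^+ 2)%:E)%E \is a fin_num.
  exact: integrable_fin_num Lw.
rewrite -(fineK Bfin); set beta := fine _.
(* Pointwise in time, Cauchy-Schwarz bounds [V s w ^+ 2] by s times the integral of the square up to
   s, hence by [T * beta]; integrating this constant over [0, T] gives the second factor T. *)
have -> : ((T ^+ 2)%:E * beta%:E = \int[leb]_(s in Icc 0 T) (T * beta)%:E)%E.
  rewrite integral_cst//; transitivity ((T * beta)%:E * leb (Icc 0 T))%E => //.
  by rewrite leb_Icc0 ?ltW// -!EFinM; congr EFin; ring.
apply: ge0_le_integral => //.
- by move=> s _; rewrite lee_fin sqr_ge0.
- by apply/measurable_EFinP; exact: (pmeas_secr _ (pmeas_sq mV)).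
move=> s sT; have /IccP/andP[s0 s1] := sT; rewrite lee_fin VE//.
move: s0; rewrite le_eqVlt => /predU1P[<-|s0].
  rewrite int_00 expr0n mulr_ge0 ?(ltW T0)//; exact: fine_ge0.
have mbs : measurable_fun (Icc 0 s) (b ^~ w).
  apply: measurable_funS (pmeas_secr w mb); first exact: measurable_itv.
  by move=> r; exact: Icc_le.
apply: le_trans (int_sq_le s0 mbs (L1_le s1 Lw)) _.
apply: ler_pM => //; first exact: ltW.
  by apply: Rintegral_ge0 => r _; exact: sqr_ge0.
rewrite /beta /Rintegral fine_le//; first exact: (integrable_fin_num _ (L1_le s1 Lw)).
apply: ge0_subset_integral => //.
- exact: measurable_int Lw.
- by move=> r _; rewrite lee_fin sqr_ge0.
- by move=> r; exact: Icc_le.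
Qed.

End ExpectedIntegral.

(** * Vector-valued functions and processes, reduced to components *)

Section Vectors.
Context {R : realType}.
Notation leb := (@lebesgue_measure R).

Lemma sqnE n (v : 'cV[R]_n) : sqn v = \sum_j v j 0 ^+ 2.
Proof. by rewrite /sqn mxE; apply: eq_bigr => j _; rewrite mxE. Qed.

Lemma sqn_ge0 n (v : 'cV[R]_n) : 0 <= sqn v.
Proof. by rewrite sqnE; apply: sumr_ge0 => j _; exact: sqr_ge0. Qed.

Lemma le_sqn n (v : 'cV[R]_n) j : v j 0 ^+ 2 <= sqn v.
Proof.
by rewrite sqnE (bigD1 j)//= lerDl; apply: sumr_ge0 => i _; exact: sqr_ge0.
Qed.

Lemma L2detP n T (f : R -> 'cV[R]_n) : L2det T f <->
  forall j, measurable_fun (Icc 0 T) (fun t => f t j 0) /\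
            L1 T (fun t => f t j 0 ^+ 2).
Proof.
split=> [[mf If] j|H].
  split; first exact: mf.
  apply/integrableP; split.
    by apply/measurable_EFinP; apply: measurable_funX; exact: mf.
  apply: le_lt_trans If; apply: ge0_le_integral => //.
  - by apply/measurable_EFinP/measurableT_comp => //; apply: measurable_funX; exact: mf.
  - apply/measurable_EFinP; under eq_fun do rewrite sqnE.
    by apply: measurable_sum => i; apply: measurable_funX; exact: mf.
  - by move=> t _; rewrite abse_EFin lee_fin ger0_norm ?sqr_ge0// le_sqn.
have LS : L1 T (fun t => sqn (f t)).
  under eq_fun do rewrite sqnE; apply: L1_sum => j; by case: (H j).
split=> [j|]; first by case: (H j).
case/integrableP: LS => _; congr (_ < _)%E; apply: eq_integral => t _.
by rewrite /= ger0_norm// sqn_ge0.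
Qed.

Lemma L2det_L1m n T (f : R -> 'cV[R]_n) : L2det T f -> L1m T f.
Proof. by move=> /L2detP H i j; rewrite (ord1 j); have [mf Lf] := H i; exact: L1_sq. Qed.

Lemma bounded_L2det n T (f : R -> 'cV[R]_n) : bounded_measm T f -> L2det T f.
Proof.
move=> bf; apply/L2detP => j; split; first by case: (bf j 0).
by apply: bounded_meas_L1; exact: bounded_measM.
Qed.

Lemma L2det_L1sqn n T (f : R -> 'cV[R]_n) : L2det T f -> L1 T (fun t => sqn (f t)).
Proof.
move=> /L2detP H; under eq_fun do rewrite sqnE.
by apply: L1_sum => j; case: (H j).
Qed.

Lemma L2detD n T (f g : R -> 'cV[R]_n) : L2det T f -> L2det T g ->
  L2det T (fun t => f t + g t).
Proof.
move=> /L2detP Hf /L2detP Hg; apply/L2detP => j.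
have [mf Lf] := Hf j; have [mg Lg] := Hg j.
have mfg : measurable_fun (Icc 0 T) (fun t => (f t + g t) j 0).
  by under eq_fun do rewrite mxE; exact: measurable_funD.
split; first exact: mfg.
apply: (@le_integrable _ _ _ leb _ (measurable_itv _) _ _ _ _ (L1Z 2 (L1D Lf Lg))).
  by apply/measurable_EFinP/measurable_funX.
move=> t _; rewrite !abse_EFin lee_fin ger0_norm ?sqr_ge0//.
apply: (@le_trans _ _ (2 * (f t j 0 ^+ 2 + g t j 0 ^+ 2))); last exact: ler_norm.
by rewrite mxE; have := sqr_ge0 (f t j 0 - g t j 0); nra.
Qed.

Lemma L2detZ n T k (f : R -> 'cV[R]_n) : L2det T f -> L2det T (fun t => k *: f t).
Proof.
move=> /L2detP Hf; apply/L2detP => j; have [mf Lf] := Hf j; split.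
  under eq_fun do rewrite mxE; apply: measurable_funM => //; exact: measurable_cst.
by apply: eq_L1 (L1Z (k ^+ 2) Lf) => t _; rewrite mxE; ring.
Qed.

Lemma eq_intv n t (f g : R -> 'cV[R]_n) : (forall s, Icc 0 t s -> f s = g s) ->
  intv 0 t f = intv 0 t g.
Proof.
by move=> fg; apply/matrixP => i j; rewrite !mxE; apply: eq_int => s /fg ->.
Qed.

Lemma abscont_mxN m n T (F F' : R -> 'M[R]_(m, n)) : 0 <= T ->
  abscont_mx T F F' -> abscont_mx T (fun t => - F t) (fun t => - F' t).
Proof.
move=> T0 HF; apply: eq_abscont_mx (abscont_mxZl (-1%:M) T0 HF) => // t _.
  by rewrite mulNmx mul1mx.
by rewrite mulNmx mul1mx.
Qed.

Context {d : measure_display} {Om : measurableType d}.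
Variable P : probability Om R.

Definition L2Pv n T (X : R -> Om -> 'cV[R]_n) :=
  forall j, L2P P T (fun t w => X t w j 0).

Lemma L2PvD n T (X Y : R -> Om -> 'cV[R]_n) : L2Pv T X -> L2Pv T Y ->
  L2Pv T (fun t w => X t w + Y t w).
Proof.
by move=> HX HY j; under eq_fun do under eq_fun do rewrite mxE; exact: L2PD.
Qed.

Lemma L2Pv_mulb m n T (M : R -> 'M[R]_(m, n)) (X : R -> Om -> 'cV[R]_n) :
  bounded_measm T M -> L2Pv T X -> L2Pv T (fun t w => M t *m X t w).
Proof.
move=> bM HX i; under eq_fun do under eq_fun do rewrite mxE.
by apply: L2P_sum => k; exact: L2P_mul_det.
Qed.

Lemma bounded_measm_cst m n T (M : 'M[R]_(m, n)) : bounded_measm T (cst M).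
Proof. by move=> i j; exact: bounded_meas_cst. Qed.

Lemma L2Pv_mul m n T (M : 'M[R]_(m, n)) (X : R -> Om -> 'cV[R]_n) :
  L2Pv T X -> L2Pv T (fun t w => M *m X t w).
Proof. by apply: (L2Pv_mulb (M := cst M)); exact: bounded_measm_cst. Qed.

Lemma L2Pv_det n T (f : R -> 'cV[R]_n) : L2det T f -> L2Pv T (fun t _ => f t).
Proof. by move=> /L2detP H j; have [mf Lf] := H j; exact: L2P_det. Qed.

Lemma L2Pv_sqn n T (X : R -> Om -> 'cV[R]_n) : L2Pv T X ->
  L1P P T (fun t w => sqn (X t w)).
Proof.
move=> HX; under eq_fun do under eq_fun do rewrite sqnE.
by apply: L1P_sum => j; exact: L2P_sq.
Qed.

Lemma L2Pv_ae n T (X : R -> Om -> 'cV[R]_n) : L2Pv T X ->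
  {ae P, forall w, L1m T (X ^~ w)}.
Proof.
move=> HX.
have : {ae P, forall w, forall j : 'I_n, L1 T (fun t => X t w j 0)}.
  have H (j : 'I_n) : {ae P, forall w, L1 T (fun t => X t w j 0)}.
    by have [] := L1P_fubini (L2P_L1P (HX j)).
  (* Almost sure statements combine over natural numbers, so the finite index type is embedded in
     them; values of k outside the range are vacuous. *)
  have : {ae P, forall w, forall k : nat, forall j : 'I_n, j = k :> nat -> L1 T (fun t => X t w j 0)}.
    apply: ae_foralln => k.
    have [kn|kn] := ltnP k n.
      have := H (Ordinal kn); apply: filterS => w Hw j jk.
      by rewrite (_ : j = Ordinal kn)//; exact: val_inj.
    by apply: aeW => w j jk; move: (ltn_ord j); rewrite jk ltnNge kn.
  by apply: filterS => w Hw j; exact: (Hw j).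
by apply: filterS => w Hw i j; rewrite (ord1 j).
Qed.

Lemma L2FP k n (W : R -> Om -> 'cV[R]_k) T (x : R -> Om -> 'cV[R]_n) :
  L2F P W T x <-> L2Pv T x /\
    (forall t, Icc 0 T t -> forall j, sub_meas (natgen W t) (fun w => x t w j 0)).
Proof.
split=> [[mx ax ix]|[Hx ax]].
  split; last by move=> t /IccP tT j B mB; exact: ax.
  move=> j; split; first exact: mx.
  apply: le_lt_trans ix.
  have mxj : pmeas T (fun t w => x t w j 0) := mx j.
  have mS : pmeas T (fun t w => sqn (x t w)).
    rewrite /pmeas; under eq_fun do rewrite sqnE.
    apply: (@measurable_sum _ _ _ _ _ _ (fun i (z : R * Om) => x z.1 z.2 i 0 ^+ 2)) => i.
    by apply: measurable_funX; exact: mx.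
  have [m1 _ _] := tonelli P mS (fun t w => sqn_ge0 (x t w)).
  have [m2 _ _] := tonelli P (pmeas_sq mxj) (fun s w => sqr_ge0 (x s w j 0)).
  apply: ge0_le_integral => //.
  - by move=> w _; apply: integral_ge0 => s _; rewrite lee_fin sqr_ge0.
  - move=> w _; apply: ge0_le_integral => //.
    + by move=> s _; rewrite lee_fin sqr_ge0.
    + by apply/measurable_EFinP; exact: (pmeas_secr w (pmeas_sq mxj)).
    + by apply/measurable_EFinP; exact: (pmeas_secr _ mS).
    + by move=> s _; rewrite lee_fin le_sqn.
split.
- by move=> j; have [] := Hx j.
- by move=> t tT j B mB; apply: ax => //; apply/IccP.
- have [_] := L2Pv_sqn Hx; congr (_ < _)%E; apply: eq_integral => w _.
  by apply: eq_integral => s _; rewrite ger0_norm// sqn_ge0.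
Qed.

End Vectors.

(** * The state equation *)

Section StateEquation.
Context {R : realType} {d : measure_display} {Om : measurableType d}.
Variable P : probability Om R.
Notation leb := (@lebesgue_measure R).
Variables (n n1 n2 : nat) (T : R) (A G : 'M[R]_n) (B : 'M[R]_(n, n1))
  (D : 'M[R]_(n, n2)) (m0 x0 : 'cV[R]_n) (W : R -> Om -> 'cV[R]_n2)
  (u : R -> Om -> 'cV[R]_n1) (ubar : R -> 'cV[R]_n1).
Hypotheses (T0 : 0 < T) (HW : std_BM P W) (Hu : L2F P W T u) (Hubar : cont_on T ubar).

Let T0' : 0 <= T := ltW T0.

Lemma cont_on_L1m : L1m T ubar.
Proof.
move=> i j; rewrite (ord1 j).
apply: continuous_compact_integrable; first exact: segment_compact.
exact: Hubar.
Qed.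

Lemma L2Pv_BM : L2Pv P T W.
Proof. by move=> j; exact: BM_L2P. Qed.

Lemma L2Pv_u : L2Pv P T u.
Proof. by case/L2FP : Hu. Qed.

Definition sub_measv k (F : set (set Om)) (X : Om -> 'cV[R]_k) :=
  forall j, sub_meas F (fun w => X w j 0).

Lemma sub_measvD k F (X Y : Om -> 'cV[R]_k) : sub_measv F X -> sub_measv F Y ->
  sub_measv F (fun w => X w + Y w).
Proof. by move=> HX HY j; under eq_fun do rewrite mxE; exact: sub_measD. Qed.

Lemma sub_measv_mul k l F (M : 'M[R]_(l, k)) (X : Om -> 'cV[R]_k) :
  sub_measv F X -> sub_measv F (fun w => M *m X w).
Proof.
move=> HX j; under eq_fun do rewrite mxE.
by apply: sub_meas_sum => i; apply: sub_measM => //; exact: sub_meas_cst.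
Qed.

Lemma sub_measv_cst k F (v : 'cV[R]_k) : sub_measv F (cst v).
Proof. by move=> j; exact: sub_meas_cst. Qed.

(** Subtracting the noise, [y = x - D W] solves [y' = A y + b] with an adapted forcing [b].
    Variation of constants solves it, with an adapted version of the integral in place of the
    integral itself. *)
Lemma state_exists f : L2det T f ->
  exists x m, state_sol P T A G B D m0 x0 W u ubar f x m.
Proof.
move=> Lf; have Lf1 := L2det_L1m Lf.
pose m := ode_sol (A + G) m0 (fun s => B *m ubar s + f s).
have Hm : abscont_mx T m (fun t => (A + G) *m m t + (B *m ubar t + f t)).
  apply: ode_sol_abscont => //; apply: L1mD => //.
  by apply: L1mZ; exact: cont_on_L1m.
have mE t : Icc 0 T t -> m t = m0 + intv 0 t (fun s => (A + G) *m m s + B *m ubar s + f s).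
  move=> tT; rewrite (abscont_mx_intv Hm tT) /m ode_sol0; congr (_ + _).
  by apply: eq_intv => s _; rewrite addrA.
have bm := abscont_mx_bounded T0' Hm; have Lm := bounded_L2det bm.
(* The term [A D W] appears because the drift acts on x, that is on [y + D W]. *)
pose b s w := A *m (D *m W s w) + B *m u s w + G *m m s + f s.
have Hb : L2Pv P T b.
  apply: L2PvD; last exact: L2Pv_det.
  apply: L2PvD; last by apply: L2Pv_mul; exact: L2Pv_det.
  apply: L2PvD; first by do 2 apply: L2Pv_mul; exact: L2Pv_BM.
  by apply: L2Pv_mul; exact: L2Pv_u.
pose h s w := mexp (- A) s *m b s w.
have Hh : L2Pv P T h by apply: L2Pv_mulb => //; exact: bounded_mexp.
have ha s : Icc 0 T s -> sub_measv (natgen W s) (h s).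
  move=> sT; have /IccP/andP[s0 _] := sT.
  have [_ au] := proj1 (L2FP _ _ _ _) Hu.
  apply: sub_measv_mul; apply: sub_measvD; last exact: sub_measv_cst.
  apply: sub_measvD; last by apply: sub_measv_mul; exact: sub_measv_cst.
  apply: sub_measvD; first by do 2 apply: sub_measv_mul => //; move=> j; exact: natgen_adapted.
  by apply: sub_measv_mul => j; exact: au.
have exV (j : 'I_n) : exists V : R -> Om -> R, [/\ pmeas T V,
    (forall t, Icc 0 T t -> sub_meas (natgen W t) (V t)) &
    {ae P, forall w, forall t, Icc 0 T t -> V t w = \int[leb]_(s in Icc 0 t) h s w j 0}].
  apply: (adapted_primitive (h := fun s w => h s w j 0)) => //.
  - exact: natgen_le.
  - by move=> t; exact: (natgen_measurable HW).
  - by move=> s sT; exact: ha.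
have [V HV] := choice exV.
have LV : L2Pv P T (fun t w => \col_j V j t w).
  move=> j; have [mV _ VE] := HV j.
  under eq_fun do under eq_fun do rewrite mxE.
  exact: (L2P_primitive T0 (Hh j)).
(* Adapted at every time through [V]; the equation holds on the almost sure event where [V] is the
   actual integral. *)
pose x t w := mexp A t *m (x0 + \col_j V j t w) + D *m W t w.
exists x, m; split; first exact: Lm.
- by move=> t tT; apply: mE; apply/IccP.
- apply/L2FP; split.
    apply: L2PvD; last by apply: L2Pv_mul; exact: L2Pv_BM.
    apply: L2Pv_mulb; first exact: bounded_mexp.
    apply: (L2PvD _ LV); apply: L2Pv_det; apply: bounded_L2det.
    exact: bounded_measm_cst.
  move=> t tT; have /IccP/andP[t0 _] := tT.
  apply: sub_measvD; last by apply: sub_measv_mul => j; exact: natgen_adapted.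
  apply: sub_measv_mul; apply: sub_measvD; first exact: sub_measv_cst.
  by move=> j; under eq_fun do rewrite mxE; have [_ + _] := HV j; exact.
- have aeV : {ae P, forall w, forall t, Icc 0 T t ->
      \col_j V j t w = intv 0 t (h ^~ w)}.
    have : {ae P, forall w, forall k : nat, forall j : 'I_n, j = k :> nat ->
        forall t, Icc 0 T t -> V j t w = \int[leb]_(s in Icc 0 t) h s w j 0}.
      apply: ae_foralln => k.
      have [kn|kn] := ltnP k n.
        have [_ _ H] := HV (Ordinal kn); move: H; apply: filterS => w Hw j jk.
        by rewrite (_ : j = Ordinal kn)//; exact: val_inj.
      by apply: aeW => w j jk; move: (ltn_ord j); rewrite jk ltnNge kn.
    apply: filterS => w Hw t tT; apply/matrixP => i j; rewrite !mxE.
    exact: Hw.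
  apply: filterS2 aeV (L2Pv_ae Hb) => w Vw Lb t /IccP tT.
  pose y := ode_sol A x0 (b ^~ w).
  have Hy : abscont_mx T y (fun t => A *m y t + b t w) by exact: ode_sol_abscont.
  have xE s : Icc 0 T s -> x s w = y s + D *m W s w by move=> sT; rewrite /x Vw.
  rewrite xE// (abscont_mx_intv Hy tT) {1}/y ode_sol0; congr (_ + _ + _).
  apply: eq_intv => s st.
  rewrite xE; last by apply: Icc_le st; case/IccP/andP: tT.
  by rewrite /b mulmxDr !addrA.
Qed.

Lemma state_abscont f x m : L2det T f -> state_sol P T A G B D m0 x0 W u ubar f x m ->
  abscont_mx T m (fun t => (A + G) *m m t + B *m ubar t + f t) /\ m 0 = m0 /\
  {ae P, forall w, abscont_mx T (fun t => x t w - D *m W t w)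
      (fun t => A *m x t w + B *m u t w + G *m m t + f t) /\ x 0 w - D *m W 0 w = x0}.
Proof.
move=> Lf [Lm mE Lx xE].
have I0 : (0 : R) <= 0 <= T by rewrite lexx.
split.
  apply: (@intv_abscont _ _ _ _ _ m0) => //.
  apply: L1mD; last exact: L2det_L1m.
  by apply: L1mD; apply: L1mZ; [exact: L2det_L1m|exact: cont_on_L1m].
split; first by rewrite mE// intv_00 addr0.
have [Hx _] := proj1 (L2FP _ _ _ _) Lx.
apply: filterS3 xE (L2Pv_ae Hx) (L2Pv_ae L2Pv_u) => w xw Lxw Luw; split.
  apply: (@intv_abscont _ _ _ _ _ x0) => //; last first.
    by move=> t /IccP tT; rewrite xw// addrK.
  apply: L1mD; last exact: L2det_L1m.
  apply: L1mD; last by apply: L1mZ; exact: L2det_L1m.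
  by apply: L1mD; exact: L1mZ.
by rewrite xw// addrK intv_00 addr0.
Qed.

(** The noise cancels in the difference of two solutions, leaving a homogeneous linear equation,
    first for m and then, along almost every path, for x. *)
Lemma state_unique f x m x' m' : L2det T f ->
  state_sol P T A G B D m0 x0 W u ubar f x m ->
  state_sol P T A G B D m0 x0 W u ubar f x' m' ->
  (forall t, Icc 0 T t -> m t = m' t) /\
  {ae P, forall w, forall t, Icc 0 T t -> x t w = x' t w}.
Proof.
move=> Lf H H'.
have [Hm [m00 Hx]] := state_abscont Lf H; have [Hm' [m00' Hx']] := state_abscont Lf H'.
have mm t : Icc 0 T t -> m t = m' t.
  move=> tT; apply/subr0_eq.
  apply: (linear_ode_unique (M := A + G) (v := fun t => m t - m' t) T0') tT.
    apply: eq_abscont_mx (abscont_mxD T0' Hm (abscont_mxN T0' Hm')) => // s _.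
    by rewrite mulmxBr !opprD !addrA; apply/matrixP => i j; rewrite !mxE; ring.
  by rewrite m00 m00' subrr.
split=> //.
apply: filterS2 Hx Hx' => w [Hw w0] [Hw' w0'] t tT; apply/subr0_eq.
apply: (linear_ode_unique (M := A) (v := fun t => x t w - x' t w) T0') tT.
  apply: eq_abscont_mx (abscont_mxD T0' Hw (abscont_mxN T0' Hw')) => // s sT.
    by apply/matrixP => i j; rewrite !mxE; ring.
  by rewrite mm// mulmxBr; apply/matrixP => i j; rewrite !mxE; ring.
by rewrite -[x 0 w](subrK (D *m W 0 w)) w0 -w0' subrK subrr.
Qed.

Lemma z_exists g : L2det T g -> exists z, z_sol T A G g z.
Proof.
move=> Lg; pose z := ode_sol (A + G) 0 g.
have Hz : abscont_mx T z (fun t => (A + G) *m z t + g t) by apply: ode_sol_abscont => //; exact: L2det_L1m.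
exists z; split; first exact/bounded_L2det/(abscont_mx_bounded T0' Hz).
by move=> t /IccP tT; rewrite (abscont_mx_intv Hz tT) /z ode_sol0 add0r.
Qed.

Lemma z_sol_abscont g z : L2det T g -> z_sol T A G g z ->
  abscont_mx T z (fun t => (A + G) *m z t + g t) /\ z 0 = 0.
Proof.
move=> Lg [Lz zE]; split.
  apply: (@intv_abscont _ _ _ _ _ 0) => //; last by move=> t /IccP tT; rewrite add0r; exact: zE.
  by apply: L1mD; [apply: L1mZ; exact: L2det_L1m|exact: L2det_L1m].
by rewrite zE ?lexx// intv_00.
Qed.

(** One [z] serves both equations: shifting x and m together changes the drift of x by [A z + G z],
    which is exactly the [(A + G) z] in the equation of m. *)
Lemma state_shift f g x m z : L2det T f -> L2det T g ->
  state_sol P T A G B D m0 x0 W u ubar f x m -> z_sol T A G g z ->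
  state_sol P T A G B D m0 x0 W u ubar (fun t => f t + g t)
    (fun t w => x t w + z t) (fun t => m t + z t).
Proof.
move=> Lf Lg H Hz; have [Hm [m00 Hx]] := state_abscont Lf H.
have [Az z00] := z_sol_abscont Lg Hz; have [Lz _] := Hz; have [Lm _ Lx _] := H.
split.
- exact: L2detD.
- move=> t /IccP tT; rewrite (abscont_mx_intv (abscont_mxD T0' Hm Az) tT) m00 z00 addr0; congr (_ + _).
  by apply: eq_intv => s _; rewrite mulmxDr (AC (3*2) (1*4*2*(3*5))).
- apply/L2FP; have [LxP xa] := proj1 (L2FP _ _ _ _) Lx; split.
    by apply: (L2PvD LxP); exact: L2Pv_det.
  by move=> t tT; apply: sub_measvD; [exact: xa|exact: sub_measv_cst].
- apply: filterS Hx => w [Hw w0] t /IccP tT.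
  have := abscont_mx_intv (abscont_mxD T0' Hw Az) tT; rewrite w0 z00 addr0.
  move=> E; rewrite -[x t w](subrK (D *m W t w)) addrAC E; congr (_ + _ + _).
  by apply: eq_intv => s _; rewrite !mulmxDr mulmxDl (AC (4*3) (1*5*2*(3*6)*(4*7))).
Qed.

(** Membership in [L2F] controls x only on average over time, whereas the terminal cost and [Ev]
    evaluate it at a fixed time. The integral equation supplies the second moment there. *)
Lemma state_L2rv f x m : L2det T f -> state_sol P T A G B D m0 x0 W u ubar f x m ->
  forall t, Icc 0 T t -> forall j, L2rv P (fun w => x t w j 0).
Proof.
move=> Lf [Lm _ Lx xE] t tT j; have /IccP/andP[t0 t1] := tT.
have [LxP xa] := proj1 (L2FP _ _ _ _) Lx.
have mx : measurable_fun setT (fun w => x t w j 0).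
  by apply: sub_meas_measurable (xa t tT j); exact: (natgen_measurable HW).
pose b s w := A *m x s w + B *m u s w + G *m m s + f s.
have Hb : L2Pv P T b.
  apply: L2PvD; last exact: L2Pv_det.
  apply: L2PvD; last by apply: L2Pv_mul; exact: L2Pv_det.
  by apply: L2PvD; apply: L2Pv_mul => //; exact: L2Pv_u.
have LI : L2rv P (fun w => \int[leb]_(s in Icc 0 t) b s w j 0).
  move: t0; rewrite le_eqVlt => /predU1P[<-|t0].
    by under eq_fun do rewrite int_00; exact: L2rv_cst.
  by apply: L2rv_int => //; exact: L2P_le (Hb j).
have LW (i : 'I_n2) : L2rv P (fun w => W t w i 0).
  have [mW _ _ _] := HW; split; first exact: mW.
  apply/integrableP; split; first by apply/measurable_EFinP/measurable_funX/mW.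
  apply: le_lt_trans (ltry (16 * t)); apply: le_trans (BM_moment2 i HW t0).
  rewrite le_eqVlt; apply/orP; left; apply/eqP; apply: eq_integral => w _.
  by rewrite abse_EFin ger0_norm ?sqr_ge0.
have LDW : L2rv P (fun w => \sum_i D j i * W t w i 0).
  by apply: L2rv_sum => i; exact: L2rvZ.
apply: (ae_L2rv mx _ (L2rvD (L2rvD (L2rv_cst P (x0 j 0)) LI) LDW)).
apply: filterS xE => w xw; rewrite xw; last exact/IccP.
by rewrite !mxE.
Qed.

End StateEquation.

(** * Duality and the cost functional *)

Section QuadraticForms.
Context {R : realType}.

Definition dot n (a b : 'cV[R]_n) : R := (a^T *m b) 0 0.

Lemma dotE n (a b : 'cV[R]_n) : dot a b = \sum_j a j 0 * b j 0.
Proof. by rewrite /dot mxE; apply: eq_bigr => j _; rewrite mxE. Qed.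

Lemma dotC n (a b : 'cV[R]_n) : dot a b = dot b a.
Proof. by rewrite !dotE; apply: eq_bigr => j _; rewrite mulrC. Qed.

Lemma dotDl n (a b c : 'cV[R]_n) : dot (a + b) c = dot a c + dot b c.
Proof. by rewrite /dot linearD mulmxDl mxE. Qed.

Lemma dotDr n (a b c : 'cV[R]_n) : dot a (b + c) = dot a b + dot a c.
Proof. by rewrite /dot mulmxDr mxE. Qed.

Lemma dotNl n (a b : 'cV[R]_n) : dot (- a) b = - dot a b.
Proof. by rewrite /dot linearN mulNmx mxE. Qed.

Lemma dotZl n k (a b : 'cV[R]_n) : dot (k *: a) b = k * dot a b.
Proof. by rewrite /dot linearZ /= -scalemxAl mxE. Qed.

Lemma dot_mulr m n (M : 'M[R]_(m, n)) a b : dot a (M *m b) = dot (M^T *m a) b.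
Proof. by rewrite /dot trmx_mul trmxK mulmxA. Qed.

Lemma qfE n (M : 'M[R]_n) v : qf M v = dot v (M *m v).
Proof. by rewrite /qf /dot mulmxA. Qed.

Lemma qfD n (M : 'M[R]_n) v w : M^T = M ->
  qf M (v + w) = qf M v + 2 * dot w (M *m v) + qf M w.
Proof.
move=> MT; rewrite !qfE mulmxDr !dotDl !dotDr.
have -> : dot v (M *m w) = dot w (M *m v) by rewrite dot_mulr MT dotC.
by ring.
Qed.

Lemma sqnD n (v w : 'cV[R]_n) : sqn (v + w) = sqn v + 2 * dot v w + sqn w.
Proof.
rewrite -[sqn _]/(dot _ _) -[sqn v]/(dot _ _) -[sqn w]/(dot _ _) !dotDl !dotDr.
rewrite (dotC w v); ring.
Qed.

Lemma sqnZ n k (v : 'cV[R]_n) : sqn (k *: v) = k ^+ 2 * sqn v.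
Proof. by rewrite -[sqn _]/(dot _ _) -[sqn v]/(dot _ _) dotZl dotC dotZl; ring. Qed.

Lemma sqn_eq0 n (v : 'cV[R]_n) : sqn v = 0 -> v = 0.
Proof.
rewrite sqnE => /eqP; rewrite psumr_eq0 => [/allP H|j _]; last exact: sqr_ge0.
apply/matrixP => i j; rewrite (ord1 j) mxE; apply/eqP.
by have := H i (mem_index_enum _); rewrite /= sqrf_eq0.
Qed.

End QuadraticForms.

(** * Integration by parts for adjoint systems and L^2 norms *)

Section Adjoint.
Context {R : realType}.
Notation leb := (@lebesgue_measure R).

Lemma abscont_mx_tr m n (T : R) (F F' : R -> 'M[R]_(m, n)) : 0 <= T -> abscont_mx T F F' ->
  abscont_mx T (fun t => (F t)^T) (fun t => (F' t)^T).
Proof. by move=> T0 HF i j; apply: eq_abscont (HF j i) => // t _; rewrite mxE. Qed.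

(** In the product rule for the pairing of p and z, the terms with [M] and its transpose cancel;
    what is left is integrated from [z 0 = 0]. *)
Lemma adjoint_ip n (M : 'M[R]_n) (T : R) (p alpha z g : R -> 'cV[R]_n) : 0 <= T ->
  abscont_mx T p (fun t => - (M^T *m p t + alpha t)) ->
  abscont_mx T z (fun t => M *m z t + g t) -> z 0 = 0 ->
  dot (p T) (z T) = \int[leb]_(t in Icc 0 T) (dot (p t) (g t) - dot (alpha t) (z t)).
Proof.
move=> T0 Hp Hz z0.
have [_ H] := abscont_mxM T0 (abscont_mx_tr T0 Hp) Hz 0 0.
have TT : Icc 0 T T by apply/IccP; rewrite T0 lexx.
rewrite {1}/dot H// z0 mulmx0 mxE add0r; apply: eq_int => t _.
rewrite mxE -[_ 0 0]/(dot (- (M^T *m p t + alpha t)) (z t)) -[X in _ + X]/(dot (p t) (M *m z t + g t)).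
by rewrite dotNl dotDl dotDr dot_mulr; ring.
Qed.

Lemma L1_dot n (T : R) (f g : R -> 'cV[R]_n) : bounded_measm T f -> L1m T g ->
  L1 T (fun t => dot (f t) (g t)).
Proof.
move=> bf Lg; under eq_fun do rewrite dotE.
by apply: L1_sum => j; exact: L1_mul.
Qed.

Lemma bounded_measm_mul m n (T : R) (M : 'M[R]_(m, n)) (f : R -> 'cV[R]_n) :
  bounded_measm T f -> bounded_measm T (fun t => M *m f t).
Proof.
move=> bf i j; under eq_fun do rewrite mxE.
by apply: bounded_meas_sum => k; apply: bounded_measM => //; exact: bounded_meas_cst.
Qed.

Lemma bounded_measm_scale n (T : R) k (f : R -> 'cV[R]_n) :
  bounded_measm T f -> bounded_measm T (fun t => k *: f t).
Proof.
move=> bf i j; under eq_fun do rewrite mxE.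
by apply: bounded_measM => //; exact: bounded_meas_cst.
Qed.

Lemma L2sqE n (T : R) (f : R -> 'cV[R]_n) : L2sq T f = \int[leb]_(t in Icc 0 T) sqn (f t).
Proof. by []. Qed.

Lemma L2sq_ge0 n (T : R) (f : R -> 'cV[R]_n) : 0 <= L2sq T f.
Proof. by rewrite L2sqE; apply: Rintegral_ge0 => t _; exact: sqn_ge0. Qed.

Lemma L2sqD n (T : R) (f g : R -> 'cV[R]_n) : 0 <= T -> bounded_measm T f -> L2det T g ->
  L2sq T (fun t => f t + g t) =
  L2sq T f + 2 * (\int[leb]_(t in Icc 0 T) dot (f t) (g t)) + L2sq T g.
Proof.
move=> T0 bf Lg.
have TT : Icc 0 T T by apply/IccP; rewrite T0 lexx.
have L1f := L2det_L1sqn (bounded_L2det bf); have L1g := L2det_L1sqn Lg.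
have L1fg := L1_dot bf (L2det_L1m Lg).
rewrite !L2sqE; under eq_Rintegral do rewrite sqnD.
by rewrite (intD TT (L1D L1f (L1Z 2 L1fg)) L1g) (intD TT L1f (L1Z 2 L1fg)) (intZ _ TT L1fg).
Qed.

Lemma L2sq_eq0 n (T : R) (f : R -> 'cV[R]_n) : L2det T f -> L2sq T f <= 0 ->
  ae_eq_on T f (fun=> 0).
Proof.
move=> Lf L0; have L1f := L2det_L1sqn Lf.
have /eqP : L2sq T f == 0 by rewrite eq_le L0 L2sq_ge0.
rewrite /L2sq => E.
have E0 : (\int[leb]_(t in Icc 0 T) `|(sqn (f t))%:E| = 0)%E.
  under eq_integral do rewrite gee0_abs ?lee_fin ?sqn_ge0//.
  by rewrite -[LHS]fineK ?E//; exact: integrable_fin_num L1f.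
have := proj1 (@ae_eq_integral_abs _ _ _ leb (Icc 0 T) (measurable_itv _)
  (EFin \o (fun t => sqn (f t))) (measurable_int _ L1f)) E0.
apply: filterS => t H tT; apply: sqn_eq0.
by have /(_ tT) [] := H.
Qed.

End Adjoint.

(** * Expansion of the cost around a solution of the forward-backward system *)

Section Cost.
Context {R : realType} {d : measure_display} {Om : measurableType d}.
Variable P : probability Om R.
Notation leb := (@lebesgue_measure R).
Variables (n n1 n2 : nat) (T : R) (A G Gam Q H : 'M[R]_n) (B : 'M[R]_(n, n1))
  (D : 'M[R]_(n, n2)) (Rw : 'M[R]_n1) (eta m0 x0 : 'cV[R]_n) (gam : R)
  (W : R -> Om -> 'cV[R]_n2)
  (u : R -> Om -> 'cV[R]_n1) (ubar : R -> 'cV[R]_n1).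
Hypotheses (T0 : 0 < T) (gam0 : 0 < gam) (HQ : psd Q) (HH : psd H).
Hypotheses (HW : std_BM P W) (Hu : L2F P W T u) (Hubar : cont_on T ubar).

Let T0' : 0 <= T := ltW T0.
Let TT : Icc 0 T T. Proof. by apply/IccP; rewrite T0' lexx. Qed.

Lemma EvE k (X : Om -> 'cV[R]_k) j : Ev P X j 0 = \int[P]_w (X w j 0).
Proof. by rewrite mxE unlock. Qed.

Lemma Rintegral_P_cst (c : R) : \int[P]_w c = c.
Proof. by rewrite /Rintegral integral_P_cst. Qed.

Lemma Ev_addr k (X : Om -> 'cV[R]_k) c : (forall j, P.-integrable setT (EFin \o (fun w => X w j 0))) ->
  Ev P (fun w => X w + c) = Ev P X + c.
Proof.
move=> iX; apply/matrixP => i j; rewrite (ord1 j) [RHS]mxE !EvE.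
under eq_Rintegral do rewrite mxE.
rewrite RintegralD//; last exact: finite_measure_integrable_cst.
by rewrite /Rintegral integral_P_cst.
Qed.

(** Integrability and value are proved in one induction, since additivity of the integral at each
    step needs integrability of the remaining sum. *)
Lemma int_lin k (X : Om -> 'cV[R]_k) (a : 'cV[R]_k) (r : seq 'I_k) :
  (forall j, P.-integrable setT (EFin \o (fun w => X w j 0))) ->
  P.-integrable setT (EFin \o (fun w => \sum_(j <- r) a j 0 * X w j 0)) /\
  \int[P]_w (\sum_(j <- r) a j 0 * X w j 0) = \sum_(j <- r) a j 0 * \int[P]_w (X w j 0).
Proof.
move=> iX.
have H1 (j : 'I_k) : P.-integrable setT (EFin \o (fun w => a j 0 * X w j 0)).
  by apply: eq_integrable (integrableZl measurableT (a j 0) (iX j)).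
elim: r => [|j r [iS ES]].
  rewrite big_nil; under eq_fun do rewrite big_nil.
  split; first exact: integrable0.
  by rewrite /Rintegral integral_P_cst.
under eq_fun do rewrite big_cons; split.
  by apply: eq_integrable (integrableD measurableT (H1 j) iS).
by rewrite big_cons RintegralD// ES RintegralZl.
Qed.

Lemma int_dot k (X : Om -> 'cV[R]_k) a :
  (forall j, P.-integrable setT (EFin \o (fun w => X w j 0))) ->
  \int[P]_w dot a (X w) = dot a (Ev P X).
Proof.
move=> iX; rewrite dotE; under eq_Rintegral do rewrite dotE.
by under eq_bigr do rewrite EvE; have [_] := int_lin a (index_enum 'I_k) iX.
Qed.

Lemma integrable_dot k (X : Om -> 'cV[R]_k) a :
  (forall j, P.-integrable setT (EFin \o (fun w => X w j 0))) ->
  P.-integrable setT (EFin \o (fun w => dot a (X w))).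
Proof.
move=> iX; under eq_fun do rewrite dotE.
by have [] := int_lin a (index_enum 'I_k) iX.
Qed.

Lemma L2Pv_dot k (X Y : R -> Om -> 'cV[R]_k) : L2Pv P T X -> L2Pv P T Y ->
  L1P P T (fun s w => dot (X s w) (Y s w)).
Proof.
move=> HX HY; under eq_fun do under eq_fun do rewrite dotE.
by apply: L1P_sum => j; exact: L2P_mul.
Qed.

Lemma L1P_dot_det k (a : R -> 'cV[R]_k) (X : R -> Om -> 'cV[R]_k) :
  bounded_measm T a -> L2Pv P T X -> L1P P T (fun s w => dot (a s) (X s w)).
Proof.
move=> ba HX; under eq_fun do under eq_fun do rewrite dotE.
by apply: L1P_sum => j; apply: (L1P_mul_det (ba j 0)); exact: L2P_L1P.
Qed.

Lemma L1P_qf k (M : 'M[R]_k) (X : R -> Om -> 'cV[R]_k) : L2Pv P T X ->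
  L1P P T (fun s w => qf M (X s w)).
Proof.
move=> HX; under eq_fun do under eq_fun do rewrite qfE.
by apply: (L2Pv_dot HX); exact: L2Pv_mul.
Qed.

Definition dev (x : R -> Om -> 'cV[R]_n) (m : R -> 'cV[R]_n) s w :=
  x s w - (Gam *m m s + eta).

Lemma L2Pv_dev x m : L2Pv P T x -> L2det T m -> L2Pv P T (dev x m).
Proof.
move=> Hx Lm; apply: (L2PvD Hx).
have H1 : L2Pv P T (fun t _ => (-1%:M) *m (Gam *m m t + eta)).
  apply: L2Pv_mul; apply: L2PvD; first by apply: L2Pv_mul; exact: L2Pv_det.
  by apply: L2Pv_det; apply: bounded_L2det; exact: bounded_measm_cst.
move=> j; have := H1 j; congr L2P; apply/funext => t; apply/funext => w.
by rewrite mulNmx mul1mx.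
Qed.

Lemma L2rv_qf (X : Om -> 'cV[R]_n) M : (forall j, L2rv P (fun w => X w j 0)) ->
  P.-integrable setT (EFin \o (fun w => qf M (X w))).
Proof.
move=> HX.
have E w : qf M (X w) = \sum_i X w i 0 * (\sum_j M i j * X w j 0).
  by rewrite qfE dotE; apply: eq_bigr => i _; rewrite mxE.
under eq_fun do rewrite E.
have HMX i : L2rv P (fun w => \sum_j M i j * X w j 0).
  by apply: L2rv_sum => j; exact: L2rvZ.
have iS (r : seq 'I_n) : P.-integrable setT
    (EFin \o (fun w => \sum_(i <- r) X w i 0 * (\sum_j M i j * X w j 0))).
  elim: r => [|i r IH].
    by under eq_fun do rewrite big_nil; exact: integrable0.
  under eq_fun do rewrite big_cons.
  by apply: eq_integrable (integrableD measurableT (L2rv_mul (HX i) (HMX i)) IH).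
exact: iS.
Qed.

Lemma costE f x m : cost P T Gam Q H Rw eta gam u f x m =
  E2 P T (fun s w => qf Q (dev x m s w)) + E2 P T (fun s w => qf Rw (u s w))
  - gam^-1 * L2sq T f + \int[P]_w qf H (x T w).
Proof. by rewrite /cost unlock. Qed.

(** Needed because [Jbar] evaluates the cost along an unspecified solution. *)
Lemma cost_unique f x m x' m' : L2det T f ->
  state_sol P T A G B D m0 x0 W u ubar f x m ->
  state_sol P T A G B D m0 x0 W u ubar f x' m' ->
  cost P T Gam Q H Rw eta gam u f x m = cost P T Gam Q H Rw eta gam u f x' m'.
Proof.
move=> Lf S S'; have [mm xx] := state_unique T0 Hu Hubar Lf S S'.
have [Lm _ Lx _] := S; have [Lm' _ Lx' _] := S'.
have [LxP _] := proj1 (L2FP _ _ _ _) Lx; have [LxP' _] := proj1 (L2FP _ _ _ _) Lx'.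
rewrite !costE.
have -> : E2 P T (fun s w => qf Q (dev x m s w)) = E2 P T (fun s w => qf Q (dev x' m' s w)).
  apply: ae_eq_E2; [by apply: L1P_qf; exact: L2Pv_dev|by apply: L1P_qf; exact: L2Pv_dev|].
  by apply: filterS xx => w xx s sT; rewrite /dev xx// mm.
have -> : \int[P]_w qf H (x T w) = \int[P]_w qf H (x' T w); last by [].
rewrite /Rintegral; congr fine; apply: ae_eq_integral.
- exact: measurableT.
- by apply: (measurable_int P); apply: L2rv_qf; exact: (state_L2rv HW Hu Lf S TT).
- by apply: (measurable_int P); apply: L2rv_qf; exact: (state_L2rv HW Hu Lf S' TT).
- by apply: filterS xx => w xx _; rewrite xx.
Qed.

Lemma intv_tail k (f : R -> 'cV[R]_k) t : Icc 0 T t -> L1m T f ->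
  intv t T f = intv 0 T f - intv 0 t f.
Proof.
move=> /IccP tT Lf; apply/matrixP => i j; rewrite !mxE.
exact: (int_tail tT (Lf i 0)).
Qed.

(** The equation of p is posed from T backwards; rewriting the tail integral as a difference gives a
    density with the opposite sign and a terminal value. *)
Lemma backward_abscont k (p b : R -> 'cV[R]_k) c : L1m T b ->
  (forall t, 0 <= t <= T -> p t = c + intv t T b) ->
  abscont_mx T p (fun t => - b t) /\ p T = c.
Proof.
move=> Lb pE; split; last by rewrite pE ?T0' ?lexx// (intv_tail TT Lb) subrr addr0.
have H1 : abscont_mx T (fun t => intv 0 t b) b.
  by apply: (@intv_abscont _ _ _ _ _ 0) => // t _; rewrite add0r.
apply: eq_abscont_mx (abscont_mxD T0' (abscont_mx_cst T (c + intv 0 T b)) (abscont_mxN T0' H1)) => //.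
- by move=> t tT; rewrite pE ?(intv_tail tT Lb) ?addrA//; apply/IccP.
- by move=> t _; rewrite add0r.
Qed.

Lemma L1m_Ev k (X : R -> Om -> 'cV[R]_k) : L2Pv P T X -> L1m T (fun s => Ev P (X s)).
Proof.
move=> HX i j; rewrite (ord1 j); under eq_fun do rewrite EvE.
by have [] := L1P_fubini (L2P_L1P (HX i)).
Qed.

(** The terms linear in z and g are twice the integral of [alpha . z] from the tracking error, minus
    twice that of [p . g] from the penalty, plus twice [p(T) . z(T)] from the terminal cost. By
    [adjoint_ip] they add up to 0, and the quadratic terms are those of [- J'']. *)
Lemma cost_shift x m p g z :
  L2det T p ->
  (forall t, 0 <= t <= T -> p t = H *m Ev P (x T) + intv t T (fun s => (A + G)^T *m p s
                 + (1 - Gam)^T *m Q *m (Ev P (x s) - (Gam *m m s + eta)))) ->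
  state_sol P T A G B D m0 x0 W u ubar (fun t => gam *: p t) x m ->
  L2det T g -> z_sol T A G g z ->
  cost P T Gam Q H Rw eta gam u (fun t => gam *: p t + g t)
    (fun t w => x t w + z t) (fun t => m t + z t) =
  cost P T Gam Q H Rw eta gam u (fun t => gam *: p t) x m - Jpp T Gam Q H gam g z.
Proof.
move=> Lp pE S Lg Hz.
have Lf : L2det T (fun t => gam *: p t) by exact: L2detZ.
have [Lm _ Lx _] := S; have [LxP _] := proj1 (L2FP _ _ _ _) Lx.
have x2 := state_L2rv HW Hu Lf S.
have xint t : Icc 0 T t -> forall j, P.-integrable setT (EFin \o (fun w => x t w j 0)).
  by move=> tT j; exact: L2rv_integrable (x2 t tT j).
have [Az z0] := z_sol_abscont T0 Lg Hz.
have bz := abscont_mx_bounded T0' Az.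
pose xi := dev x m; have Lxi : L2Pv P T xi by exact: L2Pv_dev.
pose zeta s := (1 - Gam) *m z s.
have bzeta : bounded_measm T zeta by exact: bounded_measm_mul.
pose e s := Ev P (x s) - (Gam *m m s + eta).
pose alpha s := (1 - Gam)^T *m Q *m e s.
have Le : L1m T e.
  apply: L1mD; first exact: L1m_Ev.
  apply: L1mN; apply: L1mD; first by apply: L1mZ; exact: L2det_L1m.
  by move=> i j; apply: bounded_meas_L1; exact: bounded_meas_cst.
have Lalpha : L1m T alpha by exact: L1mZ.
have [Hp pT] : abscont_mx T p (fun t => - ((A + G)^T *m p t + alpha t)) /\ p T = H *m Ev P (x T).
  by apply: backward_abscont pE; apply: L1mD => //; apply: L1mZ; exact: L2det_L1m.
have bp := abscont_mx_bounded T0' Hp.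
have IP := adjoint_ip T0' Hp Az z0.
have Lpg := L1_dot bp (L2det_L1m Lg).
have Laz : L1 T (fun t => dot (alpha t) (z t)).
  by under eq_fun do rewrite dotC; exact: L1_dot.
have Exi s : Icc 0 T s -> Ev P (xi s) = e s.
  by move=> sT; rewrite /xi /dev Ev_addr//; exact: xint.
have Qsym := proj1 HQ; have Hsym := proj1 HH.
have xi_int s : Icc 0 T s -> forall j, P.-integrable setT (EFin \o (fun w => xi s w j 0)).
  move=> sT j; have iC := @finite_measure_integrable_cst _ _ _ P setT ((- (Gam *m m s + eta)) j 0).
  apply: eq_integrable (integrableD measurableT (xint s sT j) (iC measurableT)) => // w _.
  by rewrite /= -EFinD [in RHS]mxE.
have devE s w : dev (fun t w => x t w + z t) (fun t => m t + z t) s w = xi s w + zeta s.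
  rewrite /dev /xi /zeta /dev mulmxDr mulmxBl mul1mx !opprD !addrA.
  by rewrite [LHS](ACl (1*3*5*2*4)).
have L1Q := L1P_qf Q Lxi.
have L1c : L1P P T (fun s w => dot (zeta s) (Q *m xi s w)).
  by apply: (L1P_dot_det bzeta); exact: L2Pv_mul.
have L1z : L1 T (fun s => qf Q (zeta s)).
  under eq_fun do rewrite qfE; apply: L1_dot => //.
  apply: L1mZ; exact: L2det_L1m (bounded_L2det bzeta).
(* As [zeta] is deterministic, the expectation passes onto the tracking error and only its mean [e]
   survives; moving [1 - Gam] to the other side produces [alpha]. *)
have T1c : E2 P T (fun s w => dot (zeta s) (Q *m xi s w)) =
    \int[leb]_(s in Icc 0 T) dot (alpha s) (z s).
  rewrite E2_fubini//; apply: eq_int => s sT.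
  under eq_Rintegral do rewrite dot_mulr.
  rewrite int_dot; last exact: xi_int.
  rewrite Exi// -dot_mulr /zeta [LHS]dotC [RHS]dotC /alpha -mulmxA.
  by rewrite [RHS]dot_mulr trmxK dotC.
have T1 : E2 P T (fun s w => qf Q (dev (fun t w => x t w + z t) (fun t => m t + z t) s w)) =
    E2 P T (fun s w => qf Q (xi s w)) +
    2 * (\int[leb]_(s in Icc 0 T) dot (alpha s) (z s)) +
    \int[leb]_(s in Icc 0 T) qf ((1 - Gam)^T *m Q *m (1 - Gam)) (z s).
  rewrite -T1c -(E2Z 2 L1c) -(E2D L1Q (L1PZ 2 L1c)).
  have -> : \int[leb]_(s in Icc 0 T) qf ((1 - Gam)^T *m Q *m (1 - Gam)) (z s) =
      E2 P T (fun s _ => qf Q (zeta s)).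
    rewrite E2_det; apply: eq_int => s _.
    by rewrite !qfE /zeta -!mulmxA [LHS]dot_mulr trmxK.
  rewrite -(E2D (L1PD L1Q (L1PZ 2 L1c)) (L1P_det P L1z)).
  by apply: eq_E2 => s w _; rewrite devE qfD.
have iH := L2rv_qf H (x2 T TT).
have xT := xint T TT.
have iHz : P.-integrable setT (EFin \o (fun w => 2 * dot (H^T *m z T) (x T w))).
  by apply: eq_integrable (integrableZl measurableT 2 (integrable_dot (H^T *m z T) xT)).
have T4 : \int[P]_w qf H (x T w + z T) =
    \int[P]_w qf H (x T w) + 2 * dot (z T) (H *m Ev P (x T)) + qf H (z T).
  under eq_Rintegral do rewrite (qfD _ _ Hsym) dot_mulr.
  rewrite RintegralD//; last 2 first.
  - by apply: eq_integrable (integrableD measurableT iH iHz).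
  - exact: finite_measure_integrable_cst.
  rewrite RintegralD// RintegralZl//; last exact: integrable_dot.
  by rewrite int_dot// -dot_mulr Rintegral_P_cst.
rewrite !costE T1 T4 (L2sqD T0' (bounded_measm_scale gam bp) Lg).
have -> : \int[leb]_(t in Icc 0 T) dot (gam *: p t) (g t) =
    gam * \int[leb]_(t in Icc 0 T) dot (p t) (g t).
  by rewrite -(intZ _ TT Lpg); apply: eq_int => t _; rewrite dotZl.
move: IP; rewrite pT dotC.
have -> : \int[leb]_(t in Icc 0 T) (dot (p t) (g t) - dot (alpha t) (z t)) =
    \int[leb]_(t in Icc 0 T) dot (p t) (g t) - \int[leb]_(t in Icc 0 T) dot (alpha t) (z t).
  by rewrite RintegralB.
move=> ->; rewrite /Jpp.
rewrite -[fine (\int[leb]_(t in Icc 0 T) (qf _ (z t))%:E)]/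
  (\int[leb]_(t in Icc 0 T) qf ((1 - Gam)^T *m Q *m (1 - Gam)) (z t)).
have := gt_eqF gam0; move: (E2 _ _ _) (E2 _ _ _) (L2sq _ _) (L2sq _ _) (Rintegral _ _ _) (Rintegral _ _ _)
  (Rintegral _ _ _) (Rintegral _ _ _) (qf _ _) => a1 a2 a3 a4 a5 a6 a7 a8 a9 /negbT g0.
by field.
Qed.

End Cost.

(** * The deterministic boundary value problem *)

Section Shooting.
Context {R : realType}.
Notation leb := (@lebesgue_measure R).

(** Coercivity identifies controls only almost everywhere, while integral equations hold at every t;
    this lemma bridges the two. *)
Lemma ae_eq_intv k (T t : R) (f g : R -> 'cV[R]_k) : L1m T f -> L1m T g ->
  ae_eq_on T f g -> Icc 0 T t -> intv 0 t f = intv 0 t g.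
Proof.
move=> Lf Lg fg /IccP/andP[_ tT]; apply/matrixP => i j; rewrite !mxE.
rewrite /Rintegral; congr fine; apply: ae_eq_integral; first exact: measurable_itv.
- exact: measurable_int (L1_le tT (Lf i 0)).
- exact: measurable_int (L1_le tT (Lg i 0)).
- have H := @filterS _ _ (ae_filter_ringOfSetsType leb) _ _ _ fg.
  by apply: H => s fgs st; rewrite fgs//; exact: Icc_le st.
Qed.

Lemma injective_unitmx k (N : 'M[R]_k) :
  (forall v : 'cV[R]_k, N *m v = 0 -> v = 0) -> N \in unitmx.
Proof.
move=> inj; rewrite -unitmx_tr -row_free_unit; apply: inj_row_free => v vN.
apply: trmx_inj; rewrite trmx0; apply: inj.
by apply: trmx_inj; rewrite trmx_mul trmxK trmx0.
Qed.

Lemma abscont_mx_block1 m1 m2 n (T : R) (F F' : R -> 'M[R]_(m1 + m2, n)) : 0 <= T ->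
  abscont_mx T F F' -> abscont_mx T (fun t => usubmx (F t)) (fun t => usubmx (F' t)) /\
  abscont_mx T (fun t => dsubmx (F t)) (fun t => dsubmx (F' t)).
Proof.
move=> T0 HF; split=> i j.
  by apply: eq_abscont (HF (lshift m2 i) j) => // t _; rewrite mxE.
by apply: eq_abscont (HF (rshift m1 i) j) => // t _; rewrite mxE.
Qed.

Variables (n : nat) (T : R) (A G Gam Q H : 'M[R]_n) (gam : R).
Hypotheses (T0 : 0 < T) (gam0 : 0 < gam) (HH1 : H1 T A G Gam Q H gam).

Let T0' : 0 <= T := ltW T0.
Let TT : Icc 0 T T. Proof. by apply/IccP; rewrite T0' lexx. Qed.
Let Qh : 'M[R]_n := (1 - Gam)^T *m Q *m (1 - Gam).

(** Along [g = gam *: p], duality expresses the terminal term through the two running ones, so that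
    [J''] is 0 and (H1) forces [gam *: p] to vanish almost everywhere. Then z vanishes, hence [p T],
    hence p at time 0. *)
Lemma adjoint_homogeneous (z p : R -> 'cV[R]_n) :
  abscont_mx T z (fun t => (A + G) *m z t + gam *: p t) -> z 0 = 0 ->
  abscont_mx T p (fun t => - ((A + G)^T *m p t + Qh *m z t)) ->
  p T = H *m z T -> p 0 = 0.
Proof.
move=> Hz z0 Hp pT.
have bz := abscont_mx_bounded T0' Hz; have bp := abscont_mx_bounded T0' Hp.
have bgp := bounded_measm_scale gam bp.
have Lgp := bounded_L2det bgp; have Lz := bounded_L2det bz.
have Sz : z_sol T A G (fun t => gam *: p t) z.
  by split=> // t /IccP tT; rewrite (abscont_mx_intv Hz tT) z0 add0r.
have [eps [eps0 /(_ _ _ Lgp Sz)]] := HH1.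
have Jpp0 : Jpp T Gam Q H gam (fun t => gam *: p t) z = 0.
  have := adjoint_ip T0' Hp Hz z0.
  have L1p := L2det_L1sqn (bounded_L2det bp).
  have L1q : L1 T (fun t => qf Qh (z t)).
    under eq_fun do rewrite qfE; apply: L1_dot => //.
    apply: L1mZ; exact: L2det_L1m.
  have -> : \int[leb]_(t in Icc 0 T) (dot (p t) (gam *: p t) - dot (Qh *m z t) (z t)) =
      gam * (\int[leb]_(t in Icc 0 T) sqn (p t)) - \int[leb]_(t in Icc 0 T) qf Qh (z t).
    rewrite -(intZ _ TT L1p) -RintegralB//; last exact: L1Z.
    apply: eq_int => t _; congr (_ - _); last by rewrite qfE dotC.
    by rewrite dotC dotZl.
  rewrite pT dotC -qfE => E.
  rewrite /Jpp E L2sqE.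
  have -> : \int[leb]_(t in Icc 0 T) sqn (gam *: p t) = gam ^+ 2 * \int[leb]_(t in Icc 0 T) sqn (p t).
    by rewrite -(intZ _ TT L1p); apply: eq_int => t _; rewrite sqnZ.
  rewrite -[fine _]/(\int[leb]_(t in Icc 0 T) qf Qh (z t)).
  move: (Rintegral _ _ _) (Rintegral _ _ _) (gt_eqF gam0) => a b /negbT g0.
  by field.
rewrite Jpp0 pmulr_rle0// => /(L2sq_eq0 Lgp) gp0.
(* Vanishing almost everywhere is enough to drop the forcing from the integral equation of z. *)
have zE t : Icc 0 T t -> z t = 0.
  apply: (linear_ode_unique T0' (M := A + G)) => //.
  apply: (@intv_abscont _ _ _ _ _ 0) => //; first by apply: L1mZ; exact: L2det_L1m.
  move=> s sT; rewrite (abscont_mx_intv Hz sT) z0; congr (_ + _).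
  apply: (@ae_eq_intv _ T) => //.
  - by apply: L1mD; [apply: L1mZ; exact: L2det_L1m|exact: L2det_L1m].
  - by apply: L1mZ; exact: L2det_L1m.
  - have F := @filterS _ _ (ae_filter_ringOfSetsType leb) _ _ _ gp0.
    by apply: F => r gpr rT; rewrite gpr// addr0.
have pT0 : p T = 0 by rewrite pT zE// mulmx0.
(* With z gone, p solves a homogeneous equation and this product is conserved, which carries
   [p T = 0] back to time 0. The double negation is the shape in which [mexpN_abscont] applies to
   the matrix [- (A + G)^T]. *)
have E := abscont_mx_eq0 (F := fun t => mexp (- - (A + G)^T) t *m p t) T0' _ TT.
move: E; rewrite pT0 mulmx0 mexp0 mul1mx => <-//.
have Hp' : abscont_mx T p (fun t => - (A + G)^T *m p t).
  by apply: eq_abscont_mx Hp => // t tT; rewrite zE// mulmx0 addr0 mulNmx.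
apply: eq_abscont_mx (abscont_mxM T0' (mexpN_abscont (- (A + G)^T) T0') Hp') => // t _.
by rewrite mulmxA -mulmxDl addNr mul0mx.
Qed.

(** In its use, [q] is the mean tracking error and [hT] the mean terminal state when f = 0; z is the
    correction produced by the control [gam *: p]. *)
Lemma two_point_bvp (q : R -> 'cV[R]_n) (hT : 'cV[R]_n) : L1m T q ->
  exists z p : R -> 'cV[R]_n, [/\
    abscont_mx T z (fun t => (A + G) *m z t + gam *: p t), z 0 = 0,
    abscont_mx T p (fun t => - ((A + G)^T *m p t + ((1 - Gam)^T *m Q *m q t + Qh *m z t))) &
    p T = H *m (hT + z T)].
Proof.
move=> Lq.
(* The Hamiltonian matrix of the stacked unknown (z, p). *)
pose M : 'M[R]_(n + n) := block_mx (A + G) gam%:M (- Qh) (- (A + G)^T).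
have key (xi : 'cV[R]_n) (r : R -> 'cV[R]_n) : L1m T r ->
    let Y := ode_sol M (col_mx 0 xi) (fun s => col_mx 0 (- r s)) in
    let z t := usubmx (Y t) in let p t := dsubmx (Y t) in
    [/\ abscont_mx T z (fun t => (A + G) *m z t + gam *: p t), z 0 = 0,
        abscont_mx T p (fun t => - ((A + G)^T *m p t + (r t + Qh *m z t))) & p 0 = xi].
  move=> Lr Y z p.
  have Lb : L1m T (fun s => col_mx (0 : 'cV[R]_n) (- r s)).
    move=> i j; case: (splitP i) => k ik.
      have -> : i = lshift n k by exact: val_inj.
      by under eq_fun do rewrite col_mxEu mxE; exact: L1_0.
    have -> : i = rshift n k by exact: val_inj.
    by under eq_fun do rewrite col_mxEd; exact: L1mN Lr k j.
  have HY : abscont_mx T Y (fun t => M *m Y t + col_mx 0 (- r t)) by exact: ode_sol_abscont.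
  have YE t : Y t = col_mx (z t) (p t) by rewrite vsubmxK.
  have Y0 : Y 0 = col_mx 0 xi by rewrite /Y ode_sol0.
  have [Hz Hp] := abscont_mx_block1 T0' HY.
  split.
  - apply: eq_abscont_mx Hz => // t _.
    by rewrite YE mul_block_col add_col_mx col_mxKu addr0 mul_scalar_mx.
  - by rewrite /z Y0 col_mxKu.
  - apply: eq_abscont_mx Hp => // t _.
    rewrite YE mul_block_col add_col_mx col_mxKd !mulNmx !opprD.
    by rewrite [LHS](ACl (2*3*1)) addrA.
  - by rewrite /p Y0 col_mxKd.
(* The homogeneous terminal defect [p - H z] of a stacked vector. *)
pose L : 'M[R]_(n, n + n) := row_mx (- H) 1%:M.
have LE (y : 'cV[R]_(n + n)) : L *m y = dsubmx y - H *m usubmx y.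
  by rewrite -[y in LHS]vsubmxK mul_row_col mulNmx mul1mx addrC.
(* The shooting matrix: [xi = p 0] is sent to the terminal defect of the unforced solution starting
   from (0, xi). [NE] states that the defect of the forced solution is affine in [xi] with this
   linear part. *)
pose N := L *m mexp M T *m col_mx 0 1%:M.
have NE (xi : 'cV[R]_n) b : L *m ode_sol M (col_mx 0 xi) b T = N *m xi + L *m ode_sol M 0 b T.
  rewrite /ode_sol add0r mulmxDr mulmxDr /N -!mulmxA; congr (_ *m (_ *m _) + _).
  by rewrite mul_col_mx mul0mx mul1mx.
have Nunit : N \in unitmx.
  apply: injective_unitmx => xi Nxi.
  have L0 : L1m T (fun=> 0 : 'cV[R]_n) by move=> i j; under eq_fun do rewrite mxE; exact: L1_0.
  have [Hz z0 Hp p0] := key xi _ L0.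
  rewrite -p0; apply: (adjoint_homogeneous Hz z0).
    by apply: eq_abscont_mx Hp => // t _; rewrite add0r.
  apply/subr0_eq; rewrite -LE NE Nxi add0r /ode_sol add0r.
  have -> : intv 0 T (fun s => mexp (- M) s *m col_mx (0 : 'cV[R]_n) (- 0 : 'cV[R]_n)) = 0.
    have Z : abscont_mx T (cst (0 : 'cV[R]_(n + n))) (cst 0) := abscont_mx_cst T 0.
    have := abscont_mx_intv Z TT; rewrite add0r => E; rewrite [RHS]E.
    by apply: eq_intv => s _; rewrite oppr0 col_mx0 mulmx0.
  by rewrite !mulmx0.
have Lr : L1m T (fun s => (1 - Gam)^T *m Q *m q s) by exact: L1mZ.
pose b s : 'cV[R]_(n + n) := col_mx 0 (- ((1 - Gam)^T *m Q *m q s)).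
(* Chosen so that the terminal defect [p T - H z T] equals [H *m hT]. *)
pose xi := invmx N *m (H *m hT - L *m ode_sol M 0 b T).
have [Hz z0 Hp p0] := key xi _ Lr.
do 2 eexists; split; [exact: Hz|exact: z0|exact: Hp|].
apply/subr0_eq; rewrite mulmxDr opprD addrCA -LE NE mulKVmx//.
by rewrite subrK addNr.
Qed.

End Shooting.

(** * The forward-backward system *)

Section Main.
Context {R : realType} {d : measure_display} {Om : measurableType d}.
Variable P : probability Om R.
Notation leb := (@lebesgue_measure R).
Variables (n n1 n2 : nat) (T : R) (A G Gam Q H : 'M[R]_n) (B : 'M[R]_(n, n1))
  (D : 'M[R]_(n, n2)) (Rw : 'M[R]_n1) (eta m0 x0 : 'cV[R]_n) (gam : R)
  (W : R -> Om -> 'cV[R]_n2)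
  (u : R -> Om -> 'cV[R]_n1) (ubar : R -> 'cV[R]_n1).
Hypotheses (T0 : 0 < T) (gam0 : 0 < gam) (HQ : psd Q) (HH : psd H).
Hypotheses (HW : std_BM P W) (HH1 : H1 T A G Gam Q H gam)
  (Hu : L2F P W T u) (Hubar : cont_on T ubar).

Let T0' : 0 <= T := ltW T0.
Let TT : Icc 0 T T. Proof. by apply/IccP; rewrite T0' lexx. Qed.

Local Notation state := (state_sol P T A G B D m0 x0 W u ubar).
Local Notation costf := (cost P T Gam Q H Rw eta gam u).
Local Notation J := (Jbar P T A G Gam Q H B D Rw eta m0 x0 gam W u ubar).
Local Notation fb := (fb_sol P T A G Gam Q H B D eta m0 x0 gam W u ubar).

(** The given solution shows that [epsilon] picks a genuine one, and all solutions have the same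
    cost. *)
Lemma JbarE f x m : L2det T f -> state f x m -> J f = costf f x m.
Proof.
move=> Lf S; rewrite /Jbar; set xm := ClassicalEpsilon.epsilon _ _.
have Sxm : state f xm.1 xm.2.
  apply: (@ClassicalEpsilon.epsilon_spec _ _ (fun xm => state f xm.1 xm.2)).
  by exists (x, m).
exact: (cost_unique _ _ _ _ _ _ T0 HW Hu Hubar Lf Sxm S).
Qed.

Lemma ae_eq_state f f' x m : L2det T f -> L2det T f' -> ae_eq_on T f f' ->
  state f x m -> state f' x m.
Proof.
move=> Lf Lf' ff' S; have [Lm mE Lx xE] := S.
have [LxP _] := proj1 (L2FP _ _ _ _) Lx.
have LuP := L2Pv_u Hu.
have ff (h : R -> 'cV[R]_n) : ae_eq_on T (fun t => h t + f t) (fun t => h t + f' t).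
  have F := @filterS _ _ (ae_filter_ringOfSetsType leb) _ _ _ ff'.
  by apply: F => t ft tT; rewrite ft.
split; [exact: Lm| |exact: Lx|].
- move=> t tT; rewrite mE//; congr (_ + _); apply: (@ae_eq_intv _ _ T) => //.
  + apply: L1mD; last exact: L2det_L1m.
    by apply: L1mD; apply: L1mZ; [exact: L2det_L1m|exact: cont_on_L1m].
  + apply: L1mD; last exact: L2det_L1m.
    by apply: L1mD; apply: L1mZ; [exact: L2det_L1m|exact: cont_on_L1m].
- apply: filterS3 xE (L2Pv_ae LxP) (L2Pv_ae LuP) => w xw Lxw Luw t tT.
  have Lh : L1m T (fun s => A *m x s w + B *m u s w + G *m m s).
    apply: L1mD; last by apply: L1mZ; exact: L2det_L1m.
    by apply: L1mD; exact: L1mZ.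
  rewrite xw//; congr (_ + _ + _); apply: (@ae_eq_intv _ _ T) => //.
  + by apply: L1mD => //; exact: L2det_L1m.
  + by apply: L1mD => //; exact: L2det_L1m.
Qed.

Lemma fb_state x m p : fb x m p -> state (fun t => gam *: p t) x m.
Proof. by move=> [[Lx Lm Lp] xE mE _]; split. Qed.

(** The gap is kept quantitative, rather than stating maximality alone, because uniqueness of the
    maximizer and of the system both use it. It is (H1) applied to the difference [g] between f and
    [gam *: p]. *)
Lemma fb_max x m p : fb x m p -> exists2 eps : R, 0 < eps & forall f, L2det T f ->
  J f <= J (fun t => gam *: p t) - eps * L2sq T (fun t => f t - gam *: p t).
Proof.
move=> S; have Sx := fb_state S; have [[_ _ Lp] _ _ pE] := S.
have [eps [eps0 Heps]] := HH1; exists eps => // f Lf.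
have Lgp : L2det T (fun t => gam *: p t) by exact: L2detZ.
pose g t := f t - gam *: p t.
have Lg : L2det T g.
  have -> : g = (fun t => f t + (- gam) *: p t) by apply/funext => t; rewrite scaleNr.
  by apply: L2detD => //; exact: L2detZ.
have [z Sz] := z_exists A G T0 Lg.
have Sf := state_shift T0 Hu Hubar Lgp Lg Sx Sz.
have fE : (fun t => gam *: p t + g t) = f by apply/funext => t; rewrite /g addrC subrK.
have C := cost_shift Rw T0 gam0 HQ HH HW Hu Lp pE Sx Lg Sz.
have Jf := JbarE (L2detD Lgp Lg) Sf.
have := etrans Jf (etrans C (congr1 (fun c => c - _) (esym (JbarE Lgp Sx)))).
rewrite fE => ->; rewrite lerD2l lerN2; exact: Heps Lg Sz.
Qed.

Lemma fb_exists : exists x m p, fb x m p.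
Proof.
pose f0 : R -> 'cV[R]_n := fun=> 0.
have Lf0 : L2det T f0 by apply: bounded_L2det => i j; exact: bounded_meas_cst.
have [x [m S]] := state_exists A G B D m0 x0 T0 HW Hu Hubar Lf0.
have [Lm _ Lx _] := S; have [LxP _] := proj1 (L2FP _ _ _ _) Lx.
have xint t : Icc 0 T t -> forall j, P.-integrable setT (EFin \o (fun w => x t w j 0)).
  by move=> tT j; exact: L2rv_integrable (state_L2rv HW Hu Lf0 S tT j).
pose q s := Ev P (x s) - (Gam *m m s + eta).
have Lq : L1m T q.
  apply: L1mD; first exact: L1m_Ev.
  apply: L1mN; apply: L1mD; first by apply: L1mZ; exact: L2det_L1m.
  by move=> i j; apply: bounded_meas_L1; exact: bounded_meas_cst.
have [z [p [Hz z0 Hp pT]]] := two_point_bvp T0 gam0 HH1 (Ev P (x T)) Lq.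
have bz := abscont_mx_bounded T0' Hz; have bp := abscont_mx_bounded T0' Hp.
have Lz := bounded_L2det bz; have Lp := bounded_L2det bp.
have Lgp : L2det T (fun t => gam *: p t) by exact: L2detZ.
have Sz : z_sol T A G (fun t => gam *: p t) z.
  by split=> // t /IccP tT; rewrite (abscont_mx_intv Hz tT) z0 add0r.
have S' := state_shift T0 Hu Hubar Lf0 Lgp S Sz.
exists (fun t w => x t w + z t), (fun t => m t + z t), p.
have EvE t : Icc 0 T t -> Ev P (fun w => x t w + z t) = Ev P (x t) + z t.
  by move=> tT; rewrite Ev_addr//; exact: xint.
move: S'; have -> : (fun t => f0 t + gam *: p t) = (fun t => gam *: p t).
  by apply/funext => t; rewrite add0r.
move=> [Lm' mE' Lx' xE']; split => //.
(* The right-hand side required by [fb_sol] for the shifted state. It agrees with that of the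
   boundary value problem because the shift by z moves the mean tracking error by [(1 - Gam) z]. *)
pose b s := (A + G)^T *m p s + (1 - Gam)^T *m Q *m (Ev P (fun w => x s w + z s) - (Gam *m (m s + z s) + eta)).
have bE s : Icc 0 T s -> b s = (A + G)^T *m p s + ((1 - Gam)^T *m Q *m q s + (1 - Gam)^T *m Q *m (1 - Gam) *m z s).
  move=> sT; rewrite /b EvE// /q; congr (_ + _).
  rewrite -!mulmxA -mulmxDr -mulmxDr; congr (_ *m (_ *m _)).
  by rewrite mulmxDr mulmxBl mul1mx !opprD !addrA [LHS](ACl (1*3*5*2*4)).
have Hp' : abscont_mx T p (fun t => - b t).
  by apply: eq_abscont_mx Hp => // t tT; rewrite bE.
have Lb : L1m T b.
  move=> i j; have [LN _] := Hp' i j.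
  by apply: eq_L1 (L1N LN) => t _; rewrite mxE opprK.
move=> t /IccP tT; rewrite -[intv t T _]/(intv t T b) EvE// -pT (intv_tail tT Lb).
have Hb : abscont_mx T (fun t => intv 0 t b) b.
  by apply: (@intv_abscont _ _ _ _ _ 0) => // s _; rewrite add0r.
(* Constancy of p plus the primitive of [b], compared at t and at T, returns the backward integral
   form. *)
have Hc : abscont_mx T (fun t => p t + intv 0 t b) (cst 0).
  by apply: eq_abscont_mx (abscont_mxD T0' Hp' Hb) => // s _; rewrite addNr.
have E1 := abscont_mx_eq0 T0' Hc tT; have E2 := abscont_mx_eq0 T0' Hc TT.
by rewrite addrA E2 -E1 addrK.
Qed.

Lemma ae_eq_scale (p p' : R -> 'cV[R]_n) :
  ae_eq_on T (fun t => gam *: p t) (fun t => gam *: p' t) -> ae_eq_on T p p'.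
Proof.
move=> pp; have F := @filterS _ _ (ae_filter_ringOfSetsType leb) _ _ _ pp.
by apply: F => t E tT; apply: (scalerI (negbT (gt_eqF gam0))); exact: E.
Qed.

Lemma ae_eq_of_L2sq (f g : R -> 'cV[R]_n) : L2det T f -> L2det T g ->
  L2sq T (fun t => f t - g t) <= 0 -> ae_eq_on T f g.
Proof.
move=> Lf Lg H0.
have Ld : L2det T (fun t => f t - g t).
  have -> : (fun t => f t - g t) = (fun t => f t + (-1) *: g t).
    by apply/funext => t; rewrite scaleN1r.
  by apply: L2detD => //; exact: L2detZ.
have F := @filterS _ _ (ae_filter_ringOfSetsType leb) _ _ _ (L2sq_eq0 Ld H0).
by apply: F => t E tT; apply/subr0_eq; exact: E.
Qed.

Lemma fb_unique x m p x' m' p' : fb x m p -> fb x' m' p' ->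
  [/\ L2F_eq P T x x', ae_eq_on T m m' & ae_eq_on T p p'].
Proof.
move=> S S'.
have [[_ _ Lp] _ _ _] := S; have [[_ _ Lp'] _ _ _] := S'.
have Lgp := L2detZ gam Lp; have Lgp' := L2detZ gam Lp'.
have [e e0 Hm] := fb_max S; have [e' e0' Hm'] := fb_max S'.
have pp' : ae_eq_on T (fun t => gam *: p t) (fun t => gam *: p' t).
  (* Each of the two controls beats the other by its own quadratic gap; adding both inequalities
     leaves a sum of nonnegative gaps that is at most 0. *)
  apply: ae_eq_of_L2sq => //.
  have h1 := Hm _ Lgp'; have h2 := Hm' _ Lgp.
  have h3 := L2sq_ge0 T (fun t => gam *: p' t - gam *: p t).
  have h4 : 0 <= e * L2sq T (fun t => gam *: p' t - gam *: p t) by rewrite mulr_ge0// ltW.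
  rewrite -(pmulr_rle0 _ e0').
  move: h1 h2 h4; move: (J _) (J _) (e * _) (e' * _) => a b c c' h1 h2 h4; lra.
(* Equality of the controls almost everywhere makes the first state a solution for the second
   control, so the two states can be compared. *)
have [mm xx] := state_unique T0 Hu Hubar Lgp' (ae_eq_state Lgp Lgp' pp' (fb_state S)) (fb_state S').
split; last exact: ae_eq_scale.
- rewrite /L2F_eq.
  have [[Lx _ _] _ _ _] := S; have [[Lx' _ _] _ _ _] := S'.
  have [LxP _] := proj1 (L2FP _ _ _ _) Lx; have [LxP' _] := proj1 (L2FP _ _ _ _) Lx'.
  have Lxx : L2Pv P T (fun t w => x t w + (-1%:M) *m x' t w).
    by apply: (L2PvD LxP); exact: L2Pv_mul.
  have mS : pmeas T (fun t w => sqn (x t w - x' t w)).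
    have [+ _] := L2Pv_sqn Lxx; apply: eq_measurable_fun => -[t w] _ /=.
    by rewrite mulNmx mul1mx.
  have [m1 _ _] := tonelli P mS (fun t w => sqn_ge0 (x t w - x' t w)).
  transitivity (\int[P]_w 0)%E; last by rewrite integral_P_cst.
  apply: ae_eq_integral => //.
  apply: filterS xx => w xw _; apply: integral0_eq => t tT.
  by rewrite xw// subrr sqnE big1// => j _; rewrite mxE expr0n.
- by apply: aeW => t tT; exact: mm.
Qed.

End Main.

Theorem theorem4 (R : realType) (n n1 n2 : nat) (T : R)
  (A G Gam Q H : 'M[R]_n) (B : 'M[R]_(n, n1)) (D : 'M[R]_(n, n2))
  (Rw : 'M[R]_n1) (eta m0 : 'cV[R]_n) (gam : R)
  (d : measure_display) (Om : measurableType d) (P : probability Om R)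
  (W : R -> Om -> 'cV[R]_n2) (x0 : 'cV[R]_n)
  (u : R -> Om -> 'cV[R]_n1) (ubar : R -> 'cV[R]_n1) :
  (0 < n)%N -> (0 < n1)%N -> (0 < n2)%N -> 0 < T -> 0 < gam ->
  psd Q -> psd H -> pd Rw ->
  std_BM P W ->
  H1 T A G Gam Q H gam ->
  L2F P W T u ->
  cont_on T ubar ->
  exists fhat : R -> 'cV[R]_n,
    (* (i) fhat is the unique maximizer of f |-> bar J_i(u_i, f) over L^2 *)
    [/\ L2det T fhat,
        (forall f, L2det T f ->
           Jbar P T A G Gam Q H B D Rw eta m0 x0 gam W u ubar f
           <= Jbar P T A G Gam Q H B D Rw eta m0 x0 gam W u ubar fhat),
        (forall f', L2det T f' ->
           (forall f, L2det T f ->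
              Jbar P T A G Gam Q H B D Rw eta m0 x0 gam W u ubar f
              <= Jbar P T A G Gam Q H B D Rw eta m0 x0 gam W u ubar f') ->
           ae_eq_on T f' fhat) &
    (* (ii) the FBODE system has a unique solution, and fhat = gam p *)
        exists (x : R -> Om -> 'cV[R]_n) (m p : R -> 'cV[R]_n),
          [/\ fb_sol P T A G Gam Q H B D eta m0 x0 gam W u ubar x m p,
              (forall x' m' p',
                 fb_sol P T A G Gam Q H B D eta m0 x0 gam W u ubar x' m' p' ->
                 [/\ L2F_eq P T x x', ae_eq_on T m m' & ae_eq_on T p p']) &
              ae_eq_on T fhat (fun t => gam *: p t)]].
Proof.
move=> _ _ _ T0 gam0 HQ HH _ HW HH1 Hu Hubar.
have [x [m [p S]]] := fb_exists B D eta m0 x0 T0 gam0 HW HH1 Hu Hubar.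
have [eps eps0 Hmax] := fb_max Rw T0 gam0 HQ HH HW HH1 Hu Hubar S.
have [[_ _ Lp] _ _ _] := S; have Lgp := L2detZ gam Lp.
exists (fun t => gam *: p t); split.
- exact: Lgp.
- move=> f Lf; apply: le_trans (Hmax f Lf) _.
  by rewrite gerBl mulr_ge0 ?L2sq_ge0// ltW.
- move=> f Lf fmax; apply: ae_eq_of_L2sq => //.
  (* A second maximizer f is squeezed: J at [gam *: p] is at most J at f, which is at most J at
     [gam *: p] minus the gap, so the gap is 0. *)
  have := le_trans (fmax _ Lgp) (Hmax f Lf).
  by rewrite lerDl oppr_ge0 pmulr_rle0.
exists x, m, p; split; [exact: S| |by apply: aeW].
by move=> x' m' p'; apply: (fb_unique Rw T0 gam0 HQ HH HW HH1 Hu Hubar S).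
Qed.
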